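(* Let $(X,\mu)$ be a probability space, $\phi$ an invertible measure preserving transformation of $X$, $M=L^\infty(X,\mu)\rtimes_{\alpha_\phi}\mathbb{Z}$ the crossed product, and $U\in M$ the canonical unitary implementing $\alpha_\phi$. Let $T=U|T|\in M$ be invertible such that $|T|\in L^\infty(X,\mu)$. For $r\in[-1,1]\setminus\{0\}$, $\lambda\in(0,1)$ and $f_{r,\lambda}(x)=[1-\lambda+\lambda x^r]^{1/r}$, $$\Delta_{f_{r,\lambda}}^n(T)\to UH\qquad(n\to\infty)$$ in the strong operator topology, where $H=\bigl(E^\phi(|T|^r)\bigr)^{1/r}$.
   Context: The automorphism $\alpha_\phi$ of $L^\infty(X,\mu)$ is $\alpha_\phi(f)=f\circ\phi$. The crossed product $M=L^\infty(X,\mu)\rtimes_{\alpha_\phi}\mathbb{Z}$ is the von Neumann algebra on $L^2(X,\mu)\otimes\ell^2(\mathbb{Z})$ generated by the operators $(\pi(f)\xi)(n)=\alpha_\phi^{-n}(f)\xi(n)$, $f\in L^\infty(X,\mu)$, and the unitary $(U\xi)(n)=\xi(n-1)$; $f$ is identified with $\pi(f)$, and $UfU^*=\alpha_\phi(f)=f\circ\phi$. $E^\phi$ is the $\mu$-preserving conditional expectation of $L^\infty(X,\mu)$ onto the subalgebra of $\phi$-invariant functions. The functions $f=f_{r,\lambda}$ are representing functions of operator means (power means): operator monotone on $(0,\infty)$ with $f(1)=1$. Induced Aluthge transformation: for an invertible operator $S$ with polar decomposition $S=W|S|$ and spectral decomposition $|S|=\int_{\sigma(|S|)}s\,dE_s$,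 define $\Delta_f(S):=\int_{\sigma(|S|)}\int_{\sigma(|S|)} s f(t/s)\,dE_s\,W\,dE_t$ (double operator integral). Concretely (known fact), if $\nu$ is a probability measure on $[0,1]$ with $f(x)=\int_0^1[1-\theta+\theta x^{-1}]^{-1}d\nu(\theta)$ for $x>0$ (such $\nu$ exists), then $\Delta_f(S)=\int_0^1\int_0^\infty e^{-(1-\theta)s|S|^{-1}}\,W\,e^{-\theta s|S|^{-1}}\,ds\,d\nu(\theta)$. Iterates: $\Delta_f^0(S)=S$, $\Delta_f^n(S)=\Delta_f(\Delta_f^{n-1}(S))$. *)

(* Defs.v *)
From HB Require Import structures.
From mathcomp Require Import all_boot all_order all_algebra.
From mathcomp Require Import ring_quotient generic_quotient sesquilinear complex ring lra.
From mathcomp Require Import all_classical all_reals all_analysis.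
From mathcomp Require Import measurable_realfun.
Set Implicit Arguments.
Unset Strict Implicit.
Unset Printing Implicit Defensive.
Import Order.TTheory GRing.Theory Num.Theory.
Import numFieldNormedType.Exports.
Local Open Scope classical_set_scope.
Local Open Scope quotient_scope.
Local Open Scope ring_scope.
Local Open Scope complex_scope.

Section ComplexIntegral.
Context d (Y : measurableType d) (R : realType).
Implicit Types (f : Y -> R[i]).

Definition cmeasurable f :=
  measurable_fun [set: Y] (fun y => complex.Re (f y)) /\
  measurable_fun [set: Y] (fun y => complex.Im (f y)).

Definition cintegral (nu : {measure set Y -> \bar R}) f : R[i] :=
  Rintegral nu setT (fun y => complex.Re (f y)) +i*
  Rintegral nu setT (fun y => complex.Im (f y)).

Definition cintegrable (nu : {measure set Y -> \bar R}) f :=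
  nu.-integrable setT (fun y => (complex.Re (f y))%:E) /\
  nu.-integrable setT (fun y => (complex.Im (f y))%:E).

End ComplexIntegral.

Definition normc2 (R : realType) (z : R[i]) : R :=
  complex.Re z ^+ 2 + complex.Im z ^+ 2.

Section L2.
Context d (Y : measurableType d) (R : realType).
Variable nu : {measure set Y -> \bar R}.

Definition L2_pred : {pred (Y -> R[i]^o)} := mem [set f : Y -> R[i]^o |
  cmeasurable f /\ (\int[nu]_y (normc2 (f y))%:E < +oo)%E].

Lemma L2_predP f : f \in L2_pred <->
  cmeasurable f /\ (\int[nu]_y (normc2 (f y))%:E < +oo)%E.
Proof. by split => [/set_mem|/mem_set]. Qed.

Lemma normc2_ge0 (z : R[i]) : 0 <= normc2 z.
Proof. by rewrite addr_ge0 ?sqr_ge0. Qed.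

Lemma measurable_normc2 (f : Y -> R[i]) : cmeasurable f ->
  measurable_fun [set: Y] (EFin \o (fun y => normc2 (f y))).
Proof.
move=> [mr mi]; apply/measurable_EFinP.
by apply: measurable_funD; apply: measurable_funX.
Qed.

Lemma cmeasurableZD (a : R[i]) (f g : Y -> R[i]) :
  cmeasurable f -> cmeasurable g -> cmeasurable (fun y => a * f y + g y).
Proof.
case: a => a b [fr fi] [gr gi]; split.
  rewrite (_ : (fun _ => _) = (fun y => a * complex.Re (f y) -
      b * complex.Im (f y) + complex.Re (g y))); last first.
    by apply/funext => y; case: (f y) (g y) => [? ?] [? ?].
  by apply: measurable_funD => //; apply: measurable_funB; apply: measurable_funM.
rewrite (_ : (fun _ => _) = (fun y => a * complex.Im (f y) +
    b * complex.Re (f y) + complex.Im (g y))); last first.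
  by apply/funext => y; case: (f y) (g y) => [? ?] [? ?].
by apply: measurable_funD => //; apply: measurable_funD; apply: measurable_funM.
Qed.

Lemma normc2ZD (a u v : R[i]) :
  normc2 (a * u + v) <= 2 * normc2 a * normc2 u + 2 * normc2 v.
Proof.
case: a u v => [a b] [c d'] [e f]; rewrite /normc2 /=.
have := sqr_ge0 (a * c - b * d' - e); have := sqr_ge0 (a * d' + b * c - f).
nra.
Qed.

Lemma L2_linear_closed : linear_closed L2_pred.
Proof.
move=> a f g /L2_predP[mf If] /L2_predP[mg Ig]; apply/L2_predP.
have mfg := cmeasurableZD a mf mg; split; first exact: mfg.
have n0 (k : R) (z : R[i]) : 0 <= k -> (0 <= k%:E * (normc2 z)%:E)%E.
  by move=> k0; rewrite -EFinM lee_fin mulr_ge0 ?normc2_ge0.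
have k0 : 0 <= 2 * normc2 a by rewrite mulr_ge0 ?normc2_ge0.
have mk (k : R) (h : Y -> R[i]) : cmeasurable h ->
    measurable_fun setT (fun y => k%:E * (normc2 (h y))%:E)%E.
  by move=> mh; apply: emeasurable_funM => //; exact: measurable_normc2.
apply: (@le_lt_trans _ _ (\int[nu]_y ((2 * normc2 a)%:E * (normc2 (f y))%:E +
    2%:E * (normc2 (g y))%:E))%E).
  apply: ge0_le_integral => //=.
  - by move=> y _; rewrite lee_fin normc2_ge0.
  - exact: (measurable_normc2 mfg).
  - by apply: emeasurable_funD; exact: mk.
  - by move=> y _; rewrite -!EFinM -EFinD lee_fin; exact: normc2ZD.
rewrite ge0_integralD//=; last 4 first.
- by move=> y _; rewrite n0.
- exact: mk.
- by move=> y _; rewrite n0.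
- exact: mk.
have nz (h : Y -> R[i]) y : setT y -> (0 <= (normc2 (h y))%:E)%E.
  by rewrite lee_fin normc2_ge0.
rewrite !ge0_integralZl//; try by [exact: measurable_normc2|exact: nz].
by rewrite lte_add_pinfty// lte_mul_pinfty.
Qed.

Lemma L2_submod_closed : submod_closed L2_pred.
Proof.
split; last exact: L2_linear_closed.
apply/L2_predP; split; first by split; exact: measurable_cst.
under eq_integral do rewrite /normc2 /= expr0n /= addr0.
by rewrite integral0.
Qed.

HB.instance Definition _ := GRing.isSubmodClosed.Build _ _ L2_pred
  L2_submod_closed.

Record L2fun := MkL2fun { L2val :> Y -> R[i]^o ; L2valP : L2val \in L2_pred }.
HB.instance Definition _ := [isSub for L2val].
HB.instance Definition _ := [Choice of L2fun by <:].
HB.instance Definition _ := [SubChoice_isSubLmodule of L2fun by <:].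

(** Vectors of L^2(Y, nu) are classes of square-integrable complex functions
    modulo null functions; [repr] picks a representative of a class. *)
Definition L2null : {pred L2fun} := mem [set f : L2fun |
  {ae nu, forall y, f y = 0}].

Lemma L2nullP f : f \in L2null <-> {ae nu, forall y, f y = 0}.
Proof. by split => [/set_mem|/mem_set]. Qed.

Lemma L2null_zmod_closed : zmod_closed L2null.
Proof.
split; first by apply/L2nullP; exact: aeW.
move=> f g /L2nullP f0 /L2nullP g0; apply/L2nullP.
by apply: filterS2 f0 g0 => y /= fy gy; rewrite -[LHS]/(f y - g y) fy gy subr0.
Qed.

HB.instance Definition _ := GRing.isZmodClosed.Build _ L2null
  L2null_zmod_closed.

Definition L2space := Quotient.quot L2null.
HB.instance Definition _ := GRing.Zmodule.on L2space.
HB.instance Definition _ := EqQuotient.on L2space.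

Lemma L2_reprP (f : L2fun) :
  {ae nu, forall y, repr (\pi_L2space f) y = f y}.
Proof.
have /L2nullP : repr (\pi_L2space f) - f \in L2null.
  by rewrite Quotient.idealrBE reprK.
apply: filterS => y /= /eqP.
by rewrite -[X in X == _]/(repr (\pi_L2space f) y - f y) subr_eq0 => /eqP.
Qed.

Lemma L2piD (f g : L2fun) :
  \pi_L2space (f + g) = \pi_L2space f + \pi_L2space g.
Proof. exact: (Quotient.pi_add L2null). Qed.

Definition L2scale (a : R[i]) (u : L2space) : L2space := \pi_L2space (a *: repr u).

Lemma L2scale_pi a f : L2scale a (\pi_L2space f) = \pi_L2space (a *: f).
Proof.
rewrite /L2scale; apply/eqP; rewrite -Quotient.idealrBE -scalerBr.
apply/L2nullP.
apply: filterS (L2_reprP f) => y /= fy.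
by rewrite -[LHS]/(a *: (repr (\pi_L2space f) y - f y)) fy subrr scaler0.
Qed.

Lemma L2scaleA a b u : L2scale a (L2scale b u) = L2scale (a * b) u.
Proof.
rewrite -[u]reprK (L2scale_pi b) !(L2scale_pi _ (_ *: _)).
by rewrite (L2scale_pi (_ * _)) scalerA.
Qed.

Lemma L2scale1 : left_id 1 L2scale.
Proof. by move=> u; rewrite -[u]reprK L2scale_pi scale1r. Qed.

Lemma L2scaleDr : right_distributive L2scale +%R.
Proof.
move=> a u v; rewrite -[u]reprK -[v]reprK -L2piD.
by rewrite (L2scale_pi _ (_ + _)) scalerDr L2piD !(L2scale_pi _ (repr _)).
Qed.

Lemma L2scaleDl u : {morph L2scale^~ u : a b / a + b}.
Proof. by move=> a b; rewrite -[u]reprK !(L2scale_pi _ (repr _)) scalerDl L2piD. Qed.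

HB.instance Definition _ := GRing.Zmodule_isLmodule.Build R[i] L2space
  L2scaleA L2scale1 L2scaleDr L2scaleDl.

End L2.

Section L2dot.
Context d (Y : measurableType d) (R : realType).
Variable nu : {measure set Y -> \bar R}.
Implicit Types (f g : L2fun nu) (u v : L2space nu).

Lemma cintegralZD (a : R[i]) (f g : Y -> R[i]) :
  cintegrable nu f -> cintegrable nu g ->
  cintegral nu (fun y => a * f y + g y) = a * cintegral nu f + cintegral nu g.
Proof.
case: a => a b [fr fi] [gr gi].
have iZ k (h : Y -> R) : nu.-integrable setT (EFin \o h) ->
    nu.-integrable setT (EFin \o (fun y => k * h y)).
  move=> ih; rewrite (_ : _ \o _ = (fun y => k%:E * (EFin \o h) y)%E).
    exact: integrableZl.
  by apply/funext => y.
have iD (h k : Y -> R) : nu.-integrable setT (EFin \o h) ->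
    nu.-integrable setT (EFin \o k) ->
    nu.-integrable setT (EFin \o (fun y => h y + k y)).
  move=> ih ik; rewrite (_ : _ \o _ = ((EFin \o h) \+ (EFin \o k))%E).
    exact: integrableD.
  by apply/funext => y.
have E1 : Rintegral nu setT (fun y => complex.Re ((a +i* b) * f y + g y)) =
    Rintegral nu setT
     (fun y => a * complex.Re (f y) + (- b) * complex.Im (f y) + complex.Re (g y)).
  by congr Rintegral; apply/funext => y; case: (f y) (g y) => [? ?] [? ?] /=; rewrite mulNr.
have E2 : Rintegral nu setT (fun y => complex.Im ((a +i* b) * f y + g y)) =
    Rintegral nu setT
     (fun y => a * complex.Im (f y) + b * complex.Re (f y) + complex.Im (g y)).
  by congr Rintegral; apply/funext => y; case: (f y) (g y) => [? ?] [? ?].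
rewrite /cintegral E1 E2 !RintegralD ?RintegralZl//;
  do ?[exact: iZ | exact: measurableT | apply: iD]; last 1 first.
by rewrite mulNr; simpc.
Qed.

Lemma cintegral_conj (f : Y -> R[i]) : cintegrable nu f ->
  cintegral nu (fun y => conjc (f y)) = conjc (cintegral nu f).
Proof.
move=> [fr fi]; rewrite /cintegral /=; congr (_ +i* _).
  by congr Rintegral; apply/funext => y; case: (f y).
rewrite -[RHS]mulN1r -RintegralZl//.
by congr Rintegral; apply/funext => y; case: (f y) => ? ? /=; rewrite mulN1r.
Qed.

Lemma ae_eq_cintegral (f g : Y -> R[i]) : cintegrable nu f ->
  cintegrable nu g -> {ae nu, forall y, f y = g y} ->
  cintegral nu f = cintegral nu g.
Proof.
move=> [fr fi] [gr gi] fg; rewrite /cintegral /Rintegral.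
congr (fine _ +i* fine _); apply: ae_eq_integral => //.
- exact: (measurable_int _ fr).
- exact: (measurable_int _ gr).
- by apply: filterS fg => y /= ->.
- exact: (measurable_int _ fi).
- exact: (measurable_int _ gi).
- by apply: filterS fg => y /= ->.
Qed.

Lemma integrable_normc2 f : nu.-integrable setT (fun y => (normc2 (f y))%:E).
Proof.
have /L2_predP[mf If] := L2valP f.
apply/integrableP; split; first exact: measurable_normc2.
under eq_integral do rewrite gee0_abs ?lee_fin ?normc2_ge0//.
exact: If.
Qed.

Lemma Re_mulJ (z w : R[i]) : complex.Re (z * conjc w) =
  complex.Re z * complex.Re w + complex.Im z * complex.Im w.
Proof. by case: z w => [a b] [c e] /=; ring. Qed.

Lemma Im_mulJ (z w : R[i]) : complex.Im (z * conjc w) =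
  complex.Im z * complex.Re w - complex.Re z * complex.Im w.
Proof. by case: z w => [a b] [c e] /=; ring. Qed.

Lemma normc2_mulJ (z w : R[i]) :
  `|complex.Re (z * conjc w)| <= normc2 z + normc2 w /\
  `|complex.Im (z * conjc w)| <= normc2 z + normc2 w.
Proof.
rewrite Re_mulJ Im_mulJ; case: z w => [a b] [c e]; rewrite /normc2 /=.
have := sqr_ge0 (a - c); have := sqr_ge0 (b - e).
have := sqr_ge0 (a + c); have := sqr_ge0 (b + e).
have := sqr_ge0 (a - e); have := sqr_ge0 (b - c).
have := sqr_ge0 (a + e); have := sqr_ge0 (b + c).
by move=> *; rewrite !ler_norml; split; apply/andP; split; nra.
Qed.

Lemma cintegrable_mul f g :
  cintegrable nu (fun y => (f y : R[i]) * conjc (g y : R[i])).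
Proof.
have /L2_predP[[fr fi] _] := L2valP f.
have /L2_predP[[gr gi] _] := L2valP g.
have ifg := integrableD measurableT (integrable_normc2 f) (integrable_normc2 g).
split; apply: (le_integrable measurableT _ _ ifg).
- rewrite [X in measurable_fun _ X](_ : _ = EFin \o (fun y =>
    complex.Re (f y) * complex.Re (g y) + complex.Im (f y) * complex.Im (g y))).
    by apply/measurable_EFinP; apply: measurable_funD; apply: measurable_funM.
  by apply/funext => y /=; rewrite Re_mulJ.
- move=> y _; rewrite lee_fin [leRHS]ger0_norm ?addr_ge0 ?sqr_ge0//.
  by case: (normc2_mulJ (f y) (g y)).
- rewrite [X in measurable_fun _ X](_ : _ = EFin \o (fun y =>
    complex.Im (f y) * complex.Re (g y) - complex.Re (f y) * complex.Im (g y))).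
    by apply/measurable_EFinP; apply: measurable_funB; apply: measurable_funM.
  by apply/funext => y /=; rewrite Im_mulJ.
- move=> y _; rewrite lee_fin [leRHS]ger0_norm ?addr_ge0 ?sqr_ge0//.
  by case: (normc2_mulJ (f y) (g y)).
Qed.

Definition L2dot u v : R[i] :=
  cintegral nu (fun y => (repr u y : R[i]) * conjc (repr v y : R[i])).

Lemma L2dot_pi f g : L2dot (\pi_(L2space nu) f) (\pi_(L2space nu) g) =
  cintegral nu (fun y => (f y : R[i]) * conjc (g y : R[i])).
Proof.
apply: ae_eq_cintegral; [exact: cintegrable_mul|exact: cintegrable_mul|].
by apply: filterS2 (L2_reprP f) (L2_reprP g) => y -> ->.
Qed.

Lemma L2dotC u v : L2dot u v = (-1) ^+ false * Num.conj (L2dot v u).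
Proof.
rewrite expr0 mul1r -[u]reprK -[v]reprK !L2dot_pi.
rewrite -[RHS]/(conjc _) -cintegral_conj; last exact: cintegrable_mul.
congr cintegral; apply/funext => y.
by rewrite rmorphM /= conjcK mulrC.
Qed.

Lemma L2dotl v : linear_for *%R (L2dot^~ v).
Proof.
move=> a u w; rewrite -[u]reprK -[v]reprK -[w]reprK.
rewrite -[a *: _]/(L2scale _ _) L2scale_pi -L2piD !L2dot_pi.
rewrite -cintegralZD; [|exact: cintegrable_mul|exact: cintegrable_mul].
congr cintegral; apply/funext => y.
by rewrite mulrA -mulrDl.
Qed.

Lemma L2dotr u : linear_for (Num.conj \; *%R) (L2dot u).
Proof.
move=> a v w; rewrite L2dotC L2dotl [L2dot u v]L2dotC [L2dot u w]L2dotC.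
by rewrite !expr0 !mul1r rmorphD rmorphM.
Qed.

Lemma L2dot_gt0 u : u != 0 -> 0 < L2dot u u.
Proof.
move=> u0.
have E : L2dot u u = (Rintegral nu setT (fun y => normc2 (repr u y)))%:C.
  rewrite /L2dot /cintegral; congr (_ +i* _).
    by congr Rintegral; apply/funext => y; rewrite Re_mulJ -!expr2.
  rewrite (_ : (fun _ => _) = cst 0); last first.
    by apply/funext => y; rewrite Im_mulJ mulrC subrr.
  by rewrite /Rintegral integral0.
rewrite E ltcR lt_neqAle Rintegral_ge0 ?andbT; last first.
  by move=> y _; exact: normc2_ge0.
apply: contra u0 => /eqP/esym; rewrite /Rintegral => /eqP.
have iu := integrable_normc2 (repr u).
rewrite fine_eq0; last exact: integral_fune_fin_num.
under eq_integral do rewrite -[(normc2 _)%:E]gee0_abs ?lee_fin ?normc2_ge0//.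
move/eqP/(ae_eq_integral_abs _ measurableT (measurable_int _ iu)) => iu0.
have pi0 : \pi_(L2space nu) 0 = 0.
  by apply: (addrI (\pi_(L2space nu) 0)); rewrite -L2piD !addr0.
rewrite -[u]reprK -pi0 -Quotient.idealrBE subr0.
apply/L2nullP; apply: filterS iu0 => y /= /(_ Logic.I) []; rewrite /normc2.
move/eqP; rewrite paddr_eq0 ?sqr_ge0// !sqrf_eq0 => /andP[/eqP r0 /eqP i0].
by apply/eqP; rewrite eq_complex r0 i0 !eqxx.
Qed.

HB.instance Definition _ := @bilinear_isBilinear.Build R[i] (L2space nu)
  (L2space nu) R[i] *%R (Num.conj \; *%R) L2dot (L2dotl, L2dotr).
HB.instance Definition _ := @isHermitianSesquilinear.Build R[i] (L2space nu)
  false Num.conj L2dot L2dotC.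
HB.instance Definition _ := @isDotProduct.Build R[i] (L2space nu)
  L2dot L2dot_gt0.

End L2dot.

Section Operators.
Context (R : realType) (V : lmodType R[i]) (dot : {dot V for Num.conj}).
Implicit Types (A D P S W : V -> V) (x y : V).

Definition hnorm x : R := Num.sqrt (complex.Re (dot x x)).

Definition bounded_op A :=
  linear A /\ exists k : R, forall x, hnorm (A x) <= k * hnorm x.

Definition invertible_op A :=
  bounded_op A /\ exists B, [/\ bounded_op B, cancel A B & cancel B A].

Definition is_adjoint A (B : V -> V) :=
  [/\ bounded_op A, bounded_op B & forall x y, dot (A x) y = dot x (B y)].

Definition positive_op A := bounded_op A /\ forall x, 0 <= dot (A x) x.

Definition orth_projection A :=
  [/\ bounded_op A, A \o A = A & forall x y, dot (A x) y = dot x (A y)].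

Definition sot_cvg (An : nat -> V -> V) A :=
  forall x, hnorm (An n x - A x) @[n --> \oo] --> (0 : R).

Definition commutant (F : set (V -> V)) : set (V -> V) :=
  [set A | bounded_op A /\ forall B, F B -> A \o B = B \o A].

(** The double commutant of the self-adjoint set F u F^*. *)
Definition vN_generated (F : set (V -> V)) : set (V -> V) :=
  commutant (commutant [set A | F A \/ exists2 B, F B & is_adjoint B A]).

(** P = |S| = (S^* S)^(1/2): the last clause says P^2 = S^* S. *)
Definition absolute_value S P :=
  [/\ bounded_op S, positive_op P &
      forall x y, dot (P (P x)) y = dot (S x) (S y)].

(** W is a partial isometry with the same kernel as S. *)
Definition polar_decomposition S W P :=
  [/\ absolute_value S P, bounded_op W, S = W \o P,
      (forall x, W x = 0 <-> S x = 0) &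
      (forall x, (forall y, W y = 0 -> dot x y = 0) -> hnorm (W x) = hnorm x)].

Definition spectrum A : set R[i] :=
  [set z | ~ invertible_op (fun x => A x - z *: x)].

Definition real_spectrum A : set R := [set s | spectrum A s%:C].

(** A projection-valued Borel measure [E] carried by [K]; countable additivity
    is expressed by asking that every B |-> <E(B) x, x> be a measure. *)
Definition spectral_marginal (E : set (measurableTypeR R) -> V -> V) x
    (m : {finite_measure set (measurableTypeR R) -> \bar R}) :=
  forall B, measurable B -> m B = (complex.Re (dot (E B x) x))%:E.

Definition spectral_measure (K : set R)
    (E : set (measurableTypeR R) -> V -> V) :=
  [/\ forall B, measurable B -> orth_projection (E B),
      E setT = id,
      forall B C, measurable B -> measurable C -> E (B `&` C) = E B \o E C,
      forall B, measurable B -> B `&` K = set0 -> E B = (fun=> 0) &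
      forall x, exists m, spectral_marginal E x m].

(** A = \int_K g(s) dE_s for a real-valued function g. *)
Definition spectral_integral (K : set R)
    (E : set (measurableTypeR R) -> V -> V) (g : measurableTypeR R -> R) A :=
  bounded_op A /\ forall x m, spectral_marginal E x m ->
    m.-integrable K (EFin \o g) /\
    dot (A x) x = (Rintegral m K g)%:C.

Definition spectral_decomposition P E :=
  spectral_measure (real_spectrum P) E /\
  spectral_integral (real_spectrum P) E id P.

(** D = \int_K \int_K psi(s, t) dE_s W dE_t.  The symbol psi lies in the
    integral projective tensor product, psi(s, t) =
    \int_Omega alpha(s, w) beta(t, w) dsigma(w) on K x K with
    \int_Omega sup|alpha(., w)| sup|beta(., w)| dsigma(w) < oo, and then
    D = \int_Omega (\int alpha(s, w) dE_s) W (\int beta(t, w) dE_t) dsigma(w)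
    in the weak sense; this does not depend on the chosen factorization.  For
    a real symbol, real-valued factors lose no generality. *)
Definition double_operator_integral (K : set R)
    (E : set (measurableTypeR R) -> V -> V) (psi : R -> R -> R) W D :=
  bounded_op D /\
  exists (d : measure_display) (Omega : measurableType d)
    (sigma : {sigma_finite_measure set Omega -> \bar R})
    (alpha beta : Omega -> measurableTypeR R -> R) (a b : Omega -> R)
    (Alpha Beta : Omega -> V -> V),
  [/\ measurable_fun [set: Omega * measurableTypeR R]
        (fun p => alpha p.1 p.2) /\
      measurable_fun [set: Omega * measurableTypeR R]
        (fun p => beta p.1 p.2),
      forall w s, K s -> `|alpha w s| <= a w /\ `|beta w s| <= b w,
      sigma.-integrable setT (EFin \o (fun w => a w * b w)),
      forall s t, K s -> K t ->
        psi s t = Rintegral sigma setT (fun w => alpha w s * beta w t) &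
      (forall w, spectral_integral K E (alpha w) (Alpha w) /\
                 spectral_integral K E (beta w) (Beta w)) /\
      forall x y, dot (D x) y =
        cintegral sigma (fun w => dot (Alpha w (W (Beta w x))) y)].

Definition is_induced_aluthge (f : R -> R) S D :=
  exists W P E, [/\ polar_decomposition S W P, spectral_decomposition P E &
    double_operator_integral (real_spectrum P) E
      (fun s t => s * f (t / s)) W D].

(** On a Hilbert space, and for f the representing function of an operator mean,
    every invertible S has exactly one D with [is_induced_aluthge f S D]; the
    default value 0 is used only when there is no such D. *)
Definition induced_aluthge (f : R -> R) S : V -> V :=
  xget (fun=> 0) [set D | is_induced_aluthge f S D].

End Operators.

Definition power_mean (R : realType) (r lambda x : R) : R :=
  (1 - lambda + lambda * x `^ r) `^ r^-1.

HB.instance Definition _ := isPointed.Build int 0.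
HB.instance Definition _ := @isMeasurable.Build default_measure_display int
  discrete_measurable discrete_measurable0 discrete_measurableC
  discrete_measurableU.

Definition zcounting (R : realType) : set int -> \bar R := @counting int R.
HB.instance Definition _ (R : realType) :=
  Measure.copy (@zcounting R) (@counting int R).

Lemma sigma_finite_zcounting (R : realType) :
  sigma_finite [set: int] (@zcounting R).
Proof.
pose F (n : nat) := [set (k%:Z : int) | k in `I_n] `|`
                    [set (- k%:Z : int) | k in `I_n].
exists F.
  apply/seteqP; split => // z _.
  exists `|z|.+1%N => //; case: (lerP 0 z) => z0.
    by left; exists `|z|%N => //=; rewrite gez0_abs.
  by right; exists `|z|%N => //=; rewrite ltz0_abs// opprK.
move=> n; split => //; rewrite /zcounting /counting /= asboolT ?ltry//.
by rewrite finite_setU; split; exact/finite_image/finite_II.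
Qed.

HB.instance Definition _ (R : realType) :=
  @Measure_isSigmaFinite.Build _ _ _ (@zcounting R) (sigma_finite_zcounting R).

Section CrossedProduct.
Context (R : realType) (d : measure_display) (X : measurableType d).
Variable mu : probability X R.
Implicit Types (f : X -> R[i]) (g h : X -> R).

(** phi is an invertible measure preserving transformation, with inverse psi
    up to null sets. *)
Definition invertible_mpt (phi psi : X -> X) :=
  [/\ measurable_fun [set: X] phi, measurable_fun [set: X] psi,
      forall A, measurable A -> mu (phi @^-1` A) = mu A,
      {ae mu, forall x, phi (psi x) = x} &
      {ae mu, forall x, psi (phi x) = x}].

Definition zpow (phi psi : X -> X) (n : int) : X -> X :=
  match n with Posz k => iter k phi | Negz k => iter k.+1 psi end.

Definition Linfty f :=
  cmeasurable f /\ exists C : R, {ae mu, forall x, `|f x| <= C%:C}.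

Definition toC h : X -> R[i] := fun x => (h x)%:C.

(** L^2(X, mu) (x) l^2(Z), realized as L^2(X x Z), with xi(n) = xi(., n). *)
Definition XZmeasure : {measure set (X * int) -> \bar R} :=
  (mu \x @zcounting R)%E.
Definition XZspace := L2space XZmeasure.
Definition XZdot : {dot XZspace for Num.conj} := @L2dot _ _ R XZmeasure.

Definition mkL2 (F : X * int -> R[i]) : XZspace :=
  if insub (F : X * int -> R[i]^o) is Some G
  then \pi_(L2space XZmeasure) (G : L2fun XZmeasure) else 0.

(** (pi(f) xi)(n) = alpha_phi^(-n)(f) xi(n) with alpha_phi(f) = f o phi. *)
Definition cp_pi (phi psi : X -> X) f : XZspace -> XZspace := fun xi =>
  mkL2 (fun p => f (zpow phi psi (- p.2) p.1) * (repr xi p : R[i])).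

Definition cp_shift : XZspace -> XZspace := fun xi =>
  mkL2 (fun p => repr xi (p.1, p.2 - 1)).

Definition crossed_product (phi psi : X -> X) : set (XZspace -> XZspace) :=
  vN_generated XZdot
    [set A | (exists2 f, Linfty f & A = cp_pi phi psi f) \/ A = cp_shift].

(** E^phi(g) for real g in L^oo: the essentially bounded phi-invariant function
    with the same integral as g against every phi-invariant L^oo function. *)
Definition is_invariant_expectation (phi : X -> X) g h :=
  [/\ Linfty (toC h), {ae mu, forall x, h (phi x) = h x} &
      forall k : X -> R, Linfty (toC k) -> {ae mu, forall x, k (phi x) = k x} ->
        Rintegral mu setT (fun x => h x * k x) =
        Rintegral mu setT (fun x => g x * k x)].

Definition invariant_expectation (phi : X -> X) g : X -> R :=
  xget (fun=> 0) [set h | is_invariant_expectation phi g h].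

End CrossedProduct.

Arguments XZspace {R d X} mu.
Arguments XZdot {R d X} mu.
Arguments cp_pi {R d X} mu phi psi f xi.
Arguments cp_shift {R d X} mu xi.
Arguments crossed_product {R d X} mu phi psi.

(* Main.v *)
(** Write U for the shift and M_g for the multiplication operator on
    L^2(X x Z) attached to a function g on X by pi, so that T = U M_a with
    a = |T| bounded away from 0.  The projections of any spectral decomposition
    of M_g commute with M_g and are separated by the growth of powers, hence
    they are the indicator functions of g, and the double operator integral can
    be computed pointwise: the transform of U M_g is U M_g' with
    g'^r = (1 - l) (g o psi)^r + l g^r, because s f(t/s) is the weighted power
    mean of s and t.  Thus the n-th iterate is U M_(u_n)^(1/r), where u_n is the
    n-th iterate on |T|^r of the averaging operator A u = (1 - l) u o psi + l u.
    Since |A u|^2 = |u|^2 - l (1 - l) |u - u o psi|^2, a parallelogram argument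
    as in the mean ergodic theorem makes u_n converge in L^2(mu), and the limit
    is the invariant expectation of |T|^r.  All functions stay in a compact
    subinterval of (0, oo), on which x^(1/r) is Lipschitz, and bounded
    L^2-convergence of the multipliers gives strong convergence. *)
Require Import Defs.
From HB Require Import structures.
From mathcomp Require Import all_boot all_order all_algebra.
From mathcomp Require Import ring_quotient generic_quotient sesquilinear complex ring lra.
From mathcomp Require Import all_classical all_reals all_analysis.
From mathcomp Require Import measurable_realfun.
From mathcomp Require finmap.
Set Implicit Arguments.
Unset Strict Implicit.
Unset Printing Implicit Defensive.
Import Order.TTheory GRing.Theory Num.Theory.
Import numFieldNormedType.Exports.
Local Open Scope classical_set_scope.
Local Open Scope quotient_scope.
Local Open Scope ring_scope.
Local Open Scope complex_scope.

(** * Positive operators *)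

Section InnerProduct.
Context (R : realType) (V : lmodType R[i]) (dot : {dot V for Num.conj}).
Implicit Types (A B G P : V -> V) (x y u v : V) (z : R[i]).

(** The obstacle is that [induced_aluthge] selects its value by [xget] from a relation ranging over
    every polar decomposition, every spectral measure and every factorization of the symbol. Each
    step therefore needs an instance of the relation and a proof that no other operator satisfies
    it. Uniqueness is drawn from quadratic forms alone: if the form of [G] is at most [s] on a
    subspace stable under [G] and at least [s' > s] on one stable under its inverse, then (u, v) =
    (G^n u, G^-n v) is O((s / s')^n), so the two are orthogonal. This compares an arbitrary spectral
    measure with the indicator projections on rays, up to an arbitrarily small gap. Existence needs
    the power mean of two variables as an integral of products of one-variable functions; a
    truncated fundamental theorem of calculus provides it. All multipliers are kept within fixed
    bounds at every point, not only almost everywhere, so that products, compositions and clamped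
    limits remain bounded operators; essentially bounded data are replaced by such representatives
    at the beginning of the final argument. *)

Definition rdot x y : R := complex.Re (dot x y).
Definition nsq x : R := rdot x x.

Lemma dotC x y : dot x y = conjc (dot y x).
Proof. by rewrite hermC expr0 mul1r. Qed.

Lemma dotDl x y u : dot (x + y) u = dot x u + dot y u.
Proof. exact: linearDl. Qed.

Lemma dotDr x y u : dot u (x + y) = dot u x + dot u y.
Proof. by rewrite dotC dotDl rmorphD /= -!dotC. Qed.

Lemma dotZl z x u : dot (z *: x) u = z * dot x u.
Proof. exact: linearZl_LR. Qed.

Lemma dotZr z x u : dot u (z *: x) = conjc z * dot u x.
Proof. by rewrite dotC dotZl rmorphM /= -dotC. Qed.

Lemma dot0l u : dot 0 u = 0.
Proof. by rewrite -[0 in LHS](scale0r (0 : V)) dotZl mul0r. Qed.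

Lemma rdotC x y : rdot x y = rdot y x.
Proof. by rewrite /rdot dotC; case: (dot y x). Qed.

Lemma rdotDl x y u : rdot (x + y) u = rdot x u + rdot y u.
Proof. by rewrite /rdot dotDl raddfD. Qed.

Lemma rdotDr x y u : rdot u (x + y) = rdot u x + rdot u y.
Proof. by rewrite rdotC rdotDl !(rdotC u). Qed.

Lemma rdotZl (a : R) x u : rdot (a%:C *: x) u = a * rdot x u.
Proof. by rewrite /rdot dotZl; case: (dot x u) => b c /=; rewrite mul0r subr0. Qed.

Lemma rdotZr (a : R) x u : rdot u (a%:C *: x) = a * rdot u x.
Proof. by rewrite rdotC rdotZl rdotC. Qed.

Lemma rdotNl x u : rdot (- x) u = - rdot x u.
Proof. by rewrite -scaleN1r /rdot dotZl mulN1r raddfN. Qed.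

Lemma rdotNr x u : rdot u (- x) = - rdot u x.
Proof. by rewrite rdotC rdotNl rdotC. Qed.

Lemma rdotBl x y u : rdot (x - y) u = rdot x u - rdot y u.
Proof. by rewrite rdotDl rdotNl. Qed.

Lemma rdotBr x y u : rdot u (x - y) = rdot u x - rdot u y.
Proof. by rewrite rdotDr rdotNr. Qed.

Lemma rdot0l u : rdot 0 u = 0.
Proof. by rewrite /rdot dot0l. Qed.

Lemma rdot_i x y : rdot x ('i *: y) = complex.Im (dot x y).
Proof. by rewrite /rdot dotZr; case: (dot x y) => b c /=; ring. Qed.

Lemma dotE x y : dot x y = rdot x y +i* rdot x ('i *: y).
Proof. by rewrite rdot_i /rdot; case: (dot x y). Qed.

Lemma dotxx x : dot x x = (nsq x)%:C.
Proof.
have : dot x x = conjc (dot x x) by exact: dotC.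
rewrite /nsq /rdot; case: (dot x x) => a b /= [] bb.
by congr (_ +i* _); lra.
Qed.

Lemma nsq_ge0 x : 0 <= nsq x.
Proof.
have [->|x0] := eqVneq x 0; first by rewrite /nsq rdot0l.
by have := dnorm_gt0 dot x; rewrite x0 dotxx ltcR => /ltW.
Qed.

Lemma nsq_eq0 x : nsq x = 0 -> x = 0.
Proof.
move=> x0; apply/eqP; apply/negPn/negP => nx.
by have := dnorm_gt0 dot x; rewrite nx dotxx x0 ltxx.
Qed.

Lemma nsq0 : nsq 0 = 0.
Proof. exact: rdot0l. Qed.

Lemma nsqN x : nsq (- x) = nsq x.
Proof. by rewrite /nsq rdotNl rdotNr opprK. Qed.

Lemma nsqZ (a : R) x : nsq (a%:C *: x) = a ^+ 2 * nsq x.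
Proof. by rewrite /nsq rdotZl rdotZr mulrA expr2. Qed.

Lemma nsqD x y : nsq (x + y) = nsq x + 2 * rdot x y + nsq y.
Proof. by rewrite /nsq rdotDl !rdotDr (rdotC y x); ring. Qed.

Lemma nsqB x y : nsq (x - y) = nsq x - 2 * rdot x y + nsq y.
Proof. by rewrite nsqD rdotNr nsqN; ring. Qed.

Lemma rdot_CS x y : rdot x y ^+ 2 <= nsq x * nsq y.
Proof.
have [->|y0] := eqVneq y 0; first by rewrite rdotC rdot0l nsq0 expr0n mulr0.
have yp : 0 < nsq y.
  rewrite lt_neqAle nsq_ge0 andbT; apply: contra y0 => /eqP y0.
  by apply/eqP/nsq_eq0.
have := nsq_ge0 ((nsq y)%:C *: x - (rdot x y)%:C *: y).
rewrite nsqB !nsqZ rdotZl rdotZr.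
rewrite (_ : _ + _ = nsq y * (nsq x * nsq y - rdot x y ^+ 2)); last by ring.
by rewrite pmulr_rge0// subr_ge0.
Qed.

Lemma rdot_ext x y : (forall u, rdot x u = rdot y u) -> x = y.
Proof.
move=> e; apply/eqP; rewrite -subr_eq0; apply/eqP/nsq_eq0.
by rewrite /nsq rdotBl e subrr.
Qed.

Lemma dot_ext x y : (forall u, dot x u = dot y u) -> x = y.
Proof. by move=> e; apply: rdot_ext => u; rewrite /rdot e. Qed.

Lemma hnormE x : hnorm dot x = Num.sqrt (nsq x).
Proof. by []. Qed.

Lemma sqr_hnorm x : hnorm dot x ^+ 2 = nsq x.
Proof. by rewrite hnormE sqr_sqrtr// nsq_ge0. Qed.

Lemma hnorm_ge0 x : 0 <= hnorm dot x.
Proof. exact: sqrtr_ge0. Qed.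

Lemma bounded_opP A : linear A ->
  (exists k, forall x, nsq (A x) <= k * nsq x) -> bounded_op dot A.
Proof.
move=> lA [k kA]; split => //; exists (Num.sqrt `|k|) => x.
rewrite !hnormE -sqrtrM// ler_wsqrtr// (le_trans (kA x))//.
by rewrite ler_wpM2r ?nsq_ge0// ler_norm.
Qed.

Lemma bounded_op_nsq A : bounded_op dot A ->
  exists2 k, 0 <= k & forall x, nsq (A x) <= k * nsq x.
Proof.
move=> [_ [k kA]]; exists (k ^+ 2) => [|x]; first exact: sqr_ge0.
rewrite -!sqr_hnorm -exprMn ler_pXn2r// nnegrE ?hnorm_ge0//.
exact: le_trans (hnorm_ge0 _) (kA x).
Qed.

Section Linear.
Variables (A : V -> V) (lA : linear A).
Let f : {linear V -> V} := HB.pack A (GRing.isLinear.Build _ _ _ _ A lA).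
Lemma linD x y : A (x + y) = A x + A y. Proof. exact: (linearD f). Qed.
Lemma linB x y : A (x - y) = A x - A y. Proof. exact: (linearB f). Qed.
Lemma linZ z x : A (z *: x) = z *: A x. Proof. exact: (linearZ_LR f). Qed.
Lemma lin0 : A 0 = 0. Proof. exact: (linear0 f). Qed.
End Linear.

Lemma linear_sub A B : linear A -> linear B -> linear (fun x => A x - B x).
Proof.
by move=> lA lB z x y; rewrite lA lB scalerBr opprD addrACA.
Qed.

Lemma linear_comp A B : linear A -> linear B -> linear (A \o B).
Proof. by move=> lA lB z x y /=; rewrite lB lA. Qed.

Lemma bounded_op_comp A B :
  bounded_op dot A -> bounded_op dot B -> bounded_op dot (A \o B).
Proof.
move=> bA bB; have [k k0 kA] := bounded_op_nsq bA.
have [l l0 lB] := bounded_op_nsq bB; apply: bounded_opP.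
  exact: linear_comp bA.1 bB.1.
exists (k * l) => x /=; apply: (le_trans (kA _)).
by rewrite -mulrA ler_wpM2l.
Qed.

(** Polarization over the complex scalars: [x + y] kills the sum of the two cross terms and
    [x + 'i *: y] kills their difference. *)
Lemma quadratic_form_eq0 A : linear A ->
  (forall x, dot (A x) x = 0) -> forall x, A x = 0.
Proof.
move=> lA A0 x; apply: dot_ext => y; rewrite dot0l.
have := A0 (x + y); rewrite (linD lA) dotDl !dotDr !A0 add0r addr0 => e1.
have := A0 (x + 'i *: y); rewrite (linD lA) (linZ lA) dotDl !dotDr.
rewrite !dotZl !dotZr !A0 !mulr0 addr0 add0r.
move: e1; case: (dot (A x) y) (dot (A y) x) => a b [c d] /=.
move=> [e1 e2] [e3 e4].
by congr (_ +i* _); lra.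
Qed.

Lemma quadratic_form_inj A B : linear A -> linear B ->
  (forall x, dot (A x) x = dot (B x) x) -> A = B.
Proof.
move=> lA lB AB; apply/funext => x; apply/eqP; rewrite -subr_eq0; apply/eqP.
apply: (quadratic_form_eq0 (linear_sub lA lB)) => y.
rewrite -scaleN1r dotDl AB dotZl mulN1r subrr//.
Qed.

Lemma positive_rdot A x : positive_op dot A -> 0 <= rdot (A x) x.
Proof.
move=> [_ /(_ x)]; rewrite lecE => /andP[_]; exact.
Qed.

(* [(P + k) (P - G) = (P - G) (k - G)], where [P + k] expands by at least [k]
   and [k - G] contracts by [q < 1] relative to [k]. *)
Lemma positive_sqrt_unique P G (k q : R) : positive_op dot P -> linear G ->
  bounded_op dot G -> 0 < k -> 0 <= q < 1 ->
  (forall x, nsq (k%:C *: x - G x) <= q * k ^+ 2 * nsq x) ->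
  (forall x, P (P x) = G (G x)) -> P = G.
Proof.
move=> pP lG bG k0 /andP[q0 q1] kG PG.
have lP : linear P by case: pP => -[].
pose D x := P x - G x; have lD : linear D by exact: linear_sub.
have [M M0 DM] : exists2 M, 0 <= M & forall x, nsq (D x) <= M * nsq x.
  have [a a0 aP] := bounded_op_nsq pP.1.
  have [b b0 bG'] := bounded_op_nsq bG.
  exists (2 * a + 2 * b) => [|x]; first by rewrite addr_ge0 ?mulr_ge0.
  have : nsq (D x) <= 2 * nsq (P x) + 2 * nsq (G x).
    have := nsq_ge0 (P x + G x); rewrite /D nsqB nsqD; lra.
  by move=> /le_trans; apply; have := aP x; have := bG' x; lra.
have key x : nsq (D x) * k ^+ 2 <= nsq (D (k%:C *: x - G x)).
  have -> : D (k%:C *: x - G x) = P (D x) + k%:C *: D x.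
    rewrite /D !(linB lP) !(linB lG) (linZ lP) (linZ lG) PG scalerBr opprB addrACA [RHS]addrACA.
    by rewrite (addrC (k%:C *: P x)).
  rewrite nsqD nsqZ rdotZr.
  have := nsq_ge0 (P (D x)); have := positive_rdot (D x) pP.
  have := nsq_ge0 (D x); nra.
(* Each use of [key] with the contraction bound gains a factor [q]; the a priori bound [M] starts
   the induction. *)
have Dq n x : nsq (D x) <= M * q ^+ n * nsq x.
  elim: n x => [|n IH] x; first by rewrite expr0 mulr1.
  have Mq : 0 <= M * q ^+ n by rewrite mulr_ge0 ?exprn_ge0.
  have := le_trans (le_trans (key x) (IH _)) (ler_wpM2l Mq (kG x)).
  rewrite (_ : _ * (q * _ * _) = M * q ^+ n.+1 * nsq x * k ^+ 2); last first.
    by rewrite (exprS q n); ring.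
  by rewrite ler_pM2r ?exprn_gt0.
apply/funext => x; apply/eqP; rewrite -subr_eq0; apply/eqP/nsq_eq0/eqP.
rewrite eq_le nsq_ge0 andbT.
have cv : (fun n => M * q ^+ n * nsq x) @ \oo --> (0 : R).
  rewrite (_ : (fun _ => _) = (fun n => M * nsq x * q ^+ n)); last first.
    by apply/funext => n; ring.
  rewrite -(mulr0 (M * nsq x)); apply: cvgMr; apply: cvg_expr.
  by rewrite ger0_norm.
rewrite -(cvg_lim _ cv)//; apply: limr_ge; first by apply/cvg_ex; exists 0.
by apply: nearW => n; exact: Dq.
Qed.

(** * Separation of subspaces by the growth of powers *)

Section Separation.
Variables (G : V -> V) (lG : linear G).
Hypothesis symG : forall x y, rdot (G x) y = rdot x (G y).

(* [s (s - G) G = (s - G) G (s - G) + G (s - G) G] *)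
Lemma nsq_le_form (S : set V) (s : R) : 0 < s ->
  (forall x, S x -> S (G x)) ->
  (forall x, 0 <= rdot (G x) x) ->
  (forall x, S x -> rdot (G x) x <= s * nsq x) ->
  forall x, S x -> nsq (G x) <= s ^+ 2 * nsq x.
Proof.
move=> s0 SG G0 Gs x Sx.
have h1 := G0 (s%:C *: x - G x); have h2 := Gs _ (SG _ Sx).
have h3 := Gs _ Sx.
move: h1; rewrite (linB lG) (linZ lG) rdotBl !rdotBr !rdotZl !rdotZr (symG (G x) x).
rewrite -/(nsq _) => h1.
have : s * nsq (G x) <= s * (s * rdot (G x) x) by lra.
by rewrite ler_pM2l// => /le_trans; apply; rewrite expr2 -mulrA ler_pM2l.
Qed.

(** Expanding |G x - s x|^2 >= 0 gives |G x|^2 >= 2 s (G x, x) - s^2 |x|^2. *)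
Lemma form_le_nsq (s : R) x : 0 <= s -> s * nsq x <= rdot (G x) x ->
  s ^+ 2 * nsq x <= nsq (G x).
Proof.
move=> s0 h; have := nsq_ge0 (G x - s%:C *: x); rewrite nsqB nsqZ rdotZr.
by have := ler_wpM2l s0 h; lra.
Qed.

(** By symmetry (u, v) = (G^n u, Gi^n v) for every n. By Cauchy-Schwarz its square is at most (s /
    s')^(2n) |u|^2 |v|^2, which tends to 0. *)
Lemma growth_orthogonal (Gi : V -> V) (S S' : set V) (s s' : R) :
  0 < s < s' -> cancel Gi G ->
  (forall x, S x -> S (G x) /\ nsq (G x) <= s ^+ 2 * nsq x) ->
  (forall x, S' x -> S' (Gi x) /\ s' ^+ 2 * nsq (Gi x) <= nsq x) ->
  forall u v, S u -> S' v -> rdot u v = 0.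
Proof.
move=> /andP[s0 ss'] GiK SG S'G u v Su Sv.
have s'0 : 0 < s' by exact: lt_trans s0 ss'.
have h n : [/\ S (iter n G u), S' (iter n Gi v),
    rdot (iter n G u) (iter n Gi v) = rdot u v,
    nsq (iter n G u) <= (s ^+ 2) ^+ n * nsq u &
    (s' ^+ 2) ^+ n * nsq (iter n Gi v) <= nsq v].
  elim: n => [|n [h1 h2 h3 h4 h5]]; first by rewrite !expr0 !mul1r.
  have [h6 h7] := SG _ h1; have [h8 h9] := S'G _ h2.
  split => //=; first by rewrite symG GiK.
    by rewrite exprS -mulrA (le_trans h7)// ler_pM2l ?exprn_gt0.
  apply: le_trans h5; rewrite exprSr -mulrA ler_pM2l// !exprn_gt0//.
have sq0 : rdot u v ^+ 2 <= 0.
  have cv : (fun n => nsq u * nsq v * ((s / s') ^+ 2) ^+ n) @ \oo --> (0 : R).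
    rewrite -(mulr0 (nsq u * nsq v)); apply: cvgMr; apply: cvg_expr.
    rewrite ger0_norm ?sqr_ge0// exprn_ilt1 ?divr_ge0 ?ltW//.
    by rewrite ltr_pdivrMr// mul1r.
  rewrite -(cvg_lim _ cv)//; apply: limr_ge; first by apply/cvg_ex; exists 0.
  apply: nearW => n; have [_ _ <- h4 h5] := h n.
  apply: (le_trans (rdot_CS _ _)).
  have sn : 0 < (s' ^+ 2) ^+ n by rewrite !exprn_gt0.
  move: h5; rewrite mulrC -ler_pdivlMr// => h5.
  apply: (le_trans (ler_pM (nsq_ge0 _) (nsq_ge0 _) h4 h5)).
  rewrite le_eqVlt; apply/orP; left; apply/eqP.
  by rewrite !expr_div_n; ring.
by apply/eqP; rewrite -sqrf_eq0 eq_le sq0 sqr_ge0.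
Qed.

End Separation.
End InnerProduct.

(** * Multiplication operators on L^2 *)

Section L2Class.
Context d (Y : measurableType d) (R : realType) (nu : {measure set Y -> \bar R}).
Implicit Types (F : Y -> R[i]) (u v : L2space nu) (h k : Y -> R).

(** On X x Z this is [mkL2] by conversion, so [cp_pi] and [cp_shift] are literally instances of the
    multiplication and composition operators studied over a general measure space. *)
Definition L2mk F : L2space nu :=
  if insub (F : Y -> R[i]^o) is Some G then \pi_(L2space nu) (G : L2fun nu)
  else 0.

Let dot : {dot L2space nu for Num.conj} := @L2dot _ _ R nu.

Lemma L2_ext u v : {ae nu, forall y, repr u y = repr v y} -> u = v.
Proof.
move=> uv; rewrite -[u]reprK -[v]reprK; apply/eqP.
rewrite -Quotient.idealrBE; apply/L2nullP; apply: filterS uv => y e.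
by rewrite -[LHS]/(repr u y - repr v y) e subrr.
Qed.

Lemma L2mkE F : F \in L2_pred nu -> {ae nu, forall y, repr (L2mk F) y = F y}.
Proof.
move=> F2; rewrite /L2mk; case: insubP => [G _ GF|]; last by rewrite F2.
by apply: filterS (L2_reprP G) => y ->; rewrite -GF.
Qed.

Lemma repr_L2 u : (repr u : Y -> R[i]) \in L2_pred nu.
Proof. exact: L2valP (repr u). Qed.

Lemma cmeasurable_repr u : cmeasurable (repr u : Y -> R[i]).
Proof. by have /L2_predP[] := repr_L2 u. Qed.

Lemma L2_pred_ae F G : cmeasurable F -> G \in L2_pred nu ->
  {ae nu, forall y, F y = G y} -> F \in L2_pred nu.
Proof.
move=> mF /L2_predP[mG iG] FG; apply/L2_predP; split => //.
rewrite (ae_eq_integral (fun y => (normc2 (G y))%:E)) //.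
- exact: measurable_normc2.
- exact: measurable_normc2.
- by apply: filterS FG => y /= ->.
Qed.

Lemma L2mk_ae F G : cmeasurable F -> G \in L2_pred nu ->
  {ae nu, forall y, F y = G y} -> L2mk F = L2mk G.
Proof.
move=> mF G2 FG; have F2 := L2_pred_ae mF G2 FG.
by apply: L2_ext; apply: filterS3 FG (L2mkE F2) (L2mkE G2) => y -> -> ->.
Qed.

Lemma repr_L2D u v : {ae nu, forall y, repr (u + v) y = repr u y + repr v y}.
Proof.
rewrite -[u in u + v]reprK -[v in _ + v]reprK -L2piD.
exact: filterS (L2_reprP (repr u + repr v)) => y ->.
Qed.

Lemma repr_L2Z (a : R[i]) u : {ae nu, forall y, repr (a *: u) y = a * repr u y}.
Proof.
by rewrite -[a *: u]/(L2scale _ _); apply: filterS (L2_reprP (a *: repr u)) => y ->.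
Qed.

Lemma rdotE u v : rdot dot u v =
  Rintegral nu setT (fun y => complex.Re (repr u y * conjc (repr v y))).
Proof. by []. Qed.

Lemma nsqE u : nsq dot u = Rintegral nu setT (fun y => normc2 (repr u y)).
Proof.
by rewrite /nsq rdotE; congr Rintegral; apply/funext => y; rewrite Re_mulJ /normc2 !expr2.
Qed.

Lemma integrable_nsq u : nu.-integrable setT (fun y => (normc2 (repr u y))%:E).
Proof. exact: integrable_normc2. Qed.

Lemma normc2_rM (a : R) (z : R[i]) : normc2 (a%:C * z) = a ^+ 2 * normc2 z.
Proof. by case: z => b c; rewrite /normc2 /=; ring. Qed.

(** Boundedness is asked at every point: this is stable under pointwise operations and under
    composition with any measurable map. Essentially bounded functions enter through
    [Linfty_toC_bfun]. *)
Definition bfun h := measurable_fun [set: Y] h /\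
  exists C, forall y, `|h y| <= C.

Lemma bfunP h : bfun h -> exists2 C, 0 < C & forall y, `|h y| <= C.
Proof.
move=> [_ [C hC]]; exists (`|C| + 1) => [|y]; first by rewrite ltr_wpDl.
by rewrite (le_trans (hC y))// (le_trans (ler_norm _))// lerDl.
Qed.

Lemma cmeasurable_rM h F : measurable_fun [set: Y] h -> cmeasurable F ->
  cmeasurable (fun y => (h y)%:C * F y).
Proof.
move=> mh [mr mi]; split.
  rewrite (_ : (fun _ => _) = (fun y => h y * complex.Re (F y))).
    exact: measurable_funM.
  by apply/funext => y; case: (F y) => a b /=; rewrite mul0r subr0.
rewrite (_ : (fun _ => _) = (fun y => h y * complex.Im (F y))).
  exact: measurable_funM.
by apply/funext => y; case: (F y) => a b /=; rewrite mul0r addr0.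
Qed.

Lemma bfun_mul_L2 h F : bfun h -> F \in L2_pred nu ->
  (fun y => (h y)%:C * F y) \in L2_pred nu.
Proof.
move=> bh /L2_predP[mF iF]; apply/L2_predP; split.
  by apply: cmeasurable_rM => //; case: bh.
have [C C0 hC] := bfunP bh.
apply: (@le_lt_trans _ _ (\int[nu]_y ((C ^+ 2)%:E * (normc2 (F y))%:E))%E).
  apply: ge0_le_integral => //.
  - by move=> y _; rewrite lee_fin normc2_ge0.
  - by apply: measurable_normc2; apply: cmeasurable_rM => //; case: bh.
  - by apply: emeasurable_funM => //; exact: measurable_normc2.
  - move=> y _; rewrite -EFinM lee_fin normc2_rM ler_wpM2r ?normc2_ge0//.
    by rewrite -ler_sqrt ?sqr_ge0// !sqrtr_sqr (le_trans (hC y))// ler_norm.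
rewrite ge0_integralZl//=.
- by rewrite lte_mul_pinfty// lee_fin sqr_ge0.
- exact: measurable_normc2.
- by move=> y _; rewrite lee_fin normc2_ge0.
- by rewrite lee_fin sqr_ge0.
Qed.

Definition mulL h u : L2space nu := L2mk (fun y => (h y)%:C * repr u y).

Lemma repr_mulL h u : bfun h ->
  {ae nu, forall y, repr (mulL h u) y = (h y)%:C * repr u y}.
Proof. by move=> bh; exact/L2mkE/bfun_mul_L2/repr_L2. Qed.

(** Since [h] may be unbounded on a null set, this is the passage from an essentially bounded
    multiplier to a bounded representative. *)
Lemma mulL_ae h k : measurable_fun [set: Y] h -> bfun k ->
  {ae nu, forall y, h y = k y} -> mulL h = mulL k.
Proof.
move=> mh bk hk; apply/funext => u; apply: L2mk_ae.
- exact/cmeasurable_rM/cmeasurable_repr.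
- exact/bfun_mul_L2/repr_L2.
- by apply: filterS hk => y ->.
Qed.

Lemma mulL_linear h : bfun h -> linear (mulL h).
Proof.
move=> bh a u v; apply: L2_ext.
have e1 := repr_mulL (a *: u + v) bh.
have e2 := repr_L2D (a *: u) v; have e3 := repr_L2Z a u.
have e4 := repr_L2D (a *: mulL h u) (mulL h v); have e5 := repr_L2Z a (mulL h u).
have e6 := repr_mulL u bh; have e7 := repr_mulL v bh.
apply: filterS3 (filterI e1 e4) (filterI e2 e3) (filterI e5 (filterI e6 e7)).
move=> y [-> ->] [-> ->] [-> [-> ->]].
by rewrite mulrDr mulrCA.
Qed.

Lemma bfunM h k : bfun h -> bfun k -> bfun (fun y => h y * k y).
Proof.
move=> [mh [C hC]] [mk [D hD]]; split; first exact: measurable_funM.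
by exists (C * D) => y; rewrite normrM ler_pM.
Qed.

Lemma bfunD h k : bfun h -> bfun k -> bfun (fun y => h y + k y).
Proof.
move=> [mh [C hC]] [mk [D hD]]; split; first exact: measurable_funD.
by exists (C + D) => y; rewrite (le_trans (ler_normD _ _))// lerD.
Qed.

Lemma bfun_cst (a : R) : bfun (fun=> a).
Proof. by split => //; exists `|a|. Qed.

Lemma bfunB h k : bfun h -> bfun k -> bfun (fun y => h y - k y).
Proof.
move=> bh bk; rewrite (_ : (fun _ => _) = (fun y => h y + (-1) * k y)).
  by apply: bfunD => //; apply: bfunM => //; exact: bfun_cst.
by apply/funext => y; rewrite mulN1r.
Qed.

Lemma bfun_indic (A : set Y) : measurable A -> bfun (\1_A : Y -> R).
Proof.
move=> mA; split => //; exists 1 => y.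
by rewrite indicE; case: (_ \in _); rewrite ?normr1 ?normr0.
Qed.

Lemma mulLM h k u : bfun h -> bfun k ->
  mulL h (mulL k u) = mulL (fun y => h y * k y) u.
Proof.
move=> bh bk; apply: L2_ext.
apply: filterS3 (repr_mulL (mulL k u) bh) (repr_mulL u bk)
  (repr_mulL u (bfunM bh bk)) => y -> -> ->.
by rewrite mulrA -rmorphM.
Qed.

Lemma mulL1 u : mulL (fun=> 1) u = u.
Proof.
apply: L2_ext; apply: filterS (repr_mulL u (bfun_cst 1)) => y ->.
by rewrite mul1r.
Qed.

Lemma mulL_cst (a : R) u : mulL (fun=> a) u = a%:C *: u.
Proof.
by apply: L2_ext; apply: filterS2 (repr_mulL u (bfun_cst a)) (repr_L2Z a%:C u)
  => y -> ->.
Qed.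

Lemma mulLD h k u : bfun h -> bfun k ->
  mulL (fun y => h y + k y) u = mulL h u + mulL k u.
Proof.
move=> bh bk; apply: L2_ext.
have e1 := repr_L2D (mulL h u) (mulL k u).
apply: filterS3 (filterI e1 (repr_mulL u bh)) (repr_mulL u bk)
  (repr_mulL u (bfunD bh bk)) => y [-> ->] -> ->.
by rewrite -mulrDl -rmorphD.
Qed.

Lemma mulLB h k u : bfun h -> bfun k ->
  mulL (fun y => h y - k y) u = mulL h u - mulL k u.
Proof.
move=> bh bk; apply/eqP; rewrite eq_sym subr_eq -mulLD//; last exact: bfunB.
by apply/eqP; congr mulL; apply/funext => y; rewrite subrK.
Qed.

Lemma dot_mulL h u v : bfun h -> dot (mulL h u) v =
  cintegral nu (fun y => (h y)%:C * (repr u y * conjc (repr v y))).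
Proof.
move=> bh; rewrite -[LHS]/(cintegral _ _).
have i1 := cintegrable_mul (repr (mulL h u)) (repr v).
have F2 := bfun_mul_L2 bh (repr_L2 u).
have i2 := cintegrable_mul (MkL2fun F2) (repr v).
rewrite (ae_eq_cintegral i1 i2).
  by congr cintegral; apply/funext => y; rewrite mulrA.
by apply: filterS (repr_mulL u bh) => y ->.
Qed.

Lemma mulL_sym h u v : bfun h -> dot (mulL h u) v = dot u (mulL h v).
Proof.
move=> bh; rewrite (dotC dot u) !dot_mulL// -cintegral_conj; last first.
  have F2 := bfun_mul_L2 bh (repr_L2 v).
  rewrite (_ : (fun _ => _) = (fun y => ((h y)%:C * repr v y) * conjc (repr u y))).
    exact: (cintegrable_mul (MkL2fun F2) (repr u)).
  by apply/funext => y; rewrite mulrA.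
congr cintegral; apply/funext => y.
by case: (repr u y) (repr v y) => a b [c e] /=; congr (_ +i* _); ring.
Qed.

Lemma rdot_mulL h u : bfun h -> rdot dot (mulL h u) u =
  Rintegral nu setT (fun y => h y * normc2 (repr u y)).
Proof.
move=> bh; rewrite /rdot dot_mulL//=; congr Rintegral; apply/funext => y.
by case: (repr u y) => a b; rewrite /normc2 /=; ring.
Qed.

Lemma nsq_mulL h u : bfun h -> nsq dot (mulL h u) =
  Rintegral nu setT (fun y => h y ^+ 2 * normc2 (repr u y)).
Proof.
move=> bh; rewrite /nsq /rdot mulL_sym// mulLM// -mulL_sym; last exact: bfunM.
rewrite -/(rdot _ _ _) rdot_mulL; last exact: bfunM.
by congr Rintegral; apply/funext => y; rewrite expr2.
Qed.

Lemma dot_mulL_self h u : bfun h -> dot (mulL h u) u =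
  (Rintegral nu setT (fun y => h y * normc2 (repr u y)))%:C.
Proof.
move=> bh; rewrite -rdot_mulL// /rdot.
have : dot (mulL h u) u = conjc (dot (mulL h u) u).
  by rewrite -dotC mulL_sym.
by case: (dot _ _) => a b /= [] bb; congr (_ +i* _); lra.
Qed.

Lemma integrable_bfunM h (F : Y -> R) : bfun h ->
  nu.-integrable setT (EFin \o F) ->
  nu.-integrable setT (EFin \o (fun y => h y * F y)).
Proof.
move=> bh iF; have [C C0 hC] := bfunP bh.
have iC := integrableZl measurableT C iF.
apply: (le_integrable measurableT _ _ iC).
  apply/measurable_EFinP; apply: measurable_funM; first by case: bh.
  by apply/measurable_EFinP; exact: (measurable_int _ iF).
move=> y _; rewrite lee_fin !normrM (ger0_norm (ltW C0)).
by rewrite ler_wpM2r.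
Qed.

Lemma nsq_mulL_le h (C : R) u : bfun h -> (forall y, h y ^+ 2 <= C) ->
  nsq dot (mulL h u) <= C * nsq dot u.
Proof.
move=> bh hC; rewrite nsq_mulL// nsqE -RintegralZl//; last exact: integrable_nsq.
apply: le_Rintegral => //.
- apply: (integrable_bfunM (h := fun y => h y ^+ 2)); last exact: integrable_nsq.
  by rewrite (_ : (fun _ => _) = (fun y => h y * h y)); [exact: bfunM|
     by apply/funext => y; rewrite expr2].
- apply: (integrable_bfunM (h := fun=> C)); last exact: integrable_nsq.
  exact: bfun_cst.
- by move=> y _; rewrite ler_wpM2r ?normc2_ge0.
Qed.

Lemma bounded_op_mulL h : bfun h -> bounded_op dot (mulL h).
Proof.
move=> bh; apply: bounded_opP; first exact: mulL_linear.
have [C C0 hC] := bfunP bh; exists (C ^+ 2) => u.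
apply: nsq_mulL_le => // y.
by rewrite -ler_sqrt ?sqr_ge0// !sqrtr_sqr (le_trans (hC y))// ler_norm.
Qed.

Lemma positive_op_mulL h : bfun h -> (forall y, 0 <= h y) ->
  positive_op dot (mulL h).
Proof.
move=> bh h0; split; first exact: bounded_op_mulL.
move=> u; rewrite dot_mulL_self// lecR Rintegral_ge0// => y _.
by rewrite mulr_ge0// normc2_ge0.
Qed.

Lemma rdot_mulL_ge h (c : R) u : bfun h -> (forall y, c <= h y) ->
  c * nsq dot u <= rdot dot (mulL h u) u.
Proof.
move=> bh hc; rewrite rdot_mulL// nsqE -RintegralZl//; last exact: integrable_nsq.
apply: le_Rintegral => //.
- apply: (integrable_bfunM (h := fun=> c)); last exact: integrable_nsq.
  exact: bfun_cst.
- by apply: (integrable_bfunM (h := h)); last exact: integrable_nsq.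
- by move=> y _; rewrite ler_wpM2r ?normc2_ge0.
Qed.

End L2Class.

(** * Measure preserving maps *)

Section MeasurePreserving.
Context d (Y : measurableType d) (R : realType) (nu : {measure set Y -> \bar R}).

Definition mpreserving (t : Y -> Y) := measurable_fun [set: Y] t /\
  forall A, measurable A -> nu (t @^-1` A) = nu A.

Lemma mpreserving_comp s t : mpreserving s -> mpreserving t ->
  mpreserving (s \o t).
Proof.
move=> [ms ps] [mt pt]; split; first exact: measurableT_comp.
move=> A mA; rewrite comp_preimage pt ?ps//.
by rewrite -[X in measurable X]setTI; exact: ms.
Qed.

Lemma measure_ae A B : measurable A -> measurable B ->
  {ae nu, forall y, A y <-> B y} -> nu A = nu B.
Proof.
move=> mA mB AB.
rewrite -[A in LHS]setIT -[B in RHS]setIT -!integral_indic//.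
apply: ae_eq_integral => //; do 1 ?exact/measurable_EFinP.
apply: filterS AB => y AB _; rewrite !indicE; congr ((nat_of_bool _)%:R%:E).
by apply/idP/idP; rewrite !inE => /AB.
Qed.

Lemma mpreserving_iter t n : mpreserving t -> mpreserving (iter n t).
Proof.
move=> pt; elim: n => [|n IH]; first by split => //; exact: measurable_id.
exact: (mpreserving_comp pt IH).
Qed.

Lemma mpreserving_ae t (P : Y -> Prop) : mpreserving t ->
  {ae nu, forall y, P y} -> {ae nu, forall y, P (t y)}.
Proof.
move=> [mt pt] [N [mN N0 PN]]; exists (t @^-1` N); split.
- by rewrite -[X in measurable X]setTI; exact: mt.
- by rewrite pt.
- by move=> y /= nP; exact: PN.
Qed.

Lemma mpreserving_ge0_integral t (f : Y -> \bar R) : mpreserving t ->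
  measurable_fun [set: Y] f -> (forall y, 0 <= f y)%E ->
  (\int[nu]_y f (t y) = \int[nu]_y f y)%E.
Proof.
move=> [mt pt] mf f0.
transitivity (\int[pushforward nu t]_y f y)%E.
  by rewrite ge0_integral_pushforward.
by apply: eq_measure_integral => A mA _; exact: pt.
Qed.

Lemma mpreserving_integrable t (f : Y -> R) : mpreserving t ->
  nu.-integrable setT (EFin \o f) ->
  nu.-integrable setT (EFin \o (fun y => f (t y))).
Proof.
move=> pt /integrableP[mf fi]; apply/integrableP; split.
  rewrite (_ : _ \o _ = (EFin \o f) \o t)//.
  by apply: measurableT_comp => //; case: pt.
rewrite (mpreserving_ge0_integral (f := fun y => `|(f y)%:E|%E))//.
by apply: measurableT_comp.
Qed.

Lemma mpreserving_Rintegral t (f : Y -> R) : mpreserving t ->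
  nu.-integrable setT (EFin \o f) ->
  Rintegral nu setT (fun y => f (t y)) = Rintegral nu setT f.
Proof.
move=> pt fi; have [mt pt'] := pt.
have fti := mpreserving_integrable pt fi.
have mf : measurable_fun setT (EFin \o f) by exact: measurable_int fi.
rewrite /Rintegral; congr fine.
transitivity (\int[pushforward nu t]_y (f y)%:E)%E.
  by rewrite (integral_pushforward mt mf).
by apply: eq_measure_integral => A mA _; exact: pt'.
Qed.

End MeasurePreserving.

(** * The space X x Z: slices, lifted functions and the shift *)

Section XZ.
Context (R : realType) (d : measure_display) (X : measurableType d).
Variables (mu : probability X R) (phi psi : X -> X).
Hypothesis Hphi : invertible_mpt mu phi psi.
Local Notation nu := (XZmeasure mu).

(** The two constructors of [int] present the slices as countable unions indexed by [nat]. *)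
Lemma preimage_slices T (f : X * int -> T) (A : set T) : f @^-1` A =
  (\bigcup_n ([set x | A (f (x, Posz n))] `*` [set Posz n])) `|`
  (\bigcup_n ([set x | A (f (x, Negz n))] `*` [set Negz n])).
Proof.
apply/seteqP; split => [[x [n|n]] /= Af|[x k]]; [by left; exists n|by right; exists n|].
by case=> -[n _] [/= Af ->].
Qed.

Lemma measurable_slices d' (T : measurableType d') (f : X * int -> T) :
  (forall k, measurable_fun [set: X] (fun x => f (x, k))) ->
  measurable_fun [set: X * int] f.
Proof.
move=> mf _ A mA; rewrite setTI preimage_slices.
have mk k : measurable ([set x | A (f (x, k))] `*` [set k]).
  apply: measurableX => //; rewrite -[X in measurable X]setTI.
  exact: mf.
by apply: measurableU; apply: bigcupT_measurable.
Qed.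

Lemma ae_slices (P : X * int -> Prop) :
  (forall k, {ae mu, forall x, P (x, k)}) -> {ae nu, forall p, P p}.
Proof.
move=> aeP; suff : nu.-negligible (~` [set p | P p]) by [].
have nk k : nu.-negligible ((~` [set x | P (x, k)]) `*` [set k]).
  have [N [mN N0 PN]] := aeP k; exists (N `*` [set k]); split.
  - exact: measurableX.
  - by rewrite -[LHS]/((mu \x @zcounting R)%E _) product_measure1E//= N0 mul0e.
  - by move=> [x j] [/= nP ->]; split => //; exact: PN.
apply: (@negligibleS _ _ _ _
  ((\bigcup_n ((~` [set x | P (x, Posz n)]) `*` [set Posz n])) `|`
   (\bigcup_n ((~` [set x | P (x, Negz n)]) `*` [set Negz n])))).
  by move=> [x [n|n]] nP; [left|right]; exists n.
by apply: negligibleU; apply: negligible_bigcup.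
Qed.

Lemma mpreserving_phi : mpreserving mu phi.
Proof. by case: Hphi. Qed.

(** Preservation by [phi] gives mu(psi^-1 A) = mu(phi^-1 psi^-1 A), and the last set is [A] up to a
    null set. *)
Lemma mpreserving_psi : mpreserving mu psi.
Proof.
have [mphi mpsi pphi _ psiphi] := Hphi; split => // A mA.
have mpA : measurable (psi @^-1` A).
  by rewrite -[X in measurable X]setTI; exact: mpsi.
apply: etrans (esym (pphi _ mpA)) _; apply: measure_ae => //.
  by rewrite -[X in measurable X]setTI; exact: mphi.
by apply: filterS psiphi => x /= ->.
Qed.

Lemma mpreserving_zpow k : mpreserving mu (zpow phi psi k).
Proof.
by case: k => n; apply: mpreserving_iter; [exact: mpreserving_phi|
  exact: mpreserving_psi].
Qed.

(** The function on X x Z by which [cp_pi] multiplies. *)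
Definition zlift T (g : X -> T) (p : X * int) := g (zpow phi psi (- p.2) p.1).

Lemma measurable_zlift d' (T : measurableType d') (g : X -> T) :
  measurable_fun [set: X] g -> measurable_fun [set: X * int] (zlift g).
Proof.
move=> mg; apply: measurable_slices => k.
by have [mz _] := mpreserving_zpow (- k); exact: (measurableT_comp mg mz).
Qed.

Lemma bfun_zlift (g : X -> R) : bfun g -> bfun (zlift g).
Proof.
move=> [mg [C gC]]; split; first exact: measurable_zlift.
by exists C => p; exact: gC.
Qed.

Lemma ae_zlift (P : X -> Prop) :
  {ae mu, forall x, P x} -> {ae nu, forall p, zlift P p}.
Proof.
by move=> aeP; apply: ae_slices => k; apply: mpreserving_ae aeP;
  exact: mpreserving_zpow.
Qed.

Lemma cp_piE (g : X -> R) : cp_pi mu phi psi (toC g) = mulL (nu := nu) (zlift g).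
Proof. by []. Qed.

Lemma cp_pi_ae (g h : X -> R) : measurable_fun [set: X] g -> bfun h ->
  {ae mu, forall x, g x = h x} ->
  cp_pi mu phi psi (toC g) = mulL (nu := nu) (zlift h).
Proof.
move=> mg bh gh; rewrite cp_piE; apply: mulL_ae.
- exact: measurable_zlift.
- exact: bfun_zlift.
- exact: (ae_zlift gh).
Qed.

Definition zshift (j : int) (p : X * int) : X * int := (p.1, p.2 - j).

Lemma mpreserving_zshift j : mpreserving nu (zshift j).
Proof.
split.
  apply: measurable_slices => k.
  by apply: (@measurable_fun_pair _ _ _ _ _ _ id (fun=> k - j)).
move=> A mA; rewrite /= /product_measure1; apply: eq_integral => x _ /=.
have -> : xsection (zshift j @^-1` A) x = (fun k => k + j) @` xsection A x.
  apply/seteqP; split => k; rewrite /xsection /= ?inE /=.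
    by move=> Ak; exists (k - j); rewrite ?inE// subrK.
  by move=> [l]; rewrite inE => Al <-; rewrite /zshift /= addrK.
have inj : injective (fun k : int => k + j) by move=> a b /addIr.
(* [counting] distinguishes finite from infinite sets, so the translation has to preserve finiteness
   in both directions as well as cardinality. *)
rewrite /zcounting /counting; have [fA|iA] := pselect (finite_set (xsection A x)).
  rewrite !asboolT//; last exact: finite_image.
  by rewrite fset_set_image// finmap.card_imfset.
rewrite !asboolF//; apply: contra_not iA => fA.
have := finite_image (fun k => k - j) fA; rewrite image_comp.
rewrite (_ : _ @` _ = xsection A x)//.
rewrite -[RHS]image_id; congr image; apply/funext => k /=.
by rewrite addrK.
Qed.

End XZ.

(** * Spectral measures of multiplication operators *)

Definition oray (R : realType) (s : R) : set (measurableTypeR R) :=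
  `]-oo, s[%classic.

(** The hypothesis compares a ray only with a strictly larger one, which is what growth of powers
    can deliver. Exhausting a ray from below closes the gap, and the rays are a generating pi-system
    on which the measures are finite. *)
Lemma measure_eq_rays (R : realType)
    (m1 m2 : {finite_measure set (measurableTypeR R) -> \bar R}) :
  (forall s s' : R, s < s' ->
    (m1 (oray s) <= m2 (oray s'))%E /\
    (m2 (oray s) <= m1 (oray s'))%E) ->
  forall A, measurable A -> m1 A = m2 A.
Proof.
have ray (m m' : {finite_measure set (measurableTypeR R) -> \bar R}) :
    (forall s s' : R, (s < s')%R ->
       m (oray s) <= m' (oray s'))%E ->
    forall s : R, (m (oray s) <= m' (oray s))%E.
  move=> mm' s; pose F (n : nat) := oray (s - n.+1%:R^-1).
  have UF : \bigcup_n F n = oray s.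
    apply/seteqP; split => [t [n _] |t]; rewrite /F /oray /= !in_itv /=.
      by move=> /lt_le_trans; apply; rewrite gerBl.
    move=> ts; have st : 0 < s - t by rewrite subr_gt0.
    have [n nst] := ltr_add_invr st.
    by exists n => //=; rewrite in_itv /= ltrBrDr -ltrBrDl; rewrite add0r in nst.
  have cF : m \o F @ \oo --> m (\bigcup_n F n).
    apply: nondecreasing_cvg_mu => //.
    - by move=> n; exact: measurable_itv.
    - by rewrite UF; exact: measurable_itv.
    - move=> i j ij; apply/subsetPset => t; rewrite /F /oray /= !in_itv /=.
      move=> /lt_le_trans; apply; rewrite lerB// lef_pV2 ?posrE// ler_nat.
      exact: ij.
  rewrite -UF -(cvg_lim _ cF)//; apply: lime_le; first by apply/cvg_ex; eexists; exact: cF.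
  apply: nearW => n; rewrite UF; apply: mm'.
  by rewrite ltrBlDr ltrDl invr_gt0.
move=> mm A mA; apply: (@measure_unique _ R (measurableTypeR R)
  (@RGenInftyO.G R) (fun n : nat => oray n%:R) _ _ _ _ m1 m2) => //.
- exact: RGenInftyO.measurableE.
- move=> _ _ [x ->] [y ->]; exists (Num.min x y).
  by apply/seteqP; split => t /=; rewrite !in_itv /= lt_min => /andP.
- by move=> n; exists n%:R.
- apply/seteqP; split => // t _; exists (Num.truncn t).+1 => //=.
  by rewrite /oray /= in_itv /= truncnS_gt.
- move=> _ [s ->]; apply/eqP; rewrite eq_le; apply/andP.
  by split; apply: ray => a b ab; case: (mm a b ab).
- by move=> n; rewrite ltey_eq fin_num_measure//; exact: measurable_itv.
Qed.

Section SpectralMeasure.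
Context (R : realType) (V : lmodType R[i]) (dot : {dot V for Num.conj}).
Implicit Types (u v x y : V).
Variables (K : set (measurableTypeR R)) (E : set (measurableTypeR R) -> V -> V).
Hypothesis mK : measurable K.
Hypothesis SE : spectral_measure dot K E.

Lemma spectral_proj_lin B : measurable B -> linear (E B).
Proof. by move=> mB; have [/(_ B mB)[[]]] := SE. Qed.

Lemma spectral_proj_sym B x y : measurable B -> dot (E B x) y = dot x (E B y).
Proof. by move=> mB; have [/(_ B mB)[]] := SE. Qed.

Lemma spectral_projI B C x : measurable B -> measurable C ->
  E B (E C x) = E (B `&` C) x.
Proof. by move=> mB mC; have [_ _ h _ _] := SE; rewrite h. Qed.

Lemma spectral_proj0 x : E set0 x = 0.
Proof. by have [_ _ _ h _] := SE; rewrite h ?set0I. Qed.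

Lemma spectral_projT x : E setT x = x.
Proof. by have [_ -> _ _ _] := SE. Qed.

Lemma dot_spectral_proj B x : measurable B ->
  dot (E B x) x = (nsq dot (E B x))%:C.
Proof.
move=> mB; have BB : E B (E B x) = E B x by rewrite spectral_projI// setIid.
by rewrite -dotxx -{1}BB spectral_proj_sym.
Qed.

Lemma marginalE x m B : spectral_marginal dot E x m -> measurable B ->
  m B = (nsq dot (E B x))%:E.
Proof. by move=> h mB; rewrite h// dot_spectral_proj. Qed.

(** Additivity of [E] is given only through its scalar marginals, so it is checked on quadratic
    forms and lifted to operators by polarization. *)
Lemma spectral_projC B x : measurable B -> E (~` B) x = x - E B x.
Proof.
move=> mB; have mCB := measurableC mB.
have [_ _ _ _ /(_ x)[_ _]] := SE.
suff -> : E (~` B) = (fun x => x - E B x) by [].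
apply: (quadratic_form_inj (dot := dot)).
- exact: spectral_proj_lin.
- by apply: linear_sub => //; exact: spectral_proj_lin.
move=> y; have [_ _ _ _ /(_ y)[m hm]] := SE.
have : m setT = (m B + m (~` B))%E by rewrite -measureU ?setUv// setICr.
rewrite !(marginalE hm)// spectral_projT => -[] e.
rewrite dotDl -scaleN1r dotZl !dot_spectral_proj// dotxx mulN1r.
by rewrite e; apply/eqP; rewrite eq_complex /= oppr0 !addr0 eqxx andbT; lra.
Qed.

Variable G : V -> V.
Hypothesis IG : spectral_integral dot K E id G.

Let lG : linear G. Proof. by case: IG => -[]. Qed.

(** Since [E C u] is orthogonal to [v] for every measurable [C], the marginal of [u + v] is the sum
    of those of [u] and [v], and so the form of [G] is additive on this pair. Symmetry of [G], which
    makes the two cross terms equal, comes in at [spectral_proj_comm]. *)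
Lemma spectral_operator_reduced B u v : measurable B -> E B u = u ->
  E (~` B) v = v -> rdot dot (G u) v + rdot dot (G v) u = 0.
Proof.
move=> mB Bu Bv; have mCB := measurableC mB.
have [_ _ _ _ mg] := SE.
have [m1 h1] := mg u; have [m2 h2] := mg v; have [m hm] := mg (u + v).
have cross C : measurable C -> rdot dot (E C u) v = 0.
  move=> mC; rewrite -Bv /rdot -spectral_proj_sym// spectral_projI// -Bu.
  rewrite spectral_projI//; last exact: measurableI.
  by rewrite setIAC setICl set0I spectral_proj0 dot0l.
have e C : measurable C -> m C = measure_add m1 m2 C.
  move=> mC; have -> : measure_add m1 m2 C = (m1 C + m2 C)%E by rewrite measure_addE.
  rewrite hm// h1// h2// -EFinD; congr EFin.
  rewrite (linD (spectral_proj_lin mC)).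
  rewrite -[LHS]/(rdot dot _ _) rdotDl !rdotDr cross//.
  have -> : rdot dot (E C v) u = 0.
    by rewrite /rdot spectral_proj_sym// -/(rdot dot _ _) rdotC cross.
  by rewrite addr0 add0r.
have [_ I] := IG; have [i1 d1] := I _ _ h1; have [i2 d2] := I _ _ h2.
have [i d] := I _ _ hm.
have : Rintegral m K id = Rintegral m1 K id + Rintegral m2 K id.
  rewrite /Rintegral -fineD; [|exact: integrable_fin_num|exact: integrable_fin_num].
  congr fine; rewrite -integral_measure_add//.
  by apply: eq_measure_integral => C mC _; exact: e.
have r1 : rdot dot (G u) u = Rintegral m1 K id by rewrite /rdot d1.
have r2 : rdot dot (G v) v = Rintegral m2 K id by rewrite /rdot d2.
have r : rdot dot (G (u + v)) (u + v) = Rintegral m K id by rewrite /rdot d.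
by rewrite -r -r1 -r2 (linD lG) rdotDl !rdotDr; lra.
Qed.

Hypothesis symG : forall x y, rdot dot (G x) y = rdot dot x (G y).

Lemma spectral_proj_comm B x : measurable B -> G (E B x) = E B (G x).
Proof.
move=> mB; have mCB := measurableC mB.
(* Testing against the component of [z = G (E C y)] in the complementary range turns the cross term
   into the squared norm of that component, so [G] preserves the range of [E C]. Using this for [B]
   and for its complement gives commutation. *)
have GB C y : measurable C -> G (E C y) = E C (G (E C y)).
  move=> mC; have mCC := measurableC mC; set z := G (E C y).
  apply/eqP; rewrite -subr_eq0 -spectral_projC//; apply/eqP/(nsq_eq0 (dot := dot)).
  have Cu : E C (E C y) = E C y by rewrite spectral_projI// setIid.
  have Cw : E (~` C) (E (~` C) z) = E (~` C) z by rewrite spectral_projI// setIid.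
  have := spectral_operator_reduced mC Cu Cw.
  rewrite (symG (E (~` C) z)) (rdotC dot (E (~` C) z)) -/z => e.
  rewrite /nsq /rdot spectral_proj_sym// Cw -/(rdot dot _ _).
  lra.
rewrite [in RHS](_ : x = E B x + E (~` B) x); last first.
  by rewrite spectral_projC// addrC subrK.
rewrite (linD lG) (linD (spectral_proj_lin mB)) -GB// (GB _ _ mCB).
by rewrite spectral_projI// setICr spectral_proj0 addr0.
Qed.

(** A vector in the range of [E B] has its marginal carried by [B], so an affine function
    nonnegative on [B] has a nonnegative integral. The slopes -1 and 1 give the upper and lower
    bounds that follow. *)
Lemma spectral_form_affine B (a b : R) u : measurable B -> E B u = u ->
  (forall t, B t -> 0 <= a + b * t) ->
  0 <= a * nsq dot u + b * rdot dot (G u) u.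
Proof.
move=> mB Bu Bs; have mCB := measurableC mB.
have [_ _ _ E0 /(_ u)[m hm]] := SE.
have m0 : m (~` B) = 0%E.
  by rewrite (marginalE hm)// -Bu spectral_projI// setICl spectral_proj0 nsq0.
have mKC : m (~` K) = 0%E.
  rewrite (marginalE hm); last exact: measurableC.
  by rewrite E0 ?setICl ?nsq0//; exact: measurableC.
have mT : m K = (nsq dot u)%:E.
  rewrite -[u in RHS]spectral_projT -(marginalE hm)//.
  have -> : m setT = (m K + m (~` K))%E.
    rewrite -measureU ?setUv// ?setICr//; exact: measurableC.
  by rewrite mKC adde0.
have [_ /(_ _ _ hm)[im dm]] := IG.
rewrite /rdot dm /=.
have ia : m.-integrable K (EFin \o (fun=> a)).
  exact: finite_measure_integrable_cst.
have ib : m.-integrable K (EFin \o (fun t => b * t)).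
  exact: (integrableZl mK b im).
have -> : a * nsq dot u = Rintegral m K (fun=> a).
  by rewrite Rintegral_cst//; congr (_ * _); exact: (esym (congr1 fine mT)).
rewrite -(RintegralZl b mK im) -RintegralD//.
(* The integrand is known to be nonnegative only on [B], whose complement is null for [m]; the
   absolute value makes it nonnegative on all of [K]. *)
have -> : Rintegral m K (fun t => a + b * t) =
          Rintegral m K (fun t => `|a + b * t|).
  have mst : measurable_fun K (fun t : measurableTypeR R => a + b * t).
    by apply: measurable_funD => //; exact: measurable_funM.
  rewrite /Rintegral; congr fine; apply: ae_eq_integral => //.
  - exact/measurable_EFinP.
  - by apply/measurable_EFinP; exact: measurableT_comp.
  - exists (~` B); split => // t nt /=; apply: contra_not nt => /= Bt _.
    by rewrite ger0_norm// Bs.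
by apply: Rintegral_ge0.
Qed.

Lemma spectral_form_le B (s : R) u : measurable B -> E B u = u ->
  (forall t, B t -> t <= s) -> rdot dot (G u) u <= s * nsq dot u.
Proof.
move=> mB Bu Bs; have := @spectral_form_affine B s (-1) u mB Bu.
by rewrite mulN1r subr_ge0; apply => t /Bs; rewrite mulN1r subr_ge0.
Qed.

Lemma spectral_form_ge B (s : R) u : measurable B -> E B u = u ->
  (forall t, B t -> s <= t) -> s * nsq dot u <= rdot dot (G u) u.
Proof.
move=> mB Bu Bs; have := @spectral_form_affine B (- s) 1 u mB Bu.
rewrite mul1r mulNr addrC subr_ge0; apply => t /Bs.
by rewrite mul1r addrC subr_ge0.
Qed.

End SpectralMeasure.

Lemma measurable_funpowR d (Y : measurableType d) (R : realType) (h : Y -> R)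
    (p : R) : measurable_fun [set: Y] h ->
  measurable_fun [set: Y] (fun y => h y `^ p).
Proof.
move=> mh; apply: (measurableT_comp (f := fun x : R => x `^ p)) => //.
Qed.

(** * Lower bounds and spectrum of a multiplier *)

Section Multiplier.
Context d (Y : measurableType d) (R : realType) (nu : {measure set Y -> \bar R}).
Hypothesis sfnu : sigma_finite [set: Y] nu.
Local Notation dot := (@L2dot _ _ R nu : {dot L2space nu for Num.conj}).
Implicit Types (h k : Y -> R) (u v x : L2space nu).

(** On the indicator [x] of a piece of {|h| < e} of finite measure the bounds give |x|^2 <= k e^2
    |x|^2 with k e^2 < 1, so the piece is null. Sigma-finiteness cuts the set into countably many
    such pieces. *)
Lemma mulL_lower_bound_ae h (k e : R) : bfun h -> 0 <= k ->
  (forall u, nsq dot u <= k * nsq dot (mulL h u)) -> 0 < e -> k * e ^+ 2 < 1 ->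
  {ae nu, forall y, e <= `|h y|}.
Proof.
move=> bh k0 hk e0 ke.
have [F FT Fm] := sfnu.
pose A := [set y | `|h y| < e].
have mA : measurable A.
  rewrite (_ : A = (fun y => `|h y|) @^-1` `]-oo, e[%classic).
    rewrite -[X in measurable X]setTI.
    by exact: (measurableT_comp (@normr_measurable R setT) bh.1).
  by apply/seteqP; split => y; rewrite /A /= in_itv.
suff n0 n : nu (A `&` F n) = 0%E.
  apply: (@negligibleS _ _ _ _ (\bigcup_n (A `&` F n))).
    move=> y /= /negP; rewrite -ltNge => hy.
    by rewrite -setI_bigcupr -FT setIT.
  apply: negligible_bigcup => n; apply/negligibleP; last exact: n0.
  by apply: measurableI => //; case: (Fm n).
set B := A `&` F n; have [mF Foo] := Fm n.
have mB : measurable B by exact: measurableI.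
have Boo : (nu B < +oo)%E.
  by apply: le_lt_trans Foo; apply: le_measure; rewrite ?inE//; exact: subIsetr.
have iB : (\int[nu]_y (normc2 ((\1_B y)%:C : R[i]))%:E = nu B)%E.
  rewrite -[in RHS](setIT B) -integral_indic//; apply: eq_integral => y _.
  by rewrite /normc2 /= expr0n addr0 indicE; case: (_ \in _); rewrite ?expr1n ?expr0n.
have F2 : (fun y => (\1_B y)%:C : R[i]) \in L2_pred nu.
  apply/L2_predP; split; last by rewrite iB.
  by split => //=; exact: measurable_indic.
set x := L2mk nu (fun y => (\1_B y)%:C).
have xB : mulL (\1_B) x = x.
  have e1 : {ae nu, forall y, repr x y = (\1_B y)%:C} by exact: L2mkE F2.
  apply: L2_ext; apply: filterS2 (repr_mulL x (bfun_indic R mB)) e1 => y -> ->.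
  by rewrite -rmorphM /= indicE; case: (_ \in _); rewrite ?mulr1 ?mulr0.
have nx : (nsq dot x)%:E = nu B.
  rewrite nsqE /Rintegral fineK; last first.
    by apply: integrable_fin_num => //; exact: integrable_nsq.
  rewrite -iB; apply: ae_eq_integral => //.
  - exact: measurable_int (integrable_nsq x).
  - by have [m _] := (L2_predP nu _).1 F2; exact: measurable_normc2.
  - by apply: filterS (L2mkE F2) => y ->.
apply: etrans (esym nx) _; congr EFin; apply/eqP; rewrite eq_le nsq_ge0 andbT.
have bhB : bfun (fun y => h y * \1_B y) by apply: bfunM => //; exact: bfun_indic.
have : nsq dot (mulL h x) <= e ^+ 2 * nsq dot x.
  have -> : mulL h x = mulL (fun y => h y * \1_B y) x.
    by rewrite -(mulLM x bh (bfun_indic R mB)) xB.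
  apply: nsq_mulL_le => // y; rewrite indicE; have [yB|_] := boolP (y \in B).
    rewrite mulr1 -[leLHS]real_normK ?num_real// ler_pXn2r ?nnegrE ?(ltW e0)//.
    by move: yB; rewrite inE => -[/ltW].
  by rewrite mulr0 expr0n /= sqr_ge0.
move=> /(ler_wpM2l k0) /(le_trans (hk x)); rewrite mulrA.
have := nsq_ge0 dot x; nra.
Qed.

(** On vectors supported in {h < 0} the form of |h| is minus that of [h], hence at most 0, and yet
    it is at least e |x|^2; so there are no such vectors but 0. *)
Lemma positive_mulL_ae h (e : R) : bfun h -> 0 < e ->
  {ae nu, forall y, e <= `|h y|} -> positive_op dot (mulL h) ->
  {ae nu, forall y, e <= h y}.
Proof.
move=> bh e0 he ph.
pose N := [set y | h y < 0].
have mN : measurable N.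
  rewrite (_ : N = h @^-1` `]-oo, 0[%classic).
    by rewrite -[X in measurable X]setTI; apply: bh.1.
  by apply/seteqP; split => y; rewrite /N /= in_itv.
have bN : bfun (\1_N : Y -> R) by exact: bfun_indic.
have N0 u : mulL \1_N u = 0.
  set x := mulL \1_N u.
  (* The maximum equals |h| almost everywhere and makes the lower bound [e] hold at every point, as
     [rdot_mulL_ge] asks. *)
  have bk : bfun (fun y => Num.max e `|h y|).
    split; first by apply: measurable_maxr => //; exact: measurableT_comp bh.1.
    have [C C0 hC] := bfunP bh; exists (e + C) => y.
    rewrite ger0_norm; last by rewrite le_max (ltW e0).
    rewrite ge_max; apply/andP; split.
      by rewrite lerDl ltW.
    by rewrite (le_trans (hC y))// lerDr ltW.
  have kx : mulL (fun y => Num.max e `|h y|) x = - mulL h x.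
    rewrite /x !mulLM// -[RHS]sub0r.
    have -> : (0 : L2space nu) = mulL (fun=> 0) u by rewrite mulL_cst scale0r.
    rewrite -mulLB; [|exact: bfun_cst|exact: bfunM].
    congr (_ u); apply: mulL_ae.
    - by case: (bfunM bk bN).
    - by apply: bfunB; [exact: bfun_cst|exact: bfunM].
    - apply: filterS he => y ey; rewrite indicE; have [yN|_] := boolP (y \in N).
        rewrite max_r// ler0_norm; first by rewrite !mulr1 sub0r.
        by move: yN; rewrite inE => /ltW.
      by rewrite !mulr0 subr0.
  apply: (nsq_eq0 (dot := dot)); apply/eqP; rewrite eq_le nsq_ge0 andbT.
  have : e * nsq dot x <= rdot dot (mulL (fun y => Num.max e `|h y|) x) x.
    by apply: rdot_mulL_ge => // y; rewrite le_max lexx.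
  rewrite kx rdotNl => h2.
  have : e * nsq dot x <= 0.
    by apply: le_trans h2 _; rewrite oppr_le0; exact: positive_rdot.
  by rewrite pmulr_rle0.
have b1 : bfun (fun y => 1 - \1_N y : R) by apply: bfunB => //; exact: bfun_cst.
(* Multiplication by [1 - \1_N] is the identity, so it is bounded below with constant 1; the bound
   1/2 on its multiplier excludes the value 0, that is, the points of [N]. *)
have : {ae nu, forall y, 2^-1 <= `|1 - \1_N y : R|}.
  apply: (mulL_lower_bound_ae b1 (@ler01 R)) => [u||]; last 2 first.
  - by rewrite invr_gt0.
  - by lra.
  by rewrite mul1r mulLB//; [rewrite N0 subr0 mulL1|exact: bfun_cst].
apply: filterS2 he => y ey; rewrite indicE; have [_|yN] := boolP (y \in N).
  by rewrite subrr normr0 => ?; exfalso; lra.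
move=> _; move: yN; rewrite notin_setE /N /= => /negP; rewrite -leNgt => h0.
by rewrite -(ger0_norm h0).
Qed.

End Multiplier.

Section MultiplierSpectrum.
Context d (Y : measurableType d) (R : realType) (nu : {measure set Y -> \bar R}).
Hypothesis sfnu : sigma_finite [set: Y] nu.
Local Notation dot := (@L2dot _ _ R nu : {dot L2space nu for Num.conj}).
Variables (g : Y -> R) (c C : R).
Hypotheses (bg : bfun g) (c0 : 0 < c) (gcC : forall y, c <= g y <= C).
Local Notation K := (real_spectrum dot (mulL g)).
Implicit Types (u v x : L2space nu).

Lemma mulL_subZ (s : R) x : mulL g x - s%:C *: x = mulL (fun y => g y - s) x.
Proof. by rewrite mulLB//; [rewrite mulL_cst|exact: bfun_cst]. Qed.

Lemma notin_spectrum_mulL (s e : R) : 0 < e ->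
  {ae nu, forall y, e <= `|g y - s|} -> ~ K s.
Proof.
move=> e0 es; rewrite /real_spectrum /spectrum /= => nI; apply: nI.
have bs : bfun (fun y => g y - s) by apply: bfunB => //; exact: bfun_cst.
(* This equals 1 / (g - s) where |g - s| >= e and stays bounded elsewhere; writing the inverse as a
   power gives its measurability. *)
pose k y := (g y - s) * (Num.max (e ^+ 2) ((g y - s) ^+ 2)) `^ (-1).
have m0 y : 0 < Num.max (e ^+ 2) ((g y - s) ^+ 2).
  by rewrite lt_max exprn_gt0.
have bk : bfun k.
  apply: bfunM => //; split.
    apply: measurable_funpowR.
    apply: measurable_maxr => //; apply: measurable_funX; exact: bs.1.
  exists (e ^- 2) => y; rewrite powR_inv1 ?(ltW (m0 _))// ger0_norm ?invr_ge0 ?(ltW (m0 _))//.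
  by rewrite lef_pV2 ?posrE ?exprn_gt0// le_max lexx.
have kg : {ae nu, forall y, k y * (g y - s) = 1}.
  apply: filterS es => y ey; rewrite /k powR_inv1 ?(ltW (m0 _))// max_r; last first.
    by rewrite -[leRHS]real_normK ?num_real// ler_pXn2r ?nnegrE// (ltW e0).
  rewrite mulrAC -expr2 divff// expf_neq0// -normr_gt0.
  exact: lt_le_trans ey.
have bI : bfun (fun _ : Y => 1 : R) by exact: bfun_cst.
have kgE : mulL (nu := nu) (fun y => k y * (g y - s)) = mulL (fun=> 1).
  by apply: mulL_ae => //; case: (bfunM bk bs).
have -> : (fun x => mulL g x - s%:C *: x) = mulL (fun y => g y - s).
  by apply/funext => x; exact: mulL_subZ.
split; first exact: bounded_op_mulL.
exists (mulL k); split; first exact: bounded_op_mulL.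
  by move=> x; rewrite mulLM// kgE mulL1.
move=> x; rewrite mulLM//.
have -> : (fun y => (g y - s) * k y) = (fun y => k y * (g y - s)).
  by apply/funext => y; rewrite mulrC.
by rewrite kgE mulL1.
Qed.

Lemma notin_spectrum_mulL_ae (s : R) : ~ K s ->
  exists2 e, 0 < e & {ae nu, forall y, e <= `|g y - s|}.
Proof.
move=> /contrapT [bA [B [bB BA _]]].
have [k k0 kB] := bounded_op_nsq bB.
have bs : bfun (fun y => g y - s) by apply: bfunB => //; exact: bfun_cst.
have k1 : 0 < k + 1 by rewrite ltr_wpDl.
pose e := (k + 1)^-1.
(* With m = min(1, 1/(k + 1)) one has m^2 <= 1/(k + 1), hence k m^2 < 1. *)
exists (Num.min 1 e); first by rewrite lt_min ltr01 invr_gt0.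
apply: (mulL_lower_bound_ae sfnu bs k0) => [u||].
- by rewrite -{1}(BA u) -mulL_subZ.
- by rewrite lt_min ltr01 invr_gt0.
- set m := Num.min 1 e; have m1 : m <= 1 by rewrite ge_min lexx.
  have me : m <= e by rewrite ge_min lexx orbT.
  have m0 : 0 < m by rewrite lt_min ltr01 invr_gt0.
  have : m ^+ 2 <= e by rewrite expr2; nra.
  have ek : e * (k + 1) = 1 by rewrite mulVf// gt_eqF.
  have e0 : 0 < e by rewrite invr_gt0.
  by move=> h; have := ler_wpM2l k0 h; nra.
Qed.

Lemma spectrum_mulL_bounds (s : R) : K s -> c <= s <= C.
Proof.
move=> Ks; apply/andP; split; rewrite leNgt; apply/negP => h; move: Ks.
  apply: (notin_spectrum_mulL (e := c - s)); first by rewrite subr_gt0.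
  apply: aeW => y; rewrite ger0_norm; have := gcC y; lra.
apply: (notin_spectrum_mulL (e := s - C)); first by rewrite subr_gt0.
apply: aeW => y; rewrite ler0_norm; have := gcC y; lra.
Qed.

Let ball (q : R) (n : nat) : set (measurableTypeR R) :=
  [set t | `|t - q| < n.+1%:R^-1].

(** An enumeration of the balls with rational centre and radius 1/(n + 1) whose preimage under [g]
    is negligible; every other code gives the empty set. *)
Let nballs (m : nat) : set (measurableTypeR R) :=
  if unpickle m is Some (q, n) then
    if `[< nu.-negligible (g @^-1` (ball (ratr q) n)) >] then ball (ratr q) n
    else set0
  else set0.

Let nballs_negligible m : nu.-negligible (g @^-1` (nballs m)).
Proof.
rewrite /nballs; case: unpickle => [[q n]|]; last first.
  by rewrite preimage_set0; exact: negligible_set0.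
case: asboolP => // _; rewrite preimage_set0; exact: negligible_set0.
Qed.

Let measurable_nballs m : measurable (nballs m).
Proof.
rewrite /nballs; case: unpickle => [[q n]|] //; case: asboolP => // _.
rewrite (_ : ball _ _ = (fun t => `|t - ratr q|) @^-1` `]-oo, n.+1%:R^-1[%classic).
  rewrite -[X in measurable X]setTI.
  apply: (measurableT_comp (@normr_measurable R setT)) => //.
  exact: measurable_funB.
by apply/seteqP; split => t; rewrite /ball /= in_itv.
Qed.

(** The spectrum is the essential range of [g]: a point lies outside exactly when [g] stays away
    from it almost everywhere, and then a small rational ball around it has a null preimage.
    Countability of the union gives both the measurability of [K] and [K (g y)] for almost every
    [y]. *)
Let setC_spectrumE : ~` K = \bigcup_m nballs m.
Proof.
apply/seteqP; split => s.
  move=> /notin_spectrum_mulL_ae[e e0 es].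
  have e20 : 0 < e / 2 by rewrite divr_gt0.
  have [n] := ltr_add_invr e20; rewrite add0r => ne.
  have [q] : exists q, ratr q \in `](s - n.+1%:R^-1), (s + n.+1%:R^-1)[.
    apply: rat_in_itvoo; rewrite ltrD2l.
    by rewrite (lt_trans (y := 0))// ?oppr_lt0 invr_gt0.
  rewrite in_itv /= => /andP[q1 q2].
  pose m := pickle (q, n).
  have mE : unpickle m = Some (q, n) by rewrite /m pickleK.
  exists m; first exact: Logic.I.
  rewrite /nballs mE; case: asboolP => [_|].
    by rewrite /ball /= distrC ltr_distl q1 q2.
  move=> abs; exfalso; apply: abs.
  move: es; apply: negligibleS => y /=; rewrite /ball /= => gq.
  apply/negP; rewrite -ltNge.
  rewrite (_ : g y - s = (g y - ratr q) + (ratr q - s)); last by ring.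
  apply: le_lt_trans (ler_normD _ _) _.
  have : `|ratr q - s| < n.+1%:R^-1 by rewrite ltr_distl q1 q2.
  move=> qs; apply: lt_trans (ltrD gq qs) _.
  by rewrite [ltRHS]splitr ltrD.
move=> [m _]; rewrite /nballs; case: unpickle => [[q n]|] //; case: asboolP => // nq sq.
have e0 : 0 < n.+1%:R^-1 - `|s - ratr q| by rewrite subr_gt0.
apply: (notin_spectrum_mulL e0).
move: nq; apply: negligibleS => y /=; rewrite /ball /= => /negP.
rewrite -ltNge => gs.
rewrite (_ : g y - ratr q = (g y - s) + (s - ratr q)); last by ring.
apply: le_lt_trans (ler_normD _ _) _.
by rewrite -ltrBrDr.
Qed.

Lemma measurable_spectrum_mulL : measurable (K : set (measurableTypeR R)).
Proof.
rewrite -[X in measurable X]setCK setC_spectrumE; apply: measurableC.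
exact: bigcupT_measurable.
Qed.

Lemma mulL_in_spectrum : {ae nu, forall y, K (g y)}.
Proof.
suff : nu.-negligible (g @^-1` (~` K)) by [].
rewrite setC_spectrumE preimage_bigcup.
exact: negligible_bigcup.
Qed.

End MultiplierSpectrum.

(** * Images of measures with an integrable density *)

Section ImageDensity.
Context d d' (Y : measurableType d) (Z : measurableType d') (R : realType).
Variable nu : {measure set Y -> \bar R}.
Variables (g : Y -> Z) (f : Y -> R).
Hypotheses (mg : measurable_fun [set: Y] g) (f0 : forall y, 0 <= f y).
Hypothesis fi : nu.-integrable setT (EFin \o f).

(** The proofs are arguments of the set function so that the measure structures
    declared below can be inferred from it. *)
Definition image_density & measurable_fun [set: Y] g & (forall y, 0 <= f y)
    & nu.-integrable setT (EFin \o f) : set Z -> \bar R :=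
  fun A => (\int[nu]_(y in g @^-1` A) (f y)%:E)%E.

Local Notation m := (image_density mg f0 fi).

Let mpre (A : set Z) : measurable A -> measurable (g @^-1` A).
Proof. by move=> mA; rewrite -[X in measurable X]setTI; exact: mg. Qed.

Let m0 : m set0 = 0%E.
Proof. by rewrite /image_density preimage_set0 integral_set0. Qed.

Let m_ge0 A : (0 <= m A)%E.
Proof. by apply: integral_ge0 => y _; rewrite lee_fin. Qed.

Let m_sigma_additive : semi_sigma_additive m.
Proof.
move=> F mF tF mUF; rewrite /image_density preimage_bigcup.
apply: (semi_sigma_additive_nng_induced (mu := nu) (f := EFin \o f)) => //.
- exact: measurable_int fi.
- by move=> i; exact: mpre.
- apply/trivIsetP => i j _ _ ij; rewrite -preimage_setI.
  by rewrite (trivIsetP.1 tF i j)// preimage_set0.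
- by rewrite -preimage_bigcup; exact: mpre.
Qed.

HB.instance Definition _ := isMeasure.Build _ _ _ m m0 m_ge0 m_sigma_additive.

Let m_finite : fin_num_fun m.
Proof.
move=> A mA; apply: integrable_fin_num; first exact: mpre.
by apply: integrableS fi => //; exact: mpre.
Qed.

HB.instance Definition _ := @Measure_isFinite.Build _ _ _ m m_finite.

End ImageDensity.

Section ImageDensityIntegral.
Context d d' (Y : measurableType d) (Z : measurableType d') (R : realType).
Variable sig : {sigma_finite_measure set Y -> \bar R}.
Variables (g : Y -> Z) (f : Y -> R).
Hypotheses (mg : measurable_fun [set: Y] g) (f0 : forall y, 0 <= f y).
Hypothesis fi : sig.-integrable setT (EFin \o f).

(** Equal integrals over measurable sets identify [f] almost everywhere with the Radon-Nikodym
    derivative of [m], to which the change of variables applies. *)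
Lemma integral_density (a : Y -> \bar R) :
  let m := image_density (@measurable_id _ Y setT) f0 fi in
  m.-integrable setT a ->
  (\int[m]_y a y = \int[sig]_y (a y * (f y)%:E))%E.
Proof.
move=> m ia.
have dom : m `<< sig.
  apply/null_content_dominatesP => A mA A0.
  rewrite /m /= /image_density preimage_id; apply: null_set_integral => //.
  by apply: measurable_funTS; exact: measurable_int fi.
rewrite -(Radon_Nikodym_change_of_variables dom measurableT ia).
have im := measurable_int _ ia.
apply: (ae_eq_integral (mu := sig)) => //.
- by apply: emeasurable_funM.
- by apply: emeasurable_funM => //; exact: measurable_int fi.
have ef : ae_eq sig setT (Radon_Nikodym (charge_of_finite_measure m) sig) (EFin \o f).
  apply: (integral_ae_eq measurableT).
  - exact: Radon_Nikodym_integrable.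
  - exact: measurable_int fi.
  - move=> A _ mA; rewrite -Radon_Nikodym_integral//.
by apply: filterS ef => y /= e _; rewrite e.
Qed.

End ImageDensityIntegral.

Section ImageDensityBounded.
Context d d' (Y : measurableType d) (Z : measurableType d') (R : realType).
Variable sig : {sigma_finite_measure set Y -> \bar R}.
Variables (g : Y -> Z) (f : Y -> R).
Hypotheses (mg : measurable_fun [set: Y] g) (f0 : forall y, 0 <= f y).
Hypothesis fi : sig.-integrable setT (EFin \o f).
Variables (a : Z -> R).
Hypothesis ba : bfun a.

Lemma bfun_integrable (m : {finite_measure set Z -> \bar R}) :
  m.-integrable setT (EFin \o a).
Proof.
have [b b0 ab] := bfunP ba.
apply: (le_integrable measurableT _ _ (finite_measure_integrable_cst m b measurableT)).
  by apply/measurable_EFinP; case: ba.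
by move=> z _ /=; rewrite lee_fin (le_trans (ab z))// ler_norm.
Qed.

Lemma Rintegral_image_density :
  Rintegral (image_density mg f0 fi) setT a =
  Rintegral sig setT (fun y => a (g y) * f y).
Proof.
have ma : measurable_fun setT (EFin \o a) by apply/measurable_EFinP; case: ba.
pose m := image_density (@measurable_id _ Y setT) f0 fi.
have im : m.-integrable setT (EFin \o (a \o g)).
  have [b b0 ab] := bfunP ba.
  apply: (le_integrable measurableT _ _ (finite_measure_integrable_cst m b measurableT)).
    by apply: (measurableT_comp ma mg).
  by move=> z _ /=; rewrite lee_fin (le_trans (ab _))// ler_norm.
rewrite /Rintegral; congr fine.
transitivity (\int[pushforward m g]_z (a z)%:E)%E.
  by apply: eq_measure_integral.
rewrite (integral_pushforward mg ma im)//.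
rewrite preimage_setT (integral_density (sig := sig) im).
by apply: eq_integral => y _; rewrite EFinM.
Qed.

End ImageDensityBounded.

(** * Functional calculus of a multiplier and uniqueness of its spectral measure *)

Section MulSpectral.
Context d (Y : measurableType d) (R : realType).
Variable sig : {sigma_finite_measure set Y -> \bar R}.
Local Notation dot := (@L2dot _ _ R sig : {dot L2space sig for Num.conj}).
Variables (g : Y -> R) (c C : R).
Hypotheses (bg : bfun g) (c0 : 0 < c) (gcC : forall y, c <= g y <= C).
Local Notation G := (mulL (nu := sig) g).
Local Notation K := (real_spectrum dot G).
Implicit Types (u v x : L2space sig) (a : measurableTypeR R -> R).
Implicit Types (B : set (measurableTypeR R)).

(** The Borel function a(G) of the operator [G]; indicators give its spectral projections. *)
Definition fcalc a : L2space sig -> L2space sig := mulL (fun y => a (g y)).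

Lemma bfun_comp a : bfun a -> bfun (fun y => a (g y)).
Proof.
move=> [ma [b ab]]; split; first exact: (measurableT_comp ma bg.1).
by exists b => y; exact: ab.
Qed.

(** The scalar spectral measure of [G] at [u]: the image under [g] of the measure with density
    |u|^2. *)
Definition mul_marginal u : {finite_measure set (measurableTypeR R) -> \bar R} :=
  image_density (g := g : Y -> measurableTypeR R) bg.1
    (fun y => normc2_ge0 (repr u y : R[i])) (integrable_nsq u).

Lemma Rintegral_mul_marginal a u : bfun a ->
  Rintegral (mul_marginal u) setT a = rdot dot (fcalc a u) u.
Proof.
move=> ba; rewrite rdot_mulL; last exact: bfun_comp.
exact: (Rintegral_image_density (sig := sig)).
Qed.

Lemma mul_marginal_indic B u : measurable B ->
  mul_marginal u B = (rdot dot (fcalc \1_B u) u)%:E.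
Proof.
move=> mB; rewrite -Rintegral_mul_marginal; last exact: bfun_indic.
rewrite /Rintegral fineK; last first.
  apply: integrable_fin_num => //; apply: bfun_integrable; exact: bfun_indic.
by rewrite integral_indic// setIT.
Qed.

Lemma fcalc_comp a b u : bfun a -> bfun b ->
  fcalc a (fcalc b u) = fcalc (fun s => a s * b s) u.
Proof. by move=> ba bb; rewrite /fcalc mulLM//; exact: bfun_comp. Qed.

Lemma indicM B B' : (fun s : measurableTypeR R => \1_B s * \1_B' s : R) = \1_(B `&` B').
Proof. by apply/funext => s; rewrite indicI. Qed.

Lemma fcalc_indic_comm B u : measurable B -> G (fcalc \1_B u) = fcalc \1_B (G u).
Proof.
move=> mB.
have b1 : bfun (fun y => \1_B (g y) : R) by apply: bfun_comp; exact: bfun_indic.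
rewrite /fcalc (mulLM u bg b1) (mulLM u b1 bg).
by congr (mulL _ u); apply/funext => y; rewrite mulrC.
Qed.

Lemma fcalc_indic_idem B u : measurable B ->
  fcalc \1_B (fcalc \1_B u) = fcalc \1_B u.
Proof. by move=> mB; rewrite fcalc_comp ?indicM ?setIid//; exact: bfun_indic. Qed.

Lemma fcalc_indic_form_affine B (a b : R) u : measurable B ->
  fcalc \1_B u = u -> (forall t, B t -> 0 <= a + b * t) ->
  0 <= a * nsq dot u + b * rdot dot (G u) u.
Proof.
move=> mB Bu Bs.
have b1 : bfun (fun y => \1_B (g y) : R) by apply: bfun_comp; exact: bfun_indic.
have ba : bfun (fun _ : Y => a) by exact: bfun_cst.
have bb : bfun (fun _ : Y => b) by exact: bfun_cst.
have bbg := bfunM bb bg; have bab := bfunD ba bbg.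
have -> : a * nsq dot u + b * rdot dot (G u) u =
    rdot dot (mulL (fun y => (a + b * g y) * \1_B (g y)) u) u.
  rewrite -(mulLM u bab b1) -/(fcalc \1_B u) Bu (mulLD u ba bbg).
  by rewrite -(mulLM u bb bg) !mulL_cst rdotDl !rdotZl.
rewrite (rdot_mulL u (bfunM bab b1)); apply: Rintegral_ge0 => y _.
rewrite mulr_ge0 ?normc2_ge0// indicE.
by have [/set_mem/Bs|_] := boolP (_ \in B); rewrite ?mulr1 ?mulr0.
Qed.

Lemma fcalc_indic_form_le B (s : R) u : measurable B -> fcalc \1_B u = u ->
  (forall t, B t -> t <= s) -> rdot dot (G u) u <= s * nsq dot u.
Proof.
move=> mB Bu Bs; have := @fcalc_indic_form_affine B s (-1) u mB Bu.
by rewrite mulN1r subr_ge0; apply => t /Bs; rewrite mulN1r subr_ge0.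
Qed.

Lemma fcalc_indic_form_ge B (s : R) u : measurable B -> fcalc \1_B u = u ->
  (forall t, B t -> s <= t) -> s * nsq dot u <= rdot dot (G u) u.
Proof.
move=> mB Bu Bs; have := @fcalc_indic_form_affine B (- s) 1 u mB Bu.
rewrite mul1r mulNr addrC subr_ge0; apply => t /Bs.
by rewrite mul1r addrC subr_ge0.
Qed.

Lemma lin_mulLg : linear G. Proof. exact: mulL_linear. Qed.

Let Gi : L2space sig -> L2space sig := mulL (fun y => (g y) `^ (-1)).

Let g0 y : 0 < g y. Proof. by case/andP: (gcC y) => /(lt_le_trans c0). Qed.

Let bgi : bfun (fun y => (g y) `^ (-1)).
Proof.
split; first by apply: measurable_funpowR; case: bg.
exists c^-1 => y; rewrite powR_inv1 ?(ltW (g0 _))// ger0_norm ?invr_ge0 ?(ltW (g0 _))//.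
by rewrite lef_pV2 ?posrE//; case/andP: (gcC y).
Qed.

Let GiK : cancel Gi G.
Proof.
move=> u; rewrite /Gi mulLM// -[RHS]mulL1; congr (mulL _ u).
by apply/funext => y; rewrite powR_inv1 ?(ltW (g0 _))// divff// gt_eqF.
Qed.

Let GK : cancel G Gi.
Proof.
move=> u; rewrite /Gi mulLM// -[RHS]mulL1; congr (mulL _ u).
by apply/funext => y; rewrite powR_inv1 ?(ltW (g0 _))// mulVf// gt_eqF.
Qed.

Lemma mulLg_inj : injective G.
Proof. exact: can_inj GK. Qed.

Lemma rdot_mulL_sym x y : rdot dot (G x) y = rdot dot x (G y).
Proof. by rewrite /rdot mulL_sym. Qed.

(** [nsq_le_form] and [form_le_nsq] turn bounds on the quadratic form into growth rates for the
    powers of [G] and of its inverse. Accordingly [S] is stable under [G] and [S'] under the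
    inverse. *)
Lemma form_separation (S S' : set (L2space sig)) (s s' : R) : s < s' ->
  (forall x, S x -> S (G x)) -> (forall x, S' (G x) -> S' x) ->
  (forall x, S x -> rdot dot (G x) x <= s * nsq dot x) ->
  (forall x, S' x -> s' * nsq dot x <= rdot dot (G x) x) ->
  forall u v, S u -> S' v -> rdot dot u v = 0.
Proof.
move=> ss' SG S'G' Ss S's u v Su S'v.
have S'G x : S' x -> S' (Gi x) by move=> S'x; apply: S'G'; rewrite GiK.
have Gc x : c * nsq dot x <= rdot dot (G x) x.
  by apply: rdot_mulL_ge => // y; case/andP: (gcC y).
(* Growth rates make sense for positive [s]. If s < c, the bound [c] from below on the form leaves
   only the zero vector in [S]. *)
have [sc|cs] := ltP s c.
  suff -> : u = 0 by rewrite rdot0l.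
  apply: (nsq_eq0 (dot := dot)); apply/eqP; rewrite eq_le nsq_ge0 andbT.
  have := le_trans (Gc u) (Ss u Su); rewrite -subr_le0 -mulrBl pmulr_rle0//.
  by rewrite subr_gt0.
have s0 : 0 < s by exact: lt_le_trans cs.
have s'0 : 0 <= s' by rewrite ltW// (lt_trans s0).
have G0 x : 0 <= rdot dot (G x) x.
  by apply: le_trans (Gc x); rewrite mulr_ge0 ?nsq_ge0// ltW.
have h1 : forall x, S x -> S (G x) /\ nsq dot (G x) <= s ^+ 2 * nsq dot x.
  move=> x Sx; split; first exact: SG.
  exact: (nsq_le_form lin_mulLg rdot_mulL_sym s0 SG G0 Ss Sx).
have h2 : forall x, S' x -> S' (Gi x) /\ s' ^+ 2 * nsq dot (Gi x) <= nsq dot x.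
  move=> x S'x; split; first exact: S'G.
  have := form_le_nsq s'0 (S's _ (S'G _ S'x)).
  by rewrite GiK.
have ss : 0 < s < s' by rewrite s0.
exact: (growth_orthogonal rdot_mulL_sym ss GiK h1 h2 Su S'v).
Qed.

End MulSpectral.

(** Orthogonality gives |F x|^2 = (F x, x) = (F x, P x), and then |F x - P x|^2 = |P x|^2 - |F
    x|^2. *)
Lemma proj_nsq_le (R : realType) (V : lmodType R[i])
    (dot : {dot V for Num.conj}) (F P : V -> V) x :
  (forall u v, rdot dot (F u) v = rdot dot u (F v)) ->
  F (F x) = F x -> rdot dot (F x) (x - P x) = 0 ->
  nsq dot (F x) <= nsq dot (P x).
Proof.
move=> symF FF; rewrite rdotBr => e.
have e1 : nsq dot (F x) = rdot dot (F x) x by rewrite /nsq -symF FF.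
have := nsq_ge0 dot (F x - P x); rewrite nsqB; lra.
Qed.

Section MulSpectralUnique.
Context d (Y : measurableType d) (R : realType).
Variable sig : {sigma_finite_measure set Y -> \bar R}.
Local Notation dot := (@L2dot _ _ R sig : {dot L2space sig for Num.conj}).
Variables (g : Y -> R) (c C : R).
Hypotheses (bg : bfun g) (c0 : 0 < c) (gcC : forall y, c <= g y <= C).
Local Notation G := (mulL (nu := sig) g).
Local Notation K := (real_spectrum dot G).
Implicit Types (u v x : L2space sig) (a : measurableTypeR R -> R).
Implicit Types (B : set (measurableTypeR R)).

Let mK : measurable (K : set (measurableTypeR R)).
Proof. exact: (measurable_spectrum_mulL (sigma_finiteT sig) bg). Qed.

Variable E : set (measurableTypeR R) -> L2space sig -> L2space sig.
Hypothesis SE : spectral_measure dot K E.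
Hypothesis IG : spectral_integral dot K E id G.

Let EG B x : measurable B -> G (E B x) = E B (G x).
Proof.
by move=> mB; apply: (spectral_proj_comm mK SE IG) => // u v; exact: rdot_mulL_sym.
Qed.

Let mray (s : R) : measurable (oray s).
Proof. exact: measurable_itv. Qed.

(** Both projections commute with [G]. Its form is at most [s] on the range of [E (oray s)] and at
    least [s'] on the range of the indicator of the complement of [oray s'], so these ranges are
    orthogonal, which is the input of [proj_nsq_le]. *)
Lemma marginal_ray_le1 (s s' : R) u : s < s' ->
  nsq dot (E (oray s) u) <= nsq dot (fcalc g \1_(oray s') u).
Proof.
move=> ss'; have mC := measurableC (mray s').
apply: proj_nsq_le.
- by move=> x y; rewrite /rdot (spectral_proj_sym SE).
- by rewrite (spectral_projI SE)// setIid.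
- pose S : set (L2space sig) := [set x | E (oray s) x = x].
  pose S' : set (L2space sig) := [set x | fcalc g \1_(~` oray s') x = x].
  apply: (@form_separation _ _ _ sig g c C bg c0 gcC S S' s s' ss').
  + by move=> x; rewrite /S /= -EG// => ->.
  + by move=> x; rewrite /S' /= -fcalc_indic_comm// => /(mulLg_inj bg c0 gcC).
  + move=> x; rewrite /S /= => Sx; apply: (spectral_form_le mK SE IG (mray s) Sx).
    by move=> t; rewrite /oray /= in_itv /= => /ltW.
  + move=> x; rewrite /S' /= => Sx; apply: (fcalc_indic_form_ge bg mC Sx).
    by move=> t; rewrite /oray /= in_itv /= => /negP; rewrite -leNgt.
  + by rewrite /S /= (spectral_projI SE)// setIid.
  + rewrite /S' /=.
    have -> : u - fcalc g \1_(oray s') u = fcalc g \1_(~` oray s') u.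
      rewrite -[u in u - _]mulL1 -mulLB; [|exact: bfun_cst|by apply/bfun_comp/bfun_indic].
      by congr (mulL _ u); apply/funext => y; rewrite !indicE in_setC; case: (_ \in _); rewrite ?subr0 ?subrr.
    exact: fcalc_indic_idem.
Qed.

Lemma marginal_ray_le2 (s s' : R) u : s < s' ->
  nsq dot (fcalc g \1_(oray s) u) <= nsq dot (E (oray s') u).
Proof.
move=> ss'; have mC := measurableC (mray s').
apply: proj_nsq_le.
- move=> x y; rewrite /rdot mulL_sym//; exact/bfun_comp/bfun_indic.
- exact: fcalc_indic_idem.
- pose S : set (L2space sig) := [set x | fcalc g \1_(oray s) x = x].
  pose S' : set (L2space sig) := [set x | E (~` oray s') x = x].
  apply: (@form_separation _ _ _ sig g c C bg c0 gcC S S' s s' ss').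
  + by move=> x; rewrite /S /= -fcalc_indic_comm// => ->.
  + by move=> x; rewrite /S' /= -EG// => /(mulLg_inj bg c0 gcC).
  + move=> x; rewrite /S /= => Sx; apply: (fcalc_indic_form_le bg (mray s) Sx).
    by move=> t; rewrite /oray /= in_itv /= => /ltW.
  + move=> x; rewrite /S' /= => Sx; apply: (spectral_form_ge mK SE IG mC Sx).
    by move=> t; rewrite /oray /= in_itv /= => /negP; rewrite -leNgt.
  + by rewrite /S /=; exact: fcalc_indic_idem.
  + by rewrite /S' /= -(spectral_projC SE)// (spectral_projI SE)// setIid.
Qed.

Lemma spectral_marginal_unique u m B : spectral_marginal dot E u m ->
  measurable B -> m B = mul_marginal bg u B.
Proof.
move=> hm; apply: measure_eq_rays => s s' ss'.
have e1 t : m (oray t) = (nsq dot (E (oray t) u))%:E by rewrite (marginalE SE hm).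
have e2 t : mul_marginal bg u (oray t) = (nsq dot (fcalc g \1_(oray t) u))%:E.
  rewrite mul_marginal_indic//; congr EFin.
  have b1 : bfun (fun y => \1_(oray t) (g y) : R) by apply/bfun_comp/bfun_indic.
  rewrite -[in LHS](fcalc_indic_idem bg)// /nsq /rdot /fcalc.
  by rewrite (mulL_sym _ _ b1).
by rewrite !e1 !e2 !lee_fin; split; [exact: marginal_ray_le1|exact: marginal_ray_le2].
Qed.

End MulSpectralUnique.

Section FunctionalCalculus.
Context d (Y : measurableType d) (R : realType).
Variable sig : {sigma_finite_measure set Y -> \bar R}.
Local Notation dot := (@L2dot _ _ R sig : {dot L2space sig for Num.conj}).
Variables (g : Y -> R) (c C : R).
Hypotheses (bg : bfun g) (c0 : 0 < c) (gcC : forall y, c <= g y <= C).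
Local Notation G := (mulL (nu := sig) g).
Local Notation K := (real_spectrum dot G : set (measurableTypeR R)).
Implicit Types (u v x : L2space sig) (a : measurableTypeR R -> R).
Implicit Types (B : set (measurableTypeR R)).

Let mK : measurable K.
Proof. exact: (measurable_spectrum_mulL (sigma_finiteT sig) bg). Qed.

Let Kg : {ae sig, forall y, K (g y)}.
Proof. exact: (mulL_in_spectrum (sigma_finiteT sig) bg). Qed.

Let b1 B : measurable B -> bfun (fun y => \1_B (g y) : R).
Proof. by move=> mB; apply/bfun_comp/bfun_indic. Qed.

Lemma fcalc_spectral_measure : spectral_measure dot K (fun B => fcalc g \1_B).
Proof.
split.
- move=> B mB; split.
  + exact: bounded_op_mulL (b1 mB).
  + by apply/funext => x; exact: fcalc_indic_idem.
  + by move=> x y; exact: mulL_sym (b1 mB).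
- apply/funext => x; rewrite -[RHS]mulL1; congr (mulL _ x).
  by apply/funext => y; rewrite indicT.
- move=> B B' mB mB'; apply/funext => x /=.
  by rewrite fcalc_comp ?indicM//; exact: bfun_indic.
- move=> B mB BK; apply/funext => x.
  transitivity (mulL (nu := sig) (fun=> 0) x); last by rewrite mulL_cst scale0r.
  congr (_ x); apply: mulL_ae; [by case: (b1 mB)|exact: bfun_cst|].
  apply: filterS Kg => y Ky; rewrite indicE memNset// => By.
  by have : (B `&` K) (g y) by []; rewrite BK.
- move=> x; exists (mul_marginal bg x) => B mB.
  by rewrite mul_marginal_indic.
Qed.

Variable E : set (measurableTypeR R) -> L2space sig -> L2space sig.
Hypothesis mE : forall u m B, spectral_marginal dot E u m -> measurable B ->
  m B = mul_marginal bg u B.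
Hypothesis exE : forall u, exists m, spectral_marginal dot E u m.

(** The factors of a double operator integral are controlled only on the spectrum. Cutting off by
    [\1_K] bounds them everywhere and changes nothing for [G], since [g] takes values in [K] almost
    everywhere. *)
Lemma bfun_restrict_spectrum a (k : R) : measurable_fun setT a ->
  (forall s, K s -> `|a s| <= k) -> bfun (fun s => \1_K s * a s).
Proof.
move=> ma ak; split.
  by apply: measurable_funM => //; exact: measurable_indic.
exists `|k| => s; rewrite indicE; have [/set_mem Ks|_] := boolP (s \in K).
  by rewrite mul1r (le_trans (ak _ Ks))// ler_norm.
by rewrite mul0r normr0.
Qed.

(** A spectral integral sees [E] only through its marginals, and polarization recovers the operator.
    Left to right serves the uniqueness of the transform, right to left its existence. *)
Lemma spectral_integralP a (k : R) A : measurable_fun setT a ->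
  (forall s, K s -> `|a s| <= k) ->
  spectral_integral dot K E a A <-> A = fcalc g (fun s => \1_K s * a s).
Proof.
move=> ma ak; have baK := bfun_restrict_spectrum ma ak.
have bgK := bfun_comp bg baK.
have im u m : spectral_marginal dot E u m -> m.-integrable K (EFin \o a).
  move=> hm; apply: (le_integrable mK _ _ (finite_measure_integrable_cst m k mK)).
    by apply/measurable_EFinP; exact: measurable_funTS.
  by move=> s Ks /=; rewrite lee_fin (le_trans (ak _ Ks))// ler_norm.
have rm u m : spectral_marginal dot E u m ->
    Rintegral m K a = rdot dot (fcalc g (fun s => \1_K s * a s) u) u.
  move=> hm; rewrite -(Rintegral_mul_marginal bg u baK).
  rewrite Rintegral_mkcond.
  transitivity (Rintegral m setT (fun s => \1_K s * a s)).
    congr Rintegral; apply/funext => s; rewrite patchE indicE.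
    by case: (s \in K); rewrite ?mul1r ?mul0r.
  rewrite /Rintegral; congr fine; apply: eq_measure_integral => B mB _.
  exact: mE.
split=> [[bA hA]|->].
  apply: (quadratic_form_inj (dot := dot)); [by case: bA|exact: mulL_linear|].
  move=> u; have [m hm] := exE u; have [_ ->] := hA _ _ hm.
  by rewrite (rm _ _ hm) (dot_mulL_self _ bgK) -(rdot_mulL _ bgK).
split; first exact: bounded_op_mulL.
move=> u m hm; split; first exact: im hm.
by rewrite (rm _ _ hm) (dot_mulL_self _ bgK) -(rdot_mulL _ bgK).
Qed.

End FunctionalCalculus.

(** * Composition operators *)

Section Composition.
Context d (Y : measurableType d) (R : realType) (nu : {measure set Y -> \bar R}).
Local Notation dot := (@L2dot _ _ R nu : {dot L2space nu for Num.conj}).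
Implicit Types (u v x : L2space nu) (t s : Y -> Y).

Definition compL t u : L2space nu := L2mk nu (fun y => repr u (t y)).

Lemma comp_L2 t u : mpreserving nu t ->
  (fun y => repr u (t y) : R[i]) \in L2_pred nu.
Proof.
move=> pt; apply/L2_predP; have [mt _] := pt.
have [[mr mi] iu] := (L2_predP nu (repr u)).1 (repr_L2 u).
split; first by split; [exact: (measurableT_comp mr mt)|exact: (measurableT_comp mi mt)].
rewrite (mpreserving_ge0_integral (f := fun y => (normc2 (repr u y))%:E) pt) //.
  exact: measurable_normc2.
by move=> y; rewrite lee_fin normc2_ge0.
Qed.

Lemma repr_compL t u : mpreserving nu t ->
  {ae nu, forall y, repr (compL t u) y = repr u (t y)}.
Proof. by move=> pt; exact: L2mkE (comp_L2 u pt). Qed.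

Lemma compL_linear t : mpreserving nu t -> linear (compL t).
Proof.
move=> pt a u v; apply: L2_ext.
have e1 := repr_compL (a *: u + v) pt.
have e2 := mpreserving_ae pt (repr_L2D (a *: u) v).
have e3 := mpreserving_ae pt (repr_L2Z a u).
have e4 := repr_L2D (a *: compL t u) (compL t v).
have e5 := repr_L2Z a (compL t u).
have e6 := repr_compL u pt; have e7 := repr_compL v pt.
apply: filterS3 (filterI e1 e4) (filterI e2 e3) (filterI e5 (filterI e6 e7)).
by move=> y [-> ->] [-> ->] [-> [-> ->]].
Qed.

Lemma nsq_compL t u : mpreserving nu t -> nsq dot (compL t u) = nsq dot u.
Proof.
move=> pt; rewrite !nsqE.
rewrite -(mpreserving_Rintegral pt (integrable_nsq u)).
have pm := comp_L2 u pt.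
have [mF _] := (L2_predP nu _).1 pm.
rewrite /Rintegral; congr fine; apply: ae_eq_integral => //.
- exact: measurable_int (integrable_nsq (compL t u)).
- exact: measurable_normc2.
- by apply: filterS (repr_compL u pt) => y ->.
Qed.

Lemma compL_mulL t h u : mpreserving nu t -> bfun h ->
  compL t (mulL h u) = mulL (fun y => h (t y)) (compL t u).
Proof.
move=> pt bh.
have bht : bfun (fun y => h (t y)).
  case: bh => mh [b hb]; split; first by apply: measurableT_comp mh _; case: pt.
  by exists b.
apply: L2_ext; apply: filterS3 (filterI (repr_compL (mulL h u) pt)
  (repr_mulL (compL t u) bht)) (repr_compL u pt)
  (mpreserving_ae pt (repr_mulL u bh)) => y [-> ->] -> ->.
by [].
Qed.

Lemma rdot_compL t u v : mpreserving nu t ->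
  rdot dot (compL t u) (compL t v) = rdot dot u v.
Proof.
move=> pt; have := nsq_compL (u + v) pt.
rewrite (linD (compL_linear pt)) !nsqD !nsq_compL//; lra.
Qed.

Lemma dot_compL t u v : mpreserving nu t ->
  dot (compL t u) (compL t v) = dot u v.
Proof.
by move=> pt; rewrite !dotE -(linZ (compL_linear pt)) !rdot_compL.
Qed.

Lemma bounded_op_compL t : mpreserving nu t -> bounded_op dot (compL t).
Proof.
move=> pt; apply: bounded_opP; first exact: compL_linear.
by exists 1 => u; rewrite mul1r nsq_compL.
Qed.

End Composition.

(** * Exchange of integrals for a dominated kernel *)

Section BoundedKernelFubini.
Context d d' (O : measurableType d) (Y : measurableType d') (R : realType).
Variables (sigma : {sigma_finite_measure set O -> \bar R}).
Variables (sig : {sigma_finite_measure set Y -> \bar R}).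
Variables (H : O * Y -> R) (b : O -> R) (z : Y -> R).
Hypothesis mH : measurable_fun setT H.
Hypothesis Hb : forall w y, `|H (w, y)| <= b w.
Hypothesis ib : sigma.-integrable setT (EFin \o b).
Hypothesis iz : sig.-integrable setT (EFin \o z).

Let b0 w : 0 <= b w. Proof. exact: le_trans (Hb w point). Qed.

Lemma integrable_kernelr w :
  sig.-integrable setT (EFin \o (fun y => H (w, y) * z y)).
Proof.
apply: (integrable_bfunM (h := fun y => H (w, y))) => //; split.
  exact: (measurableT_comp mH (pair1_measurable w)).
by exists (b w).
Qed.

Lemma integrable_kernell y :
  sigma.-integrable setT (EFin \o (fun w => H (w, y))).
Proof.
apply: (le_integrable measurableT _ _ ib).
  apply/measurable_EFinP; exact: (measurableT_comp mH (pair2_measurable y)).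
by move=> w _ /=; rewrite lee_fin (le_trans (Hb w y))// ler_norm.
Qed.

Let mz : measurable_fun setT z.
Proof. by apply/measurable_EFinP; exact: measurable_int iz. Qed.

Let mF : measurable_fun [set: O * Y] (fun p => (H p * z p.2)%:E).
Proof.
apply/measurable_EFinP; apply: measurable_funM => //.
by apply: measurableT_comp => //.
Qed.

(** The bound |H(w, y) z(y)| <= b(w) |z(y)| is a product of integrable functions of separate
    variables, so Tonelli yields integrability on the product. *)
Let iF : (sigma \x sig)%E.-integrable setT (fun p => (H p * z p.2)%:E).
Proof.
apply/(integrable12ltyP sigma sig mF).
have iaz : sig.-integrable setT (EFin \o (fun y => `|z y|)).
  by have := integrable_norm iz.
have i0 w : (\int[sig]_y (b w * `|z y|)%:E = (b w)%:E * \int[sig]_y `|z y|%:E)%E.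
  rewrite -integralZl//; by apply: eq_integral => y _; rewrite EFinM.
apply: (@le_lt_trans _ _ (\int[sigma]_w ((b w)%:E * \int[sig]_y `|z y|%:E))%E).
  apply: ge0_le_integral => //.
  - by move=> w _; exact: integral_ge0.
  - apply: (measurable_fun_fubini_tonelli_F (abse \o (fun p => (H p * z p.2)%:E))) => //.
      exact: measurableT_comp mF.
    by move=> p; exact: abse_ge0.
  - apply: emeasurable_funM => //; exact: measurable_int ib.
  - move=> w _; rewrite -i0; apply: ge0_le_integral => //.
    + apply: measurableT_comp => //; exact: measurable_int (integrable_kernelr w).
    + by apply/measurable_EFinP; apply: measurable_funM => //; exact: measurableT_comp.
    + by move=> y _; rewrite lee_fin normrM ler_wpM2r.
have fz : (\int[sig]_y `|z y|%:E)%E \is a fin_num by exact: integrable_fin_num.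
rewrite -(fineK fz) integralZr//.
have fb : (\int[sigma]_w (b w)%:E)%E \is a fin_num by exact: integrable_fin_num.
by rewrite -(fineK fb) -EFinM ltry.
Qed.

Let inner_kernel y : (\int[sigma]_w (H (w, y) * z y)%:E)%E =
  (Rintegral sigma setT (fun w => H (w, y)) * z y)%:E.
Proof.
rewrite /Rintegral EFinM fineK; last first.
  by apply: integrable_fin_num => //; exact: integrable_kernell.
by rewrite -integralZr//; exact: integrable_kernell.
Qed.

Lemma measurable_kernel_swap : measurable_fun setT
  (fun y => Rintegral sigma setT (fun w => H (w, y)) * z y).
Proof.
apply/measurable_EFinP; have := measurable_fubini_G iF.
by rewrite (_ : fubini_G _ _ = EFin \o (fun y =>
  Rintegral sigma setT (fun w => H (w, y)) * z y)) //; apply/funext.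
Qed.

Lemma Rintegral_kernel_swap :
  Rintegral sigma setT (fun w => Rintegral sig setT (fun y => H (w, y) * z y)) =
  Rintegral sig setT (fun y => Rintegral sigma setT (fun w => H (w, y)) * z y).
Proof.
rewrite /Rintegral; congr fine.
transitivity (\int[sigma]_w \int[sig]_y (H (w, y) * z y)%:E)%E.
  apply: eq_integral => w _; rewrite fineK//.
  by apply: integrable_fin_num => //; exact: integrable_kernelr.
rewrite (Fubini iF); apply: eq_integral => y _ /=.
by rewrite inner_kernel.
Qed.

End BoundedKernelFubini.

(** * The induced Aluthge transform *)

(** Symbols admitting a factorization as in [double_operator_integral]. *)
Definition factorizable (R : realType) (K : set (measurableTypeR R))
    (psi : R -> R -> R) :=
  exists (d : measure_display) (Omega : measurableType d)
    (sigma : {sigma_finite_measure set Omega -> \bar R})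
    (alpha beta : Omega -> measurableTypeR R -> R) (a b : Omega -> R),
  [/\ measurable_fun [set: Omega * measurableTypeR R]
        (fun p => alpha p.1 p.2) /\
      measurable_fun [set: Omega * measurableTypeR R]
        (fun p => beta p.1 p.2),
      forall w s, K s -> `|alpha w s| <= a w /\ `|beta w s| <= b w,
      sigma.-integrable setT (EFin \o (fun w => a w * b w)) &
      forall s t, K s -> K t ->
        psi s t = Rintegral sigma setT (fun w => alpha w s * beta w t)].

Section Aluthge.
Context d (Y : measurableType d) (R : realType).
Variable sig : {sigma_finite_measure set Y -> \bar R}.
Local Notation dot := (@L2dot _ _ R sig : {dot L2space sig for Num.conj}).
Variables (g : Y -> R) (c C : R).
Hypotheses (bg : bfun g) (c0 : 0 < c) (gcC : forall y, c <= g y <= C).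
Local Notation G := (mulL (nu := sig) g).
Local Notation K := (real_spectrum dot G : set (measurableTypeR R)).
Variable t : Y -> Y.
Hypothesis pt : mpreserving sig t.
Local Notation U := (compL (nu := sig) t).
Implicit Types (u v x : L2space sig).

Let mK : measurable K.
Proof. exact: (measurable_spectrum_mulL (sigma_finiteT sig) bg). Qed.

Let Kg : {ae sig, forall y, K (g y)}.
Proof. exact: (mulL_in_spectrum (sigma_finiteT sig) bg). Qed.

Let Kgt : {ae sig, forall y, K (g (t y))}.
Proof. exact: (mpreserving_ae pt Kg). Qed.

Variables (psi : R -> R -> R) (k : Y -> R).
Hypothesis bk : bfun k.
Hypothesis hk : {ae sig, forall y, k (t y) = psi (g y) (g (t y))}.

Let bkt : bfun (fun y => k (t y)).
Proof.
case: bk => mk [b hb]; split; first by apply: measurableT_comp mk _; case: pt.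
by exists b.
Qed.

(** Commuting [U] past the right factor makes the integrand the multiplication by alpha(w, g)
    beta(w, g o t), applied to [U x]. Fubini then integrates over [w] first and rebuilds psi(g, g o
    t) = k o t, the multiplier of [U (mulL k x)]. *)
Lemma double_integral_dot (d' : measure_display) (O : measurableType d')
    (sigma : {sigma_finite_measure set O -> \bar R})
    (alpha beta : O -> measurableTypeR R -> R) (a b : O -> R) :
  measurable_fun [set: O * measurableTypeR R] (fun p => alpha p.1 p.2) ->
  measurable_fun [set: O * measurableTypeR R] (fun p => beta p.1 p.2) ->
  (forall w s, K s -> `|alpha w s| <= a w /\ `|beta w s| <= b w) ->
  sigma.-integrable setT (EFin \o (fun w => a w * b w)) ->
  (forall s s', K s -> K s' ->
     psi s s' = Rintegral sigma setT (fun w => alpha w s * beta w s')) ->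
  forall x y,
  cintegral sigma (fun w =>
    dot (fcalc g (fun s => \1_K s * alpha w s)
      (U (fcalc g (fun s => \1_K s * beta w s) x))) y) =
  dot (U (mulL k x)) y.
Proof.
move=> ma mb ab iab psiE x y.
pose H (p : O * Y) := (\1_K (g p.2) * alpha p.1 (g p.2)) *
  (\1_K (g (t p.2)) * beta p.1 (g (t p.2))).
have mgt : measurable_fun setT (fun z => g (t z)).
  by apply: measurableT_comp bg.1 _; case: pt.
have mpair (h : Y -> measurableTypeR R) : measurable_fun setT h ->
    measurable_fun [set: O * Y] (fun p => (p.1, h p.2)).
  move=> mh; apply: measurable_fun_pair; first exact: measurable_fst.
  by apply: measurableT_comp mh _; exact: measurable_snd.
have mind (h : Y -> measurableTypeR R) : measurable_fun setT h ->
    measurable_fun [set: O * Y] (fun p => \1_K (h p.2) : R).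
  move=> mh; apply: (measurableT_comp (measurable_indic mK)).
  by apply: measurableT_comp mh _; exact: measurable_snd.
have mH : measurable_fun setT H.
  apply: measurable_funM; apply: measurable_funM.
  - exact: (mind g bg.1).
  - exact: (measurableT_comp ma (mpair g bg.1)).
  - exact: (mind _ mgt).
  - exact: (measurableT_comp mb (mpair _ mgt)).
(* The absolute value covers the points where an indicator vanishes: the signs of [a w] and [b w]
   are controlled only through points of [K]. *)
have Hab w z : `|H (w, z)| <= `|a w * b w|.
  rewrite /H !normrM /= !indicE.
  have [/set_mem Kz|_] := boolP (g z \in K); last by rewrite normr0 !mul0r mulr_ge0.
  have [/set_mem Ktz|_] := boolP (g (t z) \in K); last first.
    by rewrite normr0 mul0r mulr0 mulr_ge0.
  rewrite normr1 !mul1r; have [h1 _] := ab w _ Kz; have [_ h2] := ab w _ Ktz.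
  by apply: ler_pM => //; [apply: le_trans h1 _|apply: le_trans h2 _]; exact: ler_norm.
have iab' : sigma.-integrable setT (EFin \o (fun w => `|a w * b w|)).
  by have := integrable_norm iab.
have ba w : bfun (fun s => \1_K s * alpha w s).
  apply: (bfun_restrict_spectrum bg (k := a w)); last by move=> s /ab-/(_ w)[].
  exact: (measurableT_comp ma (pair1_measurable w)).
have bb w : bfun (fun s => \1_K s * beta w s).
  apply: (bfun_restrict_spectrum bg (k := b w)); last by move=> s /ab-/(_ w)[].
  exact: (measurableT_comp mb (pair1_measurable w)).
pose z p : R[i] := repr (U x) p * conjc (repr y p).
have [izr izi] : cintegrable sig z by exact: cintegrable_mul.
have dotw w : dot (fcalc g (fun s => \1_K s * alpha w s)
    (U (fcalc g (fun s => \1_K s * beta w s) x))) y =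
    cintegral sig (fun p => (H (w, p))%:C * z p).
  have b1 := bfun_comp bg (ba w); have b2 := bfun_comp bg (bb w).
  have b3 : bfun (fun p => \1_K (g (t p)) * beta w (g (t p))).
    case: b2 => m2 [e he]; split; first by apply: measurableT_comp m2 _; case: pt.
    by exists e.
  rewrite /fcalc (compL_mulL x pt b2) (mulLM (U x) b1 b3).
  by rewrite (dot_mulL _ _ (bfunM b1 b3)).
have dotk : dot (U (mulL k x)) y = cintegral sig (fun p => (k (t p))%:C * z p).
  by rewrite (compL_mulL x pt bk) (dot_mulL _ _ bkt).
have ReM (e : R) (q : R[i]) : complex.Re (e%:C * q) = e * complex.Re q.
  by case: q => q1 q2 /=; ring.
have ImM (e : R) (q : R[i]) : complex.Im (e%:C * q) = e * complex.Im q.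
  by case: q => q1 q2 /=; ring.
have inner : {ae sig, forall p, Rintegral sigma setT (fun w => H (w, p)) = k (t p)}.
  apply: filterS3 Kg Kgt hk => p K1 K2 ->; rewrite psiE//.
  congr Rintegral; apply/funext => w; rewrite /H /= !indicE !mem_set//.
  by rewrite !mul1r.
have swap (zr : Y -> R) : sig.-integrable setT (EFin \o zr) ->
    Rintegral sigma setT (fun w => Rintegral sig setT (fun p => H (w, p) * zr p)) =
    Rintegral sig setT (fun p => k (t p) * zr p).
  move=> izr'; rewrite (Rintegral_kernel_swap mH Hab iab' izr').
  rewrite /Rintegral; congr fine; apply: ae_eq_integral => //.
  - by apply/measurable_EFinP; exact: (measurable_kernel_swap mH Hab iab' izr').
  - apply/measurable_EFinP; apply: measurable_funM; first by case: bkt.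
    by apply/measurable_EFinP; exact: measurable_int izr'.
  - by apply: filterS inner => p e _ /=; rewrite -e.
rewrite dotk /cintegral; congr (_ +i* _).
  transitivity (Rintegral sigma setT (fun w =>
      Rintegral sig setT (fun p => H (w, p) * complex.Re (z p)))).
    congr Rintegral; apply/funext => w; rewrite dotw /cintegral /=.
    by congr Rintegral; apply/funext => p; rewrite ReM.
  rewrite swap//; congr Rintegral; apply/funext => p; rewrite ReM//.
transitivity (Rintegral sigma setT (fun w =>
    Rintegral sig setT (fun p => H (w, p) * complex.Im (z p)))).
  congr Rintegral; apply/funext => w; rewrite dotw /cintegral /=.
  by congr Rintegral; apply/funext => p; rewrite ImM.
by rewrite swap//; congr Rintegral; apply/funext => p; rewrite ImM.
Qed.

Lemma fcalc_id_spectrum : fcalc g (fun s => \1_K s * s) = G.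
Proof.
rewrite /fcalc; apply: mulL_ae => //.
  apply: measurable_funM; last by case: bg.
  by apply: (measurableT_comp (measurable_indic mK)); case: bg.
by apply: filterS Kg => y Ky; rewrite indicE mem_set// mul1r.
Qed.

Let g0 y : 0 < g y. Proof. by case/andP: (gcC y) => /(lt_le_trans c0). Qed.

Let G0 : positive_op dot G.
Proof. by apply: positive_op_mulL => // y; exact: ltW. Qed.

Lemma abs_value_unique P : absolute_value dot (U \o G) P -> P = G.
Proof.
move=> [_ pP e].
have C0 : 0 < C by case/andP: (gcC point) => c1 c2; apply: lt_le_trans (le_trans c1 c2).
have cC : c <= C by case/andP: (gcC point) => c1 c2; apply: le_trans c1 c2.
(* C - G is multiplication by a function between 0 and C - c, so it contracts by (C - c) / C
   relative to [C]; [q] is the square of this ratio because [nsq] is a squared norm. *)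
apply: (positive_sqrt_unique (k := C) (q := ((C - c) / C) ^+ 2) pP) => //.
- exact: mulL_linear.
- exact: bounded_op_mulL.
- rewrite sqr_ge0 expr_lt1// ?divr_ge0 ?subr_ge0 ?(ltW C0)//.
  by rewrite ltr_pdivrMr// mul1r gtrBl.
- move=> x; rewrite -exprMn divfK ?gt_eqF//.
  have -> : C%:C *: x - G x = mulL (fun y => C - g y) x.
    by rewrite mulLB ?mulL_cst//; exact: bfun_cst.
  apply: nsq_mulL_le; first by apply: bfunB => //; exact: bfun_cst.
  move=> y; case/andP: (gcC y) => c1 c2.
  by rewrite ler_pXn2r ?nnegrE ?subr_ge0// lerB.
- move=> x; apply: (dot_ext (dot := dot)) => y.
  by rewrite e /= dot_compL// (mulL_sym (G x) y bg).
Qed.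

(** [P] is forced as a positive square root, [W] because [G] is onto, and the marginals of [E] by
    comparison on rays. Hence every [Alpha w] and [Beta w] is the multiplier dictated by its symbol,
    and the integral has the same value for every factorization. *)
Lemma Aluthge_unique f D : (forall s s', K s -> K s' -> psi s s' = s * f (s' / s)) ->
  is_induced_aluthge dot f (U \o G) D -> D = U \o mulL k.
Proof.
move=> psif [W [P [E [pd sd doi]]]].
have [absP _ SW _ _] := pd.
have PG : P = G by exact: abs_value_unique.
rewrite PG in SW sd doi.
(* Every vector is a value of [G], and [W] and [U] agree after [G]. *)
have WU : W = U.
  apply/funext => x.
  have Gs : exists x', x = G x'.
    exists (mulL (fun y => (g y) `^ (-1)) x).
    have bgi : bfun (fun y => (g y) `^ (-1)).
      split; first by apply: measurable_funpowR; case: bg.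
      exists c^-1 => y; rewrite powR_inv1 ?(ltW (g0 _))// ger0_norm ?invr_ge0 ?(ltW (g0 _))//.
      by rewrite lef_pV2 ?posrE//; case/andP: (gcC y).
    rewrite (mulLM x bg bgi) -[LHS]mulL1; congr (mulL _ x); apply/funext => y.
    by rewrite powR_inv1 ?(ltW (g0 _))// divff// gt_eqF.
  by have [x' ->] := Gs; have := congr1 (fun F => F x') SW => /= <-.
rewrite WU in doi.
have [SE IE] := sd.
have [bD [dO [Om [sigma [alpha [beta [a [b [Alpha [Beta [[ma mb] ab iab psiE [AB De]]]]]]]]]]]] := doi.
have mE u m B := @spectral_marginal_unique _ _ _ sig g c C bg c0 gcC E SE IE u m B.
have exE u : exists m, spectral_marginal dot E u m by case: SE.
apply/funext => x; apply: (dot_ext (dot := dot)) => y.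
rewrite De /= -(double_integral_dot ma mb ab iab); last first.
  by move=> s s' Ks Ks'; rewrite psif// psiE.
congr cintegral; apply/funext => w; have [hA hB] := AB w.
have ma' : measurable_fun setT (alpha w) by exact: (measurableT_comp ma (pair1_measurable w)).
have mb' : measurable_fun setT (beta w) by exact: (measurableT_comp mb (pair1_measurable w)).
have ka s : K s -> `|alpha w s| <= a w by move=> /ab-/(_ w)[].
have kb s : K s -> `|beta w s| <= b w by move=> /ab-/(_ w)[].
rewrite ((spectral_integralP mE exE _ ma' ka).1 hA).
by rewrite ((spectral_integralP mE exE _ mb' kb).1 hB).
Qed.

(** The witness is [U], [G] and the indicator projections. As [U] is isometric and [G] injective,
    both kernels in the polar decomposition are trivial. *)
Lemma Aluthge_exists f : (forall s s', K s -> K s' -> psi s s' = s * f (s' / s)) ->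
  factorizable K psi -> is_induced_aluthge dot f (U \o G) (U \o mulL k).
Proof.
move=> psif [dO [Om [sigma [alpha [beta [a [b [[ma mb] ab iab psiE]]]]]]]].
have bU : bounded_op dot U by exact: bounded_op_compL.
have bG : bounded_op dot G by exact: bounded_op_mulL.
have SE := fcalc_spectral_measure sig bg.
have mE u m B : spectral_marginal dot (fun B => fcalc g \1_B) u m ->
    measurable B -> m B = mul_marginal bg u B.
  by move=> hm mB; rewrite hm// mul_marginal_indic.
have exE u : exists m, spectral_marginal dot (fun B => fcalc g \1_B) u m by case: SE.
have U0 x : U x = 0 -> x = 0.
  by move=> Ux; apply: (nsq_eq0 (dot := dot)); rewrite -(nsq_compL x pt) Ux nsq0.
have G0' x : G x = 0 -> x = 0.
  by move=> Gx; apply: (mulLg_inj bg c0 gcC); rewrite Gx (lin0 (mulL_linear bg)).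
exists U, G, (fun B => fcalc g \1_B); split.
- split; [|exact: bU|exact: erefl| |].
  + split; [exact: (bounded_op_comp bU bG)|exact: G0|].
    by move=> x y /=; rewrite dot_compL// (mulL_sym (G x) y bg).
  + move=> x; split => [/U0 ->|/U0/G0' ->].
      by rewrite /= (lin0 (mulL_linear bg)) (lin0 (compL_linear pt)).
    by rewrite (lin0 (compL_linear pt)).
  + by move=> x _; rewrite !hnormE nsq_compL.
- split; first exact: SE.
  have kK s : K s -> `|s| <= C.
    move=> /(spectrum_mulL_bounds bg gcC)/andP[cs sC].
    by rewrite ger0_norm// (le_trans (ltW c0)).
  apply/(spectral_integralP mE exE _ _ kK); first exact: measurable_id.
  by rewrite fcalc_id_spectrum.
- split; first by apply: (bounded_op_comp bU); exact: bounded_op_mulL.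
  exists dO, Om, sigma, alpha, beta, a, b,
    (fun w => fcalc g (fun s => \1_K s * alpha w s)),
    (fun w => fcalc g (fun s => \1_K s * beta w s)).
  split; [by split|exact: ab|exact: iab| |].
    by move=> s s' Ks Ks'; rewrite -psif// psiE.
  split => [w|x y]; last by rewrite /= -(double_integral_dot ma mb ab iab).
  have ma' : measurable_fun setT (alpha w).
    exact: (measurableT_comp ma (pair1_measurable w)).
  have mb' : measurable_fun setT (beta w).
    exact: (measurableT_comp mb (pair1_measurable w)).
  have ka s : K s -> `|alpha w s| <= a w by move=> /ab-/(_ w)[].
  have kb s : K s -> `|beta w s| <= b w by move=> /ab-/(_ w)[].
  split; [exact: (spectral_integralP mE exE _ ma' ka).2|].
  exact: (spectral_integralP mE exE _ mb' kb).2.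
Qed.

End Aluthge.

(** * Factorization of the power mean symbol *)

Lemma powR_itv_bounds (R : realType) (q m M : R) : 0 < m ->
  exists lo hi, 0 < lo /\ forall z, m <= z <= M -> lo <= z `^ q <= hi.
Proof.
move=> m0.
have pos (e m' M' : R) : 0 <= e -> 0 < m' -> forall z, m' <= z <= M' ->
    m' `^ e <= z `^ e <= M' `^ e.
  move=> e0 m'0 z /andP[mz zM]; have z0 := lt_le_trans m'0 mz.
  have M0 := lt_le_trans z0 zM.
  by rewrite !ge0_ler_powR// nnegrE ltW.
have [q0|q0] := leP 0 q.
  exists (m `^ q), (M `^ q); split; first exact: powR_gt0.
  exact: pos.
have [mM|Mm] := leP m M; last first.
  (* The interval is empty here, so any positive constants serve. *)
  exists 1, 1; split => // z /andP[mz zM].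
  by have := lt_le_trans Mm (le_trans mz zM); rewrite ltxx.
have M0 := lt_le_trans m0 mM.
have q0' : 0 <= - q by rewrite oppr_ge0 ltW.
exists ((M `^ (- q))^-1), ((m `^ (- q))^-1); split.
  by rewrite invr_gt0 powR_gt0.
move=> z hz; have /andP[h1 h2] := pos _ _ _ q0' m0 _ hz.
have z0 : 0 < z by case/andP: hz => /(lt_le_trans m0).
rewrite -[in X in _ <= X <= _](opprK q) (powRN z (- q)).
by rewrite !lef_pV2 ?posrE ?powR_gt0// h1 h2.
Qed.

Section ShiftedPowerIntegral.
Context (R : realType) (x : R).
Hypothesis x0 : 0 < x.

Lemma is_derive_shift_powR (p w : R) : 0 <= w ->
  is_derive w 1 (fun v => (x + v) `^ p) (p * (x + w) `^ (p - 1)).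
Proof.
move=> w0; rewrite -[X in is_derive _ _ _ X]mulr1.
apply: (@is_derive1_comp _ (fun z => z `^ p) (fun v => x + v)).
  by apply: is_derive1_powR; rewrite ltr_pwDl.
rewrite -[1 in X in is_derive _ _ _ X]add0r.
exact: is_deriveD.
Qed.

Lemma is_derive_mul_shift_powR (p w : R) : 0 <= w ->
  is_derive w 1 (fun v => v * (x + v) `^ p)
    ((x + w) `^ p + w * (p * (x + w) `^ (p - 1))).
Proof.
move=> w0; have d1 := is_derive_shift_powR p w0.
have := @is_deriveM _ _ id (fun v => (x + v) `^ p) w 1 _ _ (is_derive_id w 1) d1.
by rewrite addrC /= scaler1.
Qed.

Lemma shift_powR_continuous (q w : R) : 0 <= w ->
  {for w, continuous (fun v : R => (x + v) `^ q)}.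
Proof.
move=> w0; apply: differentiable_continuous; apply/derivable1_diffP.
by have [] := is_derive_shift_powR q w0.
Qed.

Lemma shift_powR_integrand_continuous (p y : R) : {within `[0, y], continuous
  (fun w : R => (x + w) `^ p + w * (p * (x + w) `^ (p - 1)))}.
Proof.
apply: continuous_in_subspaceT => w; rewrite inE /= in_itv /= => /andP[w0 _].
apply: cvgD; first exact: shift_powR_continuous.
apply: cvgM; first exact: cvg_id.
apply: cvgM; first exact: cvg_cst.
exact: shift_powR_continuous.
Qed.

Lemma integrable_shift_powR (p y : R) :
  lebesgue_measure.-integrable `[0, y]
    (EFin \o (fun w => (x + w) `^ p + w * (p * (x + w) `^ (p - 1)))).
Proof.
apply: continuous_compact_integrable; first exact: segment_compact.
exact: shift_powR_integrand_continuous.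
Qed.

Lemma integral_shift_powR (p y : R) : 0 < y ->
  \int[lebesgue_measure]_(w in `[0, y])
    ((x + w) `^ p + w * (p * (x + w) `^ (p - 1))) = y * (x + y) `^ p.
Proof.
move=> y0.
have dF (w : R) : 0 <= w -> {for w, continuous (fun v : R => v * (x + v) `^ p)}.
  move=> w0; apply: differentiable_continuous; apply/derivable1_diffP.
  by have [] := is_derive_mul_shift_powR p w0.
rewrite /Rintegral (@continuous_FTC2 _ _ (fun v : R => v * (x + v) `^ p))//.
- by rewrite mul0r sube0 /=.
- exact: shift_powR_integrand_continuous.
- split.
  + move=> w; rewrite in_itv /= => /andP[w0 _].
    by have [] := is_derive_mul_shift_powR p (ltW w0).
  + by apply: cvg_at_right_filter; exact: dF.
  + by apply: cvg_at_left_filter; apply: dF; exact: ltW.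
- move=> w; rewrite in_itv /= => /andP[w0 _].
  by rewrite derive1E; have [_ ->] := is_derive_mul_shift_powR p (ltW w0).
Qed.

End ShiftedPowerIntegral.

Lemma factorizable_sub (R : realType) (K K' : set (measurableTypeR R))
    (psi : R -> R -> R) :
  K `<=` K' -> factorizable K' psi -> factorizable K psi.
Proof.
move=> KK' [d [Om [sigma [alpha [beta [a [b [m ab iab e]]]]]]]].
exists d, Om, sigma, alpha, beta, a, b; split => //.
  by move=> w s /KK'; exact: ab.
by move=> s t /KK' Ks /KK' Kt; exact: e.
Qed.

(** With [x = (1 - l) s^r], [y = l t^r] and [p = 1 / r], differentiating
    [w (x + w)^p] gives
    [(x + y)^p = 1/y \int_0^y ((x + w)^p + w p (x + w)^(p - 1)) dw],
    whose integrand depends on [t] only through the bound [w <= y]. *)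
Lemma power_symbol_factorizable (R : realType) (c C r l : R) :
  0 < c -> 0 < l < 1 -> factorizable `[c, C]%classic
    (fun s t => ((1 - l) * s `^ r + l * t `^ r) `^ r^-1).
Proof.
move=> c0 /andP[l0 l1]; set p := r^-1.
have l1' : 0 < 1 - l by rewrite subr_gt0.
have [lo [hi [lo0 lohi]]] := powR_itv_bounds r C c0.
pose X (s : R) := (1 - l) * s `^ r; pose Yt (t : R) := l * t `^ r.
pose y0 := l * lo; pose y1 := l * hi.
have y0_gt0 : 0 < y0 by rewrite mulr_gt0.
have Xb s : c <= s <= C -> (1 - l) * lo <= X s <= (1 - l) * hi.
  by move=> /lohi/andP[h1 h2]; rewrite !ler_pM2l// h1 h2.
have Yb t : c <= t <= C -> y0 <= Yt t <= y1.
  by move=> /lohi/andP[h1 h2]; rewrite !ler_pM2l// h1 h2.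
have x0_gt0 : 0 < (1 - l) * lo by rewrite mulr_gt0.
have [lo1 [h1 [lo1_gt0 hp]]] := powR_itv_bounds p ((1 - l) * hi + y1) x0_gt0.
have [lo2 [h2 [lo2_gt0 hp1]]] := powR_itv_bounds (p - 1) ((1 - l) * hi + y1) x0_gt0.
pose I : set (measurableTypeR R) := `[0, y1]%classic.
have mI : measurable I by exact: measurable_itv.
(* The upper limit of integration l t^r becomes the condition [w <= Yt t] in [beta], which also
   carries the factor 1/y. [alpha] is cut off at [y1], an upper bound of [Yt] on the interval, so
   that the product of the bounds is integrable over the line. *)
pose alpha (w s : measurableTypeR R) : R :=
  \1_I w * ((X s + w) `^ p + w * (p * (X s + w) `^ (p - 1))).
pose beta (w t : measurableTypeR R) : R := if w <= Yt t then Yt t `^ (-1) else 0.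
exists _, (measurableTypeR R), lebesgue_measure, alpha, beta,
  (fun w => \1_I w * (h1 + y1 * (`|p| * h2))), (fun=> y0^-1).
have m1 : measurable_fun [set: measurableTypeR R * measurableTypeR R]
    (fun q => q.1 : R) by exact: measurable_fst.
have m2 : measurable_fun [set: measurableTypeR R * measurableTypeR R]
    (fun q => q.2 : R) by exact: measurable_snd.
have mX : measurable_fun [set: measurableTypeR R * measurableTypeR R]
    (fun q => X q.2).
  by apply: measurable_funM => //; exact: measurable_funpowR.
have mY : measurable_fun [set: measurableTypeR R * measurableTypeR R]
    (fun q => Yt q.2).
  by apply: measurable_funM => //; exact: measurable_funpowR.
split.
- split.
    apply: measurable_funM; first exact: (measurableT_comp (measurable_indic mI) m1).
    apply: measurable_funD; first by apply: measurable_funpowR; exact: measurable_funD.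
    apply: measurable_funM => //; apply: measurable_funM => //.
    by apply: measurable_funpowR; exact: measurable_funD.
  apply: measurable_fun_ifT => //; last exact: measurable_funpowR.
  exact: measurable_fun_ler.
- move=> w s; rewrite /= in_itv /= => sK; split; last first.
    have /andP[y0s _] := Yb _ sK; rewrite /beta; case: ifP => _; last first.
      by rewrite normr0 invr_ge0 ltW.
    have Ys0 := lt_le_trans y0_gt0 y0s.
    rewrite powR_inv1 ?(ltW Ys0)// ger0_norm ?invr_ge0 ?(ltW Ys0)//.
    by rewrite lef_pV2 ?posrE.
  have /andP[x0s sx1] := Xb _ sK; rewrite /alpha indicE.
  have [/set_mem|_] := boolP (w \in I); last by rewrite !mul0r normr0.
  rewrite /I /= in_itv /= !mul1r => /andP[w0 wy].
  have zb : (1 - l) * lo <= X s + w <= (1 - l) * hi + y1.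
    by rewrite (le_trans x0s) ?lerDl//= lerD.
  have /andP[z1 z2] := hp _ zb; have /andP[z3 z4] := hp1 _ zb.
  rewrite (le_trans (ler_normD _ _))//; apply: lerD.
    by rewrite ger0_norm// powR_ge0.
  rewrite !normrM (ger0_norm w0) (ger0_norm (powR_ge0 _ _)).
  apply: ler_pM => //; first by rewrite mulr_ge0// powR_ge0.
  by rewrite ler_wpM2l.
- rewrite [X in integrable _ _ X](_ : _ = (fun w =>
      ((h1 + y1 * (`|p| * h2)) * y0^-1)%:E * (\1_I w)%:E)%E); last first.
    by apply/funext => w /=; rewrite -EFinM; congr EFin; ring.
  apply: integrableZl => //.
  exact: integrable_indic_itv.
- move=> s t; rewrite /= !in_itv /= => sK tK.
  have /andP[x0s _] := Xb _ sK; have X0 := lt_le_trans x0_gt0 x0s.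
  have /andP[y0t ty1] := Yb _ tK; have Y0 := lt_le_trans y0_gt0 y0t.
  have := integral_shift_powR X0 p Y0.
  (* As [Yt t <= y1], the two cut-offs together leave exactly the interval from 0 to [Yt t]. *)
  rewrite (_ : (fun w => alpha w s * beta w t) = (fun w => (Yt t)^-1 *
     ((X s + w) `^ p + w * (p * (X s + w) `^ (p - 1)))) \_ `[0, Yt t]%classic).
    rewrite -Rintegral_mkcond RintegralZl//; last exact: integrable_shift_powR.
    by move=> ->; rewrite mulrA mulVf ?mul1r// gt_eqF.
  apply/funext => w; rewrite patchE /alpha /beta indicE.
  have [/set_mem|] := boolP (w \in `[0, Yt t]%classic).
    rewrite /= in_itv /= => /andP[w0 wY]; rewrite wY powR_inv1 ?(ltW Y0)//.
    rewrite mem_set ?mul1r; first by rewrite mulrC.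
    by rewrite /I /= in_itv /= w0 (le_trans wY).
  rewrite notin_setE /= in_itv /= => /negP; rewrite negb_and.
  case: (leP w (Yt t)) => wY; last by rewrite mulr0.
  rewrite orbF -ltNge => w0; rewrite memNset ?mul0r//.
  by rewrite /I /= in_itv /= leNgt w0.
Qed.

Lemma mul_power_mean (R : realType) (r l s t : R) : r != 0 -> 0 < l < 1 ->
  0 < s -> 0 < t ->
  s * power_mean r l (t / s) = ((1 - l) * s `^ r + l * t `^ r) `^ r^-1.
Proof.
move=> r0 /andP[l0 l1] s0 t0; have l1' : 0 < 1 - l by rewrite subr_gt0.
have sE : s = (s `^ r) `^ r^-1 by rewrite -powRrM divff// powRr1// ltW.
rewrite /power_mean [X in X * _]sE -powRM ?powR_ge0//; last first.
  by rewrite addr_ge0// ?mulr_ge0 ?powR_ge0// ltW.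
congr (_ `^ _); rewrite mulrDr mulrC; congr (_ + _).
have st : s * (t / s) = t by rewrite mulrCA divff ?mulr1 ?gt_eqF.
have ts : 0 <= t / s by rewrite divr_ge0// ltW.
by rewrite mulrCA -(powRM r (ltW s0) ts) st.
Qed.

Section SigmaFiniteXZ.
Context (R : realType) (d : measure_display) (X : measurableType d).
Variable mu : probability X R.

(** [XZmeasure] is typed as a mere measure; this copy of it also carries
    sigma-finiteness. *)
Definition XZsigma : set (X * int)%type -> \bar R := (mu \x @zcounting R)%E.
HB.instance Definition _ := Measure.copy XZsigma (mu \x @zcounting R)%E.

Let XZsigma_sigma_finite : sigma_finite setT XZsigma.
Proof.
have [F FT Foo] := @sigma_finite_zcounting R.
exists (fun n => setT `*` F n).
  by rewrite -setXTT FT predeqE => -[x y]; split => [[_ [n _ Fy]]|[n _ [_ Fy]]];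
    [exists n|split => //; exists n].
move=> n; have [mF Fn] := Foo n; split; first exact: measurableX.
rewrite /XZsigma product_measure1E//.
have -> : (mu setT * zcounting R (F n) = zcounting R (F n))%E.
  by rewrite probability_setT mul1e.
exact: Fn.
Qed.

HB.instance Definition _ :=
  @Measure_isSigmaFinite.Build _ _ _ XZsigma XZsigma_sigma_finite.

End SigmaFiniteXZ.

(** * One step of the transform in the crossed product *)

Section AluthgeStep.
Context (R : realType) (d : measure_display) (X : measurableType d).
Variables (mu : probability X R) (phi psi : X -> X).
Hypothesis Hphi : invertible_mpt mu phi psi.
Local Notation nu := (XZmeasure mu).
Let sig : {sigma_finite_measure set (X * int)%type -> \bar R} := XZsigma mu.

Lemma cp_shiftE : cp_shift mu = compL (nu := nu) (zshift 1).
Proof. by []. Qed.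

(** For nonnegative [j] this cancels [psi] against [phi], which is possible only almost everywhere;
    for negative [j] it is one more iterate of [psi], by computation. *)
Lemma psi_zpow (j : int) :
  {ae mu, forall x, psi (zpow phi psi (j + 1) x) = zpow phi psi j x}.
Proof.
case: j => n.
  have [_ _ _ _ pp] := Hphi.
  have -> : Posz n + 1 = Posz n.+1 by rewrite -addn1 PoszD.
  exact: (mpreserving_ae (mpreserving_iter n (mpreserving_phi Hphi)) pp).
apply: aeW => x; case: n => [//|n].
have -> : Negz n.+1 + 1 = Negz n by rewrite !NegzE -[n.+2]addn1 PoszD opprD subrK.
by [].
Qed.

(** At height n the shift reads the value at height n - 1, where the multiplier is [g] at phi^(1-n),
    while the outer factor sees [g] at phi^(-n) = psi phi^(1-n). This is the origin of [g o psi] in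
    the average. *)
Lemma induced_aluthge_step (g : X -> R) (c C r l : R) : bfun g -> 0 < c ->
  (forall x, c <= g x <= C) -> r != 0 -> 0 < l < 1 ->
  bfun (fun x => ((1 - l) * g (psi x) `^ r + l * g x `^ r) `^ r^-1) ->
  induced_aluthge (XZdot mu) (power_mean r l)
    (cp_shift mu \o mulL (nu := nu) (zlift phi psi g)) =
  cp_shift mu \o mulL (nu := nu) (zlift phi psi
    (fun x => ((1 - l) * g (psi x) `^ r + l * g x `^ r) `^ r^-1)).
Proof.
move=> bg c0 gcC r0 l01; set g' := fun x => _ => bg'.
pose ps s t : R := ((1 - l) * s `^ r + l * t `^ r) `^ r^-1.
have blg : bfun (zlift phi psi g) by exact: (bfun_zlift Hphi).
have blg' : bfun (zlift phi psi g') by exact: (bfun_zlift Hphi).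
have hk : {ae nu, forall p, zlift phi psi g' (zshift 1 p) =
    ps (zlift phi psi g p) (zlift phi psi g (zshift 1 p))}.
  apply: ae_slices => k; apply: filterS (psi_zpow (- k)) => x e.
  rewrite /zlift /zshift /= /g' /ps opprB (addrC 1 (- k)) e.
  by [].
have lcC p : c <= zlift phi psi g p <= C by exact: gcC.
have pU : mpreserving sig (zshift 1) by exact: (mpreserving_zshift mu 1).
have psE s s' : real_spectrum (@L2dot _ _ R sig) (mulL (nu := sig) (zlift phi psi g)) s ->
    real_spectrum (@L2dot _ _ R sig) (mulL (nu := sig) (zlift phi psi g)) s' ->
    ps s s' = s * power_mean r l (s' / s).
  move=> /(spectrum_mulL_bounds blg lcC)/andP[cs _].
  move=> /(spectrum_mulL_bounds blg lcC)/andP[cs' _].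
  by rewrite mul_power_mean// ?(lt_le_trans c0).
have fac : factorizable (real_spectrum (@L2dot _ _ R sig)
    (mulL (nu := sig) (zlift phi psi g)) : set (measurableTypeR R)) ps.
  apply: (factorizable_sub _ (power_symbol_factorizable C r c0 l01)).
  by move=> s /(spectrum_mulL_bounds blg lcC); rewrite /= in_itv.
have ex := Aluthge_exists blg c0 lcC pU blg' hk psE fac.
rewrite /induced_aluthge; apply: xget_subset1.
  exact: ex.
move=> D D' hD hD'.
rewrite (Aluthge_unique blg c0 lcC pU blg' hk psE hD).
by rewrite (Aluthge_unique blg c0 lcC pU blg' hk psE hD').
Qed.

End AluthgeStep.

(** * The mean ergodic theorem for weighted averages *)

Section BoundedFunctions.
Context d (X : measurableType d) (R : realType) (mu : probability X R).
Implicit Types (u v w h : X -> R).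
Local Notation I u := (Rintegral mu setT u).

Lemma bint u : bfun u -> mu.-integrable setT (EFin \o u).
Proof. by move=> bu; exact: bfun_integrable. Qed.

Lemma bintD u v : bfun u -> bfun v -> I (fun x => u x + v x) = I u + I v.
Proof. by move=> bu bv; rewrite RintegralD//; exact: bint. Qed.

Lemma bintZ (a : R) u : bfun u -> I (fun x => a * u x) = a * I u.
Proof. by move=> bu; rewrite RintegralZl//; exact: bint. Qed.

Definition sqint u : R := I (fun x => u x ^+ 2).

Lemma bfun_sq u : bfun u -> bfun (fun x => u x ^+ 2).
Proof. by move=> bu; exact: (bfunM bu bu). Qed.

Lemma bfunZ (a : R) u : bfun u -> bfun (fun x => a * u x).
Proof. by move=> bu; apply: bfunM => //; exact: bfun_cst. Qed.

Lemma sqint_ge0 u : 0 <= sqint u.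
Proof. by apply: Rintegral_ge0 => x _; exact: sqr_ge0. Qed.

Lemma le_bint u v : bfun u -> bfun v -> (forall x, u x <= v x) -> I u <= I v.
Proof. by move=> bu bv uv; apply: le_Rintegral => //; exact: bint. Qed.

Lemma sqintZ (a : R) u : bfun u -> sqint (fun x => a * u x) = a ^+ 2 * sqint u.
Proof.
move=> bu; rewrite /sqint -bintZ; last exact: bfun_sq.
by congr Rintegral; apply/funext => x; rewrite exprMn.
Qed.

Lemma sqintD_le u v : bfun u -> bfun v ->
  sqint (fun x => u x + v x) <= 2 * sqint u + 2 * sqint v.
Proof.
move=> bu bv; have [bu2 bv2] := (bfun_sq bu, bfun_sq bv).
rewrite /sqint -!bintZ// -bintD; [|exact: bfunZ|exact: bfunZ].
apply: le_bint => [||x].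
- exact/bfun_sq/bfunD.
- by apply: bfunD; exact: bfunZ.
- have := sqr_ge0 (u x - v x); nra.
Qed.

Lemma sqint_parallelogram u v : bfun u -> bfun v ->
  sqint (fun x => u x - v x) =
  2 * sqint u + 2 * sqint v - 4 * sqint (fun x => 2^-1 * (u x + v x)).
Proof.
move=> bu bv; have [bu2 bv2] := (bfun_sq bu, bfun_sq bv).
have buv := bfunD bu bv; rewrite sqintZ//.
have bm := bfun_sq (bfunB bu bv); have bp := bfun_sq buv.
suff : sqint (fun x => u x - v x) + sqint (fun x => u x + v x) =
    2 * sqint u + 2 * sqint v by lra.
rewrite /sqint -bintD// -!bintZ// -bintD; [|exact: bfunZ|exact: bfunZ].
by congr Rintegral; apply/funext => x; ring.
Qed.

Lemma bint_CS u v : bfun u -> bfun v ->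
  I (fun x => u x * v x) ^+ 2 <= sqint u * sqint v.
Proof.
move=> bu bv; have [bu2 bv2] := (bfun_sq bu, bfun_sq bv).
have buv := bfunM bu bv; set c := I _.
have key (a b : R) : 0 <= a ^+ 2 * sqint u + 2 * a * b * c + b ^+ 2 * sqint v.
  have <- : sqint (fun x => a * u x + b * v x) =
      a ^+ 2 * sqint u + 2 * a * b * c + b ^+ 2 * sqint v; last exact: sqint_ge0.
  rewrite /sqint /c -!bintZ// -!bintD; try by do ?apply: bfunD; exact: bfunZ.
  by congr Rintegral; apply/funext => x; ring.
have [v0|v0] := eqVneq (sqint v) 0.
  have [->|cn0] := eqVneq c 0; first by rewrite v0 mulr0 expr0n.
  (* With [sqint v] zero the quadratic form is affine in its second coefficient; this choice gives
     it the value - sqint u - 2, which is negative. *)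
  have := key 1 (- (sqint u + 1) / c); rewrite v0 !mulr0 !addr0.
  rewrite mulr1 -mulrA divfK// expr1n mul1r; have := sqint_ge0 u.
  by move=> ? ?; exfalso; lra.
have vp : 0 < sqint v by rewrite lt_neqAle eq_sym v0 sqint_ge0.
have := key (sqint v) (- c).
rewrite (_ : _ + _ = sqint v * (sqint u * sqint v - c ^+ 2)); last by ring.
by rewrite pmulr_rge0// subr_ge0.
Qed.

Lemma bint_ae u v : measurable_fun setT u -> measurable_fun setT v ->
  {ae mu, forall x, u x = v x} -> I u = I v.
Proof.
move=> mu' mv uv; rewrite /Rintegral; congr fine; apply: ae_eq_integral => //.
- exact/measurable_EFinP.
- exact/measurable_EFinP.
- by apply: filterS uv => x /= ->.
Qed.

Lemma sqint_eq0 u : bfun u -> sqint u = 0 -> {ae mu, forall x, u x = 0}.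
Proof.
move=> bu; have bu2 := bfun_sq bu; have iu := bint bu2.
move/eqP; rewrite /sqint /Rintegral fine_eq0; last exact: integral_fune_fin_num.
under eq_integral do rewrite -[((_ ^+ 2)%:E)]gee0_abs ?lee_fin ?sqr_ge0//.
move/eqP/(ae_eq_integral_abs _ measurableT (measurable_int _ iu)) => iu0.
by apply: filterS iu0 => x /= /(_ Logic.I) [] /eqP; rewrite sqrf_eq0 => /eqP.
Qed.

(** Young's inequality |u| <= (u^2 / e + e) / 2, integrated against a probability measure; with [e]
    the size of the L^2 norm it bounds the L^1 norm without square roots. *)
Lemma bint_abs_le u (e : R) : bfun u -> 0 < e ->
  I (fun x => `|u x|) <= 2^-1 * (e^-1 * sqint u + e).
Proof.
move=> bu e0; have bu2 := bfun_sq bu.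
have bau : bfun (fun x => `|u x|).
  case: bu => mu' [b hb]; split; first exact: (measurableT_comp (@normr_measurable R setT)).
  by exists b => x; rewrite normr_id.
have bc : bfun (fun _ : X => e) by exact: bfun_cst.
have eI : e = I (fun=> e).
  by rewrite Rintegral_cst//= probability_setT mulr1.
rewrite [X in _ + X]eI -bintZ// -bintD//; last exact: bfunZ.
rewrite -bintZ; last by apply: bfunD => //; exact: bfunZ.
apply: le_bint => //; first by apply: bfunZ; apply: bfunD => //; exact: bfunZ.
move=> x; have h := sqr_ge0 (`|u x| - e).
rewrite -(ler_pM2l e0) mulrCA mulrDr mulrA divff ?gt_eqF// mul1r.
rewrite -[u x ^+ 2]real_normK ?num_real//; nra.
Qed.

End BoundedFunctions.

Lemma bfun_itv d (X : measurableType d) (R : realType) (h : X -> R) (lo hi : R) :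
  measurable_fun setT h -> (forall x, lo <= h x <= hi) -> bfun h.
Proof.
move=> mh hb; split=> //; exists (`|lo| + `|hi|) => x.
case/andP: (hb x) => h1 h2; rewrite ler_norml; apply/andP; split.
  rewrite lerNl; have := ler_norm (- lo); rewrite normrN; have := normr_ge0 hi; lra.
by have := ler_norm hi; have := normr_ge0 lo; lra.
Qed.

(** * L^2 completeness for uniformly bounded sequences *)

Section BoundedComplete.
Context d (X : measurableType d) (R : realType) (mu : probability X R).
Variables (v : nat -> X -> R) (lo hi : R).
Hypothesis mv : forall n, measurable_fun setT (v n).
Hypothesis vb : forall n x, lo <= v n x <= hi.

Let bv n : bfun (v n).
Proof. exact: bfun_itv (mv n) (vb n). Qed.

(** The L^1 norms of the increments are at most 2^-(k+1), so the sum of their absolute values has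
    finite integral. It is finite almost everywhere, and there the telescoping series converges
    absolutely. *)
Lemma geometric_sqint_ae_cvg :
  (forall k, sqint mu (fun x => v k.+1 x - v k x) <= (1 / (2 ^ k.+1)%:R) ^+ 2) ->
  {ae mu, forall x, cvgn (v ^~ x)}.
Proof.
move=> small; pose D k x : R := `|v k.+1 x - v k x|.
have bD k : bfun (fun x => v k.+1 x - v k x) by exact: bfunB.
have bD' k : bfun (D k).
  have [m [b hb]] := bD k.
  split; first exact: (measurableT_comp (@normr_measurable R setT) m).
  by exists b => x; rewrite normr_id.
have mD k : measurable_fun setT (fun x => (D k x)%:E).
  by apply/measurable_EFinP; case: (bD' k).
have D0 k x : (0 <= (D k x)%:E)%E by rewrite lee_fin normr_ge0.
have ID k : (\int[mu]_x (D k x)%:E <= (1 / (2 ^ k.+1)%:R)%:E)%E.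
  have : 0 < 1 / (2 ^ k.+1)%:R :> R by rewrite divr_gt0// ltr0n expn_gt0.
  move: (small k); set e : R := 1 / _ => smallk k0.
  have := bint_abs_le mu (bD k) k0.
  have -> : (\int[mu]_x (D k x)%:E)%E = (Rintegral mu setT (D k))%:E.
    by rewrite /Rintegral fineK//; apply: integrable_fin_num => //; exact: bint.
  rewrite lee_fin => /le_trans; apply.
  have ik0 : 0 <= e^-1 by rewrite invr_ge0 ltW.
  have := ler_wpM2l ik0 smallk.
  rewrite [X in _ <= X -> _](_ : _ = e); last first.
    by rewrite expr2 mulrA mulVf ?mul1r// gt_eqF.
  set a := _ * sqint _ _; lra.
have fin : (\int[mu]_x (\sum_(k <oo) (D k x)%:E) < +oo)%E.
  rewrite integral_nneseries//.
  apply: (@le_lt_trans _ _ (\sum_(k <oo) (1 / (2 ^ k.+1)%:R : R)%:E)%E).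
    by apply: lee_nneseries => [k _ _|k _]; [exact: integral_ge0|exact: ID].
  by apply: le_lt_trans (epsilon_trick0 xpredT ler01) _; rewrite ltry.
have ms : measurable_fun setT (fun x => \sum_(k <oo) (D k x)%:E)%E.
  by apply: ge0_emeasurable_sum => //.
have s0 x : (0 <= \sum_(k <oo) (D k x)%:E)%E by apply: nneseries_ge0.
have ifin : mu.-integrable setT (fun x => \sum_(k <oo) (D k x)%:E)%E.
  apply/integrableP; split => //.
  by under eq_integral do rewrite gee0_abs//.
apply: filterS (integrable_ae measurableT ifin) => x /(_ Logic.I) xfin.
have cD : cvgn (series (telescope (v ^~ x))).
  apply: normed_cvg; apply: nondecreasing_is_cvgn.
    by apply: nondecreasing_series => i _ _; exact: normr_ge0.
  exists (fine (\sum_(k <oo) (D k x)%:E)%E) => _ [n _ <-].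
  rewrite -lee_fin fineK//.
  have := @nneseries_lim_ge R (fun k => (D k x)%:E) xpredT 0%N n (fun k _ _ => D0 k x).
  by rewrite sumEFin.
have -> : v ^~ x = (fun n => v 0%N x + series (telescope (v ^~ x)) n).
  by apply/funext => n; exact: eq_sum_telescope.
by apply: is_cvgD => //; exact: is_cvg_cst.
Qed.

Lemma sqint_cvg_of_ae (h : X -> R) : measurable_fun setT h ->
  (forall x, lo <= h x <= hi) -> {ae mu, forall x, v ^~ x @ \oo --> h x} ->
  sqint mu (fun x => v n x - h x) @[n --> \oo] --> 0.
Proof.
move=> mh hb cv.
have bh := bfun_itv mh hb.
have bvh n : bfun (fun x => (v n x - h x) ^+ 2) by apply: bfun_sq; exact: bfunB.
have h1 n : measurable_fun setT (fun x => ((v n x - h x) ^+ 2)%:E).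
  by apply/measurable_EFinP; case: (bvh n).
have h2 : measurable_fun setT (fun _ : X => 0%E : \bar R) by exact: measurable_cst.
have h3 : {ae mu, forall x, setT x -> ((v n x - h x) ^+ 2)%:E @[n --> \oo] --> 0%E}.
  apply: filterS cv => x vx _; apply: cvg_EFin; first by exact: nearW.
  have c1 : (v n x - h x) @[n --> \oo] --> (0 : R).
    by rewrite -(subrr (h x)); apply: cvgB => //; exact: cvg_cst.
  by have := cvgM c1 c1; rewrite mulr0; exact.
have h4 : mu.-integrable setT (fun=> ((hi - lo) ^+ 2)%:E).
  exact: (finite_measure_integrable_cst mu _ measurableT).
have h5 : {ae mu, forall x n, setT x ->
    (`|((v n x - h x) ^+ 2)%:E| <= ((hi - lo) ^+ 2)%:E)%E}.
  apply: aeW => x n _; rewrite gee0_abs ?lee_fin ?sqr_ge0//.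
  case/andP: (vb n x) => a1 a2; case/andP: (hb x) => b1 b2; nra.
have [_ _] := dominated_convergence measurableT h1 h2 h3 h4 h5.
rewrite integral0 => c; exact: (fine_cvg c).
Qed.

End BoundedComplete.

Section Complete.
Context d (X : measurableType d) (R : realType) (mu : probability X R).

Lemma sqint_complete (v : nat -> X -> R) (lo hi : R) :
  (forall n, measurable_fun setT (v n)) -> (forall n x, lo <= v n x <= hi) ->
  (forall e, 0 < e -> exists N, forall n m, (N <= n)%N -> (N <= m)%N ->
     sqint mu (fun x => v n x - v m x) <= e) ->
  exists h, [/\ measurable_fun setT h, forall x, lo <= h x <= hi &
    sqint mu (fun x => v n x - h x) @[n --> \oo] --> 0].
Proof.
move=> mv vb cau.
have bv n : bfun (v n) := bfun_itv (mv n) (vb n).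
have loh : lo <= hi by case/andP: (vb 0%N point) => /le_trans /[apply].
have /choice[f fP] : forall k : nat, exists N, forall n m, (N <= n)%N -> (N <= m)%N ->
    sqint mu (fun x => v n x - v m x) <= (1 / (2 ^ k.+1)%:R) ^+ 2.
  move=> k; apply: cau.
  by rewrite exprn_gt0// divr_gt0// ltr0n expn_gt0.
(* Summing the successors makes the index increasing and at least [f k] and [k], whatever the order
   of the values of [f]. *)
pose idx k := (\sum_(i < k.+1) (f i).+1)%N.
have idxS k : (f k <= idx k)%N by rewrite /idx big_ord_recr /= addnS leqW// leq_addl.
have idxS' k : (idx k <= idx k.+1)%N by rewrite /idx [leqRHS]big_ord_recr leq_addr.
have idxk k : (k <= idx k)%N.
  elim: k => // k; rewrite /idx [in X in _ -> X]big_ord_recr /= addnS ltnS => h.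
  exact: leq_trans h (leq_addr _ _).
pose w k := v (idx k).
have cw := @geometric_sqint_ae_cvg _ X R mu w lo hi (fun k => mv _) (fun k => vb _).
have {}cw : {ae mu, forall x, cvgn (w ^~ x)}.
  by apply: cw => k; apply: fP; [exact: leq_trans (idxS k) (idxS' k)|exact: idxS].
(* The upper limit is measurable irrespective of convergence, and clamping yields the bounds at
   every point; where [w] converges, [h] is its limit. *)
pose h x := Num.max lo (Num.min hi (limn_sup (w ^~ x))).
have mh : measurable_fun setT h.
  apply: measurable_maxr => //; apply: measurable_minr => //.
  apply: measurable_fun_limn_sup => [x _|x _|n].
  - by exists hi => _ [n _ <-]; case/andP: (vb (idx n) x).
  - by exists lo => _ [n _ <-]; case/andP: (vb (idx n) x).
  - exact: mv.
have hb x : lo <= h x <= hi.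
  by rewrite le_max lexx /= ge_max loh ge_min lexx.
have wh : {ae mu, forall x, w ^~ x @ \oo --> h x}.
  apply: filterS cw => x cx; rewrite /h cvg_limn_supE// min_r; last first.
    by apply: limr_le => //; apply: nearW => n; case/andP: (vb (idx n) x).
  rewrite max_r//.
  by apply: limr_ge => //; apply: nearW => n; case/andP: (vb (idx n) x).
exists h; split => //.
have cwh := sqint_cvg_of_ae (fun k => mv _) (fun k => vb _) mh hb wh.
have bh := bfun_itv mh hb.
apply/cvgrPdist_le => e e0; have e4 : 0 < e / 4 by rewrite divr_gt0.
have [N hN] := cau _ e4.
have /cvgrPdist_le/(_ _ e4)[M _ hM] := cwh.
exists N => // n /= Nn; rewrite sub0r normrN ger0_norm ?sqint_ge0//.
pose k := maxn N M.
have kM := hM k (leq_maxr _ _); rewrite /= sub0r normrN ger0_norm ?sqint_ge0// in kM.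
have kN := hN n (idx k) Nn (leq_trans (leq_maxl _ _) (idxk k)).
have := sqintD_le mu (bfunB (bv n) (bv (idx k))) (bfunB (bv (idx k)) bh).
rewrite [X in sqint mu X <= _](_ : _ = (fun x => v n x - h x)); last first.
  by apply/funext => x; rewrite addrA subrK.
move: kM kN; rewrite /w; set a := sqint _ _; set b := sqint _ _; set c := sqint _ _.
lra.
Qed.

End Complete.

(** * The averaging operator and the hull of an orbit *)

Section MeanErgodic.
Context d (X : measurableType d) (R : realType) (mu : probability X R).
Variables (psi : X -> X) (l : R).
Hypothesis ppsi : mpreserving mu psi.
Hypothesis l01 : 0 < l < 1.
Implicit Types (u v w h k : X -> R).
Local Notation I u := (Rintegral mu setT u).

Definition average u : X -> R := fun x => (1 - l) * u (psi x) + l * u x.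

Let l0 : 0 < l. Proof. by case/andP: l01. Qed.
Let l1 : 0 < 1 - l. Proof. by case/andP: l01 => _; rewrite subr_gt0. Qed.

Lemma bfun_psi u : bfun u -> bfun (fun x => u (psi x)).
Proof.
move=> [mu' [b hb]]; split; last by exists b.
by apply: measurableT_comp mu' _; case: ppsi.
Qed.

Lemma bfun_average u : bfun u -> bfun (average u).
Proof. by move=> bu; apply: bfunD; apply: bfunZ => //; exact: bfun_psi. Qed.

Lemma bfun_iter_average u n : bfun u -> bfun (iter n average u).
Proof. by move=> bu; elim: n => //= n; exact: bfun_average. Qed.

Lemma bint_psi u : bfun u -> I (fun x => u (psi x)) = I u.
Proof. by move=> bu; apply: mpreserving_Rintegral => //; exact: bint. Qed.

Lemma average_itv u lo hi : (forall x, lo <= u x <= hi) ->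
  forall x, lo <= average u x <= hi.
Proof.
move=> ub x; case/andP: (ub x) => a1 a2; case/andP: (ub (psi x)) => b1 b2.
rewrite /average; have := l0; have := l1; move=> l1' l0'; apply/andP; split.
  by rewrite (_ : lo = (1 - l) * lo + l * lo); [rewrite lerD// ler_pM2l|ring].
by rewrite (_ : hi = (1 - l) * hi + l * hi); [rewrite lerD// ler_pM2l|ring].
Qed.

Lemma iter_average_itv u lo hi n : (forall x, lo <= u x <= hi) ->
  forall x, lo <= iter n average u x <= hi.
Proof. by move=> ub; elim: n => //= n; exact: average_itv. Qed.

Lemma iter_averageD (a b : R) u v n :
  iter n average (fun x => a * u x + b * v x) =
  (fun x => a * iter n average u x + b * iter n average v x).
Proof. by elim: n => //= n ->; apply/funext => x; rewrite /average; ring. Qed.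

Lemma iter_average_psi u n :
  iter n average (fun x => u (psi x)) = (fun x => iter n average u (psi x)).
Proof. by elim: n => //= n ->. Qed.

Lemma sqint_average u : bfun u -> sqint mu (average u) =
  sqint mu u - l * (1 - l) * sqint mu (fun x => u x - u (psi x)).
Proof.
move=> bu; have bp := bfun_psi bu.
have b1 := bfun_sq bu; have b2 := bfun_sq bp; have b3 := bfun_sq (bfunB bu bp).
have e : sqint mu u = (1 - l) * I (fun x => u (psi x) ^+ 2) + l * sqint mu u.
  by rewrite (bint_psi b1) -/(sqint mu u); ring.
rewrite e -mulNr /sqint -!bintZ//.
rewrite -!bintD//; try by do ?apply: bfunD; exact: bfunZ.
by congr Rintegral; apply/funext => x; rewrite /average; ring.
Qed.

Lemma sqint_average_le u : bfun u -> sqint mu (average u) <= sqint mu u.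
Proof.
move=> bu; rewrite sqint_average// gerBl mulr_ge0 ?sqint_ge0//.
by rewrite mulr_ge0// ltW.
Qed.

(** The loss in [sqint_average] telescopes along the orbit, hence vanishes. *)
Lemma iter_average_coboundary u : bfun u ->
  sqint mu (iter n average (fun x => u x - u (psi x))) @[n --> \oo] --> 0.
Proof.
move=> bu; pose q n := sqint mu (iter n average u).
have bi n := bfun_iter_average n bu.
have dq : nonincreasing_seq q.
  by apply/nonincreasing_seqP => n; exact: (sqint_average_le (bi n)).
have cq : cvgn q.
  apply: nonincreasing_is_cvgn => //; exists 0 => _ [n _ <-].
  exact: sqint_ge0.
have -> : (fun n => sqint mu (iter n average (fun x => u x - u (psi x)))) =
    (fun n => (l * (1 - l))^-1 * (q n - q n.+1)).
  apply/funext => n.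
  have -> : (fun x => u x - u (psi x)) = (fun x => 1 * u x + (-1) * u (psi x)).
    by apply/funext => x; ring.
  rewrite iter_averageD iter_average_psi /q /= sqint_average// subKr.
  rewrite mulKf ?gt_eqF ?mulr_gt0//; congr Rintegral; apply/funext => x; ring.
rewrite -(mulr0 (l * (1 - l))^-1); apply: cvgMl_tmp; rewrite -(subrr (limn q)).
apply: cvgB => //; have := cq; rewrite -(cvg_shiftS q); exact.
Qed.

(** Midpoints are the only convex combinations that the parallelogram law calls for, so an inductive
    closure replaces convex combinations with coefficients. *)
Inductive hull (g : X -> R) : (X -> R) -> Prop :=
| hull_base : hull g g
| hull_average u : hull g u -> hull g (average u)
| hull_midpoint u v : hull g u -> hull g v ->
    hull g (fun x => 2^-1 * (u x + v x)).

Lemma bfun_hull g u : bfun g -> hull g u -> bfun u.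
Proof.
move=> bg; elim=> // [{}u _|{}u v _ bu _ bv]; first exact: bfun_average.
by apply: bfunZ; exact: bfunD.
Qed.

Lemma hull_iter g u n : hull g u -> hull g (iter n average u).
Proof. by move=> hu; elim: n => //= n; exact: hull_average. Qed.

Lemma cvg0_le (p q : nat -> R) : (forall n, 0 <= p n <= q n) ->
  q n @[n --> \oo] --> (0 : R) -> p n @[n --> \oo] --> (0 : R).
Proof.
move=> pq q0; apply: (squeeze_cvgr (f := fun=> 0) (h := q)) => //.
  exact: nearW.
exact: cvg_cst.
Qed.

(** One averaging step changes [u] by -(1 - l) times the coboundary [u - u o psi], whose iterates
    tend to 0; midpoints follow from linearity of the iterates. *)
Lemma hull_orbit g u : bfun g -> hull g u ->
  sqint mu (fun x => iter n average u x - iter n average g x) @[n --> \oo] --> 0.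
Proof.
move=> bg; elim=> [|{}u hu IH|{}u v hu IHu hv IHv].
- rewrite (_ : (fun _ => _) = fun=> 0); first exact: cvg_cst.
  apply/funext => n; rewrite /sqint (_ : (fun _ => _) = fun=> 0).
    by rewrite Rintegral_cst// mul0r.
  by apply/funext => x; rewrite subrr expr0n.
- have bu := bfun_hull bg hu; have bp := bfun_psi bu.
  have c1 := iter_average_coboundary bu.
  apply: (@cvg0_le _ (fun n => 2 * ((1 - l) ^+ 2 *
      sqint mu (iter n average (fun x => u x - u (psi x)))) +
    2 * sqint mu (fun x => iter n average u x - iter n average g x))).
    move=> n; rewrite sqint_ge0 /=.
    have bi := bfun_iter_average n bu; have bgi := bfun_iter_average n bg.
    have bc := bfun_iter_average n (bfunB bu bp).
    rewrite -(sqrrN (1 - l)) -sqintZ//.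
    apply: le_trans (sqintD_le mu (bfunZ _ bc) (bfunB bi bgi)).
    rewrite le_eqVlt; apply/orP; left; apply/eqP; congr sqint; apply/funext => x.
    have -> : (fun x => u x - u (psi x)) = (fun x => 1 * u x + (-1) * u (psi x)).
      by apply/funext => z; ring.
    rewrite -iterSr iterS iter_averageD iter_average_psi.
    by rewrite /average; ring.
  have -> : (0 : R) = 2 * ((1 - l) ^+ 2 * 0) + 2 * 0 by ring.
  by apply: cvgD; apply: cvgMl_tmp => //; exact: cvgMl_tmp.
- have bu := bfun_hull bg hu; have bv := bfun_hull bg hv.
  apply: (@cvg0_le _ (fun n =>
    2 * (2^-1 ^+ 2 * sqint mu (fun x => iter n average u x - iter n average g x)) +
    2 * (2^-1 ^+ 2 * sqint mu (fun x => iter n average v x - iter n average g x)))).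
    move=> n; rewrite sqint_ge0 /=.
    have bi := bfun_iter_average n bu; have bj := bfun_iter_average n bv.
    have bgi := bfun_iter_average n bg.
    have b1 := bfunB bi bgi; have b2 := bfunB bj bgi.
    rewrite -!sqintZ//.
    apply: le_trans (sqintD_le mu (bfunZ _ b1) (bfunZ _ b2)).
    rewrite le_eqVlt; apply/orP; left; apply/eqP; congr sqint; apply/funext => x.
    have -> : (fun x => 2^-1 * (u x + v x)) = (fun x => 2^-1 * u x + 2^-1 * v x).
      by apply/funext => z; ring.
    by rewrite iter_averageD; field.
  have -> : (0 : R) = 2 * (2^-1 ^+ 2 * 0) + 2 * (2^-1 ^+ 2 * 0) by ring.
  by apply: cvgD; apply: cvgMl_tmp; exact: cvgMl_tmp.
Qed.

(** An almost minimizer of the L^2 norm over the midpoint-convex hull of the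
    orbit has, by the parallelogram law, an almost constant orbit, and all
    orbits from the hull are asymptotic to that of [g]. *)
Lemma iter_average_cauchy g : bfun g -> forall e, 0 < e ->
  exists N, forall n m, (N <= n)%N -> (N <= m)%N ->
    sqint mu (fun x => iter n average g x - iter m average g x) <= e.
Proof.
move=> bg e e0.
pose S : set R := [set q | exists2 u, hull g u & q = sqint mu u].
have S0 : S !=set0 by exists (sqint mu g), g => //; exact: hull_base.
have lbS : has_inf S.
  by split => //; exists 0 => _ [u _ ->]; exact: sqint_ge0.
(* The parallelogram law turns the defect e/24 into 4 e/24 = e/6. Two uses of (a + b)^2 <= 2 a^2 + 2
   b^2 then give 2 e/24 + 2 (2 e/6 + 2 e/24) <= e. *)
have e1 : 0 < e / 24 by rewrite divr_gt0.
have [_ [u hu ->] ulow] := inf_adherent e1 lbS.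
have bu := bfun_hull bg hu.
have orb n : sqint mu (iter n average u) <= sqint mu u.
  elim: n => //= n IH; apply: le_trans IH.
  by apply: sqint_average_le; exact: bfun_iter_average.
have near n m : sqint mu (fun x => iter n average u x - iter m average u x) <= e / 6.
  have bn := bfun_iter_average n bu; have bm := bfun_iter_average m bu.
  rewrite sqint_parallelogram//.
  have : inf S <= sqint mu (fun x => 2^-1 * (iter n average u x + iter m average u x)).
    apply: ge_inf; first by case: lbS.
    exists (fun x => 2^-1 * (iter n average u x + iter m average u x)) => //.
    by apply: hull_midpoint; exact: hull_iter.
  have := orb n; have := orb m.
  set a := sqint _ _; set b := sqint _ _; set c := sqint _ _; set dd := sqint _ _.
  move: ulow; rewrite -/b -/c -/dd => *; lra.
have e2 : 0 < e / 24 by rewrite divr_gt0.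
have /cvgrPdist_le/(_ _ e2)[N _ hN] := hull_orbit bg hu.
exists N => n m Nn Nm.
have bn := bfun_iter_average n bu; have bm := bfun_iter_average m bu.
have gn := bfun_iter_average n bg; have gm := bfun_iter_average m bg.
have kn := hN n Nn; rewrite /= sub0r normrN ger0_norm ?sqint_ge0// in kn.
have km := hN m Nm; rewrite /= sub0r normrN ger0_norm ?sqint_ge0// in km.
have h1 := sqintD_le mu (bfunB gn bn) (bfunB bn gm).
have h2 := sqintD_le mu (bfunB bn bm) (bfunB bm gm).
have h3 := near n m.
have r1 : sqint mu (fun x => iter n average g x - iter n average u x) =
    sqint mu (fun x => iter n average u x - iter n average g x).
  by congr Rintegral; apply/funext => x; ring.
have r2 : (fun x => iter n average g x - iter n average u x +
    (iter n average u x - iter m average g x)) =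
    (fun x => iter n average g x - iter m average g x).
  by apply/funext => x; ring.
have r3 : (fun x => iter n average u x - iter m average u x +
    (iter m average u x - iter m average g x)) =
    (fun x => iter n average u x - iter m average g x).
  by apply/funext => x; ring.
rewrite r2 r1 in h1; rewrite r3 in h2.
apply: (le_trans h1).
move: h2 h3 kn km; set a := sqint _ _; set b := sqint _ _; set c := sqint _ _.
set dd := sqint _ _; lra.
Qed.

End MeanErgodic.

Lemma le_cvg0 (R : realType) (q : R) (p : nat -> R) :
  (forall n, q <= p n) -> p n @[n --> \oo] --> (0 : R) -> q <= 0.
Proof.
move=> qp p0; have cp : cvgn p by apply/cvg_ex; exists 0.
rewrite -(cvg_lim (@Rhausdorff R) p0); apply: limr_ge => //; exact: nearW.
Qed.

Lemma normC_real (R : realType) (x : R) : `|x%:C| = `|x|%:C.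
Proof. by rewrite normc_def /= expr0n /= addr0 sqrtr_sqr. Qed.

(** * Identification of the limit with the invariant expectation *)

Section InvariantLimit.
Context (R : realType) d (X : measurableType d) (mu : probability X R).
Variables (phi psi : X -> X).
Hypothesis Hphi : invertible_mpt mu phi psi.
Implicit Types (g h k : X -> R).
Local Notation I u := (Rintegral mu setT u).

Lemma Linfty_toC_measurable k : Linfty mu (toC k) -> measurable_fun setT k.
Proof. by case=> [[]]. Qed.

Lemma Linfty_toC_bfun k : Linfty mu (toC k) ->
  exists2 k', bfun k' & {ae mu, forall x, k x = k' x}.
Proof.
move=> [[mk _] [C kC]].
exists (fun x => Num.max (- `|C|) (Num.min `|C| (k x))).
  apply: (@bfun_itv _ _ _ _ (- `|C|) `|C|).
    apply: measurable_maxr; first exact: measurable_cst.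
    by apply: measurable_minr => //; exact: measurable_cst.
  by move=> x; rewrite le_max ge_max ge_min !lexx andbT /= ge0_cp.
apply: filterS kC => x; rewrite /toC normC_real lecR => kx.
have : `|k x| <= `|C| by exact: le_trans kx (ler_norm _).
rewrite ler_norml => /andP[k1 k2].
by rewrite (min_idPr k2) (max_idPr k1).
Qed.

Lemma bfun_Linfty k : bfun k -> Linfty mu (toC k).
Proof.
move=> [mk [C kC]]; split; first by split => //=; exact: measurable_cst.
by exists C; apply: aeW => x; rewrite /toC normC_real lecR.
Qed.

Lemma ae_invariant_psi k : {ae mu, forall x, k (phi x) = k x} ->
  {ae mu, forall x, k (psi x) = k x}.
Proof.
move=> kphi; have := mpreserving_ae (mpreserving_psi Hphi) kphi.
case: Hphi => _ _ _ e _; apply: filterS2 e => x ex.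
by rewrite ex => <-.
Qed.

Lemma ae_invariant_phi k : {ae mu, forall x, k (psi x) = k x} ->
  {ae mu, forall x, k (phi x) = k x}.
Proof.
move=> kpsi; have := mpreserving_ae (mpreserving_phi Hphi) kpsi.
case: Hphi => _ _ _ _ e; apply: filterS2 e => x ex.
by rewrite ex => <-.
Qed.

Lemma bint_ae_mul g k k' : measurable_fun setT g -> measurable_fun setT k ->
  measurable_fun setT k' -> {ae mu, forall x, k x = k' x} ->
  I (fun x => g x * k x) = I (fun x => g x * k' x).
Proof.
move=> mg mk mk' kk; apply: bint_ae; [exact: measurable_funM..|].
by apply: filterS kk => x ->.
Qed.

(** Invariance of [k] and of [mu] makes the integrals of (u o psi) k and of u k equal, so averaging
    keeps the pairing with [k]. *)
Lemma bint_iter_average (l : R) g k n : bfun g -> bfun k ->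
  {ae mu, forall x, k (psi x) = k x} ->
  I (fun x => iter n (average psi l) g x * k x) = I (fun x => g x * k x).
Proof.
move=> bg bk kpsi; have pp := mpreserving_psi Hphi.
elim: n => //= n IH; set u := iter n _ g in IH *.
have bu : bfun u := @bfun_iter_average _ _ _ _ _ l pp g n bg.
have bup := bfun_psi pp bu.
have -> : (fun x => average psi l u x * k x) =
    (fun x => (1 - l) * (u (psi x) * k x) + l * (u x * k x)).
  by apply/funext => x; rewrite /average; ring.
rewrite bintD; [|by apply: bfunZ; exact: bfunM..].
rewrite !bintZ; [|exact: bfunM..].
have -> : I (fun x => u (psi x) * k x) = I (fun x => u x * k x).
  rewrite -(bint_psi pp (bfunM bu bk)); apply: bint_ae_mul.
  - exact: bup.1.
  - exact: bk.1.
  - exact: (bfun_psi pp bk).1.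
  - by apply: filterS kpsi => x ->.
by rewrite IH; ring.
Qed.

(** The limit is invariant because [v n - v n o psi] is an iterate of a coboundary and tends to 0.
    It is the expectation because the pairing with an invariant function is constant along the
    iterates and passes to the limit by Cauchy-Schwarz. *)
Lemma iter_average_cvg (l : R) g lo hi : 0 < l < 1 ->
  measurable_fun setT g -> (forall x, lo <= g x <= hi) ->
  exists h, [/\ measurable_fun setT h, forall x, lo <= h x <= hi,
    sqint mu (fun x => iter n (average psi l) g x - h x) @[n --> \oo] --> 0 &
    is_invariant_expectation mu phi g h].
Proof.
move=> l01 mg gb; have pp := mpreserving_psi Hphi.
have bg := bfun_itv mg gb.
pose v n := iter n (average psi l) g.
have bv n : bfun (v n) := @bfun_iter_average _ _ _ _ _ l pp g n bg.
have [h [mh hb vh]] := sqint_complete (fun n => (bv n).1)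
  (fun n => iter_average_itv psi l01 n gb) (iter_average_cauchy pp l01 bg).
have bh := bfun_itv mh hb; have bhp := bfun_psi pp bh.
exists h; split => //; split; first exact: bfun_Linfty.
- apply: ae_invariant_phi.
  suff : {ae mu, forall x, h x - h (psi x) = 0}.
    by apply: filterS => x /eqP; rewrite subr_eq0 => /eqP ->.
  apply: sqint_eq0; first exact: bfunB.
  apply/eqP; rewrite eq_le sqint_ge0 andbT.
  apply: (@le_cvg0 _ _ (fun n => 2 * sqint mu (fun x => v n x - h x) +
    2 * (2 * sqint mu (iter n (average psi l) (fun x => g x - g (psi x))) +
      2 * sqint mu (fun x => v n x - h x)))).
    move=> n; have bvp := bfun_psi pp (bv n).
    have <- : sqint mu (fun x => h x - v n x) = sqint mu (fun x => v n x - h x).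
      by congr Rintegral; apply/funext => x; ring.
    have s1 := sqintD_le mu (bfunB bh (bv n)) (bfunB (bv n) bhp).
    have s2 := sqintD_le mu (bfunB (bv n) bvp) (bfunB bvp bhp).
    have e1 : (fun x => h x - v n x + (v n x - h (psi x))) =
      (fun x => h x - h (psi x)) by apply/funext => x; ring.
    have e2 : (fun x => v n x - v n (psi x) + (v n (psi x) - h (psi x))) =
      (fun x => v n x - h (psi x)) by apply/funext => x; ring.
    have e3 : sqint mu (fun x => v n (psi x) - h (psi x)) =
        sqint mu (fun x => h x - v n x).
      rewrite /sqint (bint_psi pp (bfun_sq (bfunB (bv n) bh))).
      by congr Rintegral; apply/funext => x; ring.
    have e4 : iter n (average psi l) (fun x => g x - g (psi x)) =
        (fun x => v n x - v n (psi x)).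
      have -> : (fun x => g x - g (psi x)) = (fun x => 1 * g x + (-1) * g (psi x)).
        by apply/funext => x; ring.
      by rewrite iter_averageD iter_average_psi; apply/funext => x; rewrite /v; ring.
    rewrite e1 in s1; rewrite e2 e3 in s2; rewrite e4.
    by apply: le_trans s1 _; rewrite lerD2l ler_pM2l.
  have -> : (0 : R) = 2 * 0 + 2 * (2 * 0 + 2 * 0) by ring.
  have c0 := iter_average_coboundary pp l01 bg.
  apply: cvgD; first exact: cvgMl_tmp.
  by apply: cvgMl_tmp; apply: cvgD; exact: cvgMl_tmp.
- move=> k Lk kphi.
  have mk := Linfty_toC_measurable Lk.
  have [k' bk' kk'] := Linfty_toC_bfun Lk.
  rewrite (bint_ae_mul mh mk bk'.1 kk') (bint_ae_mul mg mk bk'.1 kk').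
  have kpsi' : {ae mu, forall x, k' (psi x) = k' x}.
    have := mpreserving_ae pp kk'; apply: filterS3 (ae_invariant_psi kphi) kk' => x.
    by move=> -> -> <-.
  apply/eqP; rewrite -subr_eq0 -sqrf_eq0 eq_le sqr_ge0 andbT.
  apply: (@le_cvg0 _ _ (fun n => sqint mu k' * sqint mu (fun x => v n x - h x))).
    move=> n; rewrite -(bint_iter_average l n bg bk' kpsi') -/(v n) mulrC.
    apply: le_trans (bint_CS mu (bfunB (bv n) bh) bk').
    rewrite le_eqVlt; apply/orP; left; apply/eqP.
    have -> : (fun x => (v n x - h x) * k' x) =
        (fun x => v n x * k' x + (-1) * (h x * k' x)).
      by apply/funext => x; ring.
    rewrite bintD ?bintZ; [ring|exact: bfunM|exact: bfunM|].
    by apply: bfunZ; exact: bfunM.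
  by rewrite -(mulr0 (sqint mu k')); exact: cvgMl_tmp.
Qed.

(** The difference of two bounded representatives is itself an invariant test function, and testing
    with it makes the integral of its square vanish. *)
Lemma invariant_expectation_unique g h h' :
  is_invariant_expectation mu phi g h -> is_invariant_expectation mu phi g h' ->
  {ae mu, forall x, h x = h' x}.
Proof.
move=> [Lh hphi hE] [Lh' hphi' hE'].
have [mh mh'] := (Linfty_toC_measurable Lh, Linfty_toC_measurable Lh').
have [a ba ha] := Linfty_toC_bfun Lh; have [b bb hb] := Linfty_toC_bfun Lh'.
pose k x := a x - b x; have bk : bfun k by exact: bfunB.
have kphi : {ae mu, forall x, k (phi x) = k x}.
  have pp := mpreserving_phi Hphi.
  have e1 : {ae mu, forall x, a (phi x) = a x}.
    have := mpreserving_ae pp ha; apply: filterS3 hphi ha => x.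
    by move=> -> -> <-.
  have e2 : {ae mu, forall x, b (phi x) = b x}.
    have := mpreserving_ae pp hb; apply: filterS3 hphi' hb => x.
    by move=> -> -> <-.
  by apply: filterS2 e1 e2 => x; rewrite /k => -> ->.
have Lk := bfun_Linfty bk.
have := etrans (hE k Lk kphi) (esym (hE' k Lk kphi)).
have comm (p q : X -> R) : (fun x => p x * q x) = (fun x => q x * p x).
  by apply/funext => x; rewrite mulrC.
rewrite (comm h) (comm h') (bint_ae_mul bk.1 mh ba.1 ha).
rewrite (bint_ae_mul bk.1 mh' bb.1 hb) => /eqP; rewrite -subr_eq0 => /eqP e0.
have k0 : {ae mu, forall x, k x = 0}.
  apply: sqint_eq0 => //; rewrite -e0 /sqint -[in RHS]mulN1r -bintZ; last exact: bfunM.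
  rewrite -bintD; [|exact: bfunM|by apply: bfunZ; exact: bfunM].
  by congr Rintegral; apply/funext => x; rewrite /k; ring.
apply: filterS3 k0 ha hb => x /eqP; rewrite subr_eq0 => /eqP e -> ->.
exact: e.
Qed.

Lemma is_invariant_expectation_ae g g' h : measurable_fun setT g ->
  measurable_fun setT g' -> {ae mu, forall x, g x = g' x} ->
  is_invariant_expectation mu phi g h -> is_invariant_expectation mu phi g' h.
Proof.
move=> mg mg' gg [Lh hphi hE]; split=> // k Lk kphi; rewrite hE//.
have mk := Linfty_toC_measurable Lk.
apply: bint_ae; [exact: measurable_funM..|].
by apply: filterS gg => x ->.
Qed.

End InvariantLimit.

(** * Strong convergence *)

Lemma powR_lipschitz (R : realType) (q m M : R) : 0 < m ->
  exists2 L, 0 <= L & forall x y, m <= x <= M -> m <= y <= M ->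
    `|x `^ q - y `^ q| <= L * `|x - y|.
Proof.
move=> m0; have [lo [hi [lo0 b]]] := powR_itv_bounds (q - 1) M m0.
exists (`|q| * `|hi|); first by rewrite mulr_ge0.
suff H x y : m <= x -> y <= M -> x <= y ->
    `|y `^ q - x `^ q| <= `|q| * `|hi| * `|y - x|.
  move=> x y /andP[mx xM] /andP[my yM]; have [xy|/ltW yx] := leP x y.
    by rewrite distrC (distrC x); exact: H.
  exact: H.
move=> mx yM xy.
have pos z : x <= z -> 0 < z by move=> xz; exact: lt_le_trans (lt_le_trans m0 mx) xz.
have der z : x <= z -> is_derive z 1 (fun t => t `^ q) (q * z `^ (q - 1)).
  by move=> xz; apply: is_derive1_powR; exact: pos.
have [z|c|] := MVT_segment (f := fun t => t `^ q) (df := fun z => q * z `^ (q - 1)) xy.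
- by rewrite in_itv /= => /andP[/ltW xz _]; exact: der.
- apply: derivable_within_continuous => z; rewrite in_itv /= => /andP[xz _].
  by have := der z xz; case.
- move=> c; rewrite in_itv /= => /andP[xc cy] ->.
  rewrite !normrM; apply: ler_wpM2r => //; apply: ler_wpM2l => //.
  rewrite ger0_norm ?powR_ge0//; apply: le_trans (ler_norm _).
  have /b/andP[//] : m <= c <= M.
  by rewrite (le_trans mx xc) (le_trans cy yM).
Qed.

Section WeightedConvergence.
Context (R : realType) d (X : measurableType d) (mu : probability X R).
Variables (phi psi : X -> X).
Hypothesis Hphi : invertible_mpt mu phi psi.
Let nu := XZmeasure mu.

Let band (N : nat) : set int := [set k | `|k| <= N%:Z].

Let band_fin N : exists2 c : R, 0 <= c & (@zcounting R) (band N) = c%:E.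
Proof.
have fb : finite_set (band N).
  apply: (@sub_finite_set _ _ ([set (k%:Z : int) | k in `I_N.+1] `|`
      [set (- k%:Z : int) | k in `I_N.+1])).
    move=> z; rewrite /band /= => zN; case: (lerP 0 z) => z0.
      by left; exists `|z|%N; rewrite /= ?gez0_abs// ltnS -lez_nat abszE.
    by right; exists `|z|%N; rewrite /= ?ltz0_abs ?opprK// ltnS -lez_nat abszE.
  by rewrite finite_setU; split; exact/finite_image/finite_II.
rewrite /zcounting /counting /= asboolT//.
by eexists; last reflexivity; exact: ler0n.
Qed.

(** Fubini over the band and invariance of [mu] under each [zpow]. *)
Lemma band_sqint N : exists2 c : R, 0 <= c & forall D : X -> R, bfun D ->
  (\int[nu]_p (zlift phi psi D p ^+ 2 * \1_(band N) p.2)%:E = (c * sqint mu D)%:E)%E.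
Proof.
have [c c0 cE] := band_fin N; exists c => // D bD.
have bz := bfun_zlift Hphi bD; have bD2 := bfun_sq bD.
have mb : measurable_fun [set: int] (\1_(band N) : int -> R).
  exact: measurable_indic.
rewrite /nu /XZmeasure fubini_tonelli2/=; last 2 first.
- apply/measurable_EFinP; apply: measurable_funM; first exact: (bfun_sq bz).1.
  exact: (measurableT_comp mb measurable_snd).
- by move=> p; rewrite lee_fin mulr_ge0 ?sqr_ge0.
rewrite (_ : (fun _ => _) = (fun k : int => (sqint mu D)%:E * (\1_(band N) k)%:E)%E).
  rewrite ge0_integralZl//=; try by [exact/measurable_EFinP|
    move=> k _; rewrite lee_fin|rewrite lee_fin sqint_ge0].
  have -> : (\int[@zcounting R]_k (\1_(band N) k)%:E = c%:E)%E.
    by rewrite integral_indic// setIT; exact: cE.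
  by rewrite -EFinM mulrC.
apply/funext => k; rewrite /fubini_G /=.
under eq_integral do rewrite mulrC EFinM.
rewrite ge0_integralZl//=; last first.
- by move=> x _; rewrite lee_fin sqr_ge0.
- apply/measurable_EFinP; apply: measurable_funX.
  by apply: measurableT_comp bD.1 _; case: (mpreserving_zpow Hphi (- k)).
rewrite muleC; congr (_ * _)%E.
rewrite (mpreserving_ge0_integral (f := fun x => (D x ^+ 2)%:E)
  (mpreserving_zpow Hphi (- k))).
- rewrite /sqint /Rintegral fineK//; apply: integrable_fin_num => //; exact: bint.
- exact/measurable_EFinP/bD2.1.
- by move=> x; rewrite lee_fin sqr_ge0.
Qed.

Variable w : X * int -> R.
Hypothesis w0 : forall p, 0 <= w p.
Hypothesis iw : nu.-integrable setT (EFin \o w).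

Let mw : measurable_fun setT w.
Proof. by apply/measurable_EFinP; exact: measurable_int iw. Qed.

(** What remains of the weight outside the region |k| <= N, w <= N; that region meets finitely many
    slices and carries a bounded weight. *)
Let tail (N : nat) p : R := if (`|p.2| <= N%:Z) && (w p <= N%:R) then 0 else w p.

Let tail0 N p : 0 <= tail N p. Proof. by rewrite /tail; case: ifP. Qed.

Let measurable_tail N : measurable_fun setT (tail N).
Proof.
apply: measurable_fun_ifT => //.
apply: measurable_and.
  exact: (measurableT_comp (f := fun k : int => `|k| <= N%:Z) _ measurable_snd).
by apply: measurable_fun_ler => //; exact: measurable_cst.
Qed.

Let tail_le N p : tail N p <= w p. Proof. by rewrite /tail; case: ifP. Qed.

Let tail_cvg : (\int[nu]_p (tail N p)%:E)%E @[N --> \oo] --> 0%E.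
Proof.
have -> : (0 = \int[nu]_(p in setT) (cst 0 p))%E by rewrite integral0.
apply: (@dominated_cvg _ _ _ nu setT measurableT
  (fun N p => (tail N p)%:E) (cst 0%E) (EFin \o w)) => //.
- by move=> N; apply/measurable_EFinP; exact: measurable_tail.
- move=> p _; apply: cvg_near_cst.
  exists (maxn `|p.2|%N (Num.truncn (w p)).+1) => // N /=.
  rewrite geq_max => /andP[N1 N2]; rewrite /tail ifT//; apply/andP; split.
    by rewrite -abszE lez_nat.
  by apply/ltW/(lt_le_trans (truncnS_gt _)); rewrite ler_nat.
- by move=> N p _; rewrite gee0_abs lee_fin.
Qed.

(** The truncated weight contributes at most N times the integral over the band, a multiple of
    [sqint]. The rest is at most K^2 times the integral of [tail N], small by dominated convergence;
    [N] is therefore chosen before [n]. *)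
Lemma weighted_sqint_cvg (D : nat -> X -> R) (K : R) :
  (forall n, measurable_fun setT (D n)) -> (forall n x, `|D n x| <= K) ->
  sqint mu (D n) @[n --> \oo] --> 0 ->
  Rintegral nu setT (fun p => zlift phi psi (D n) p ^+ 2 * w p) @[n --> \oo] --> 0.
Proof.
move=> mD DK D0.
have bD n : bfun (D n) by split; [exact: mD|exists K].
have bz n := bfun_sq (bfun_zlift Hphi (bD n)).
have iD n : nu.-integrable setT (EFin \o (fun p => zlift phi psi (D n) p ^+ 2 * w p)).
  exact: integrable_bfunM.
have it N : nu.-integrable setT (EFin \o tail N).
  apply: le_integrable iw => //; first by apply/measurable_EFinP; exact: measurable_tail.
  by move=> p _; rewrite /= !ger0_norm// lee_fin.
apply/cvgrPdist_le => e e0.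
have [N hN] : exists N, K ^+ 2 * Rintegral nu setT (tail N) <= e / 2.
  (* The summand 1 keeps the divisor positive when [K] is 0. *)
  have K1 : 0 < K ^+ 2 + 1 by rewrite ltr_wpDl ?sqr_ge0.
  have e1 : 0 < e / 2 / (K ^+ 2 + 1) by rewrite !divr_gt0.
  have /fine_cvgP[_ /cvgrPdist_le/(_ _ e1)[N _ /(_ N (leqnn N))]] := tail_cvg.
  rewrite /= sub0r normrN => hN; exists N.
  have t0 : 0 <= Rintegral nu setT (tail N).
    by apply: Rintegral_ge0 => p _; exact: tail0.
  rewrite ger0_norm// ler_pdivlMr// in hN.
  by apply: le_trans hN; rewrite mulrC ler_wpM2l// lerDl.
have [c c0 cE] := band_sqint N.
have c1 : 0 < N%:R * c + 1 by rewrite ltr_wpDl ?mulr_ge0.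
have e1 : 0 < e / 2 / (N%:R * c + 1) by rewrite !divr_gt0.
have /cvgrPdist_le/(_ _ e1)[n0 _ hn] := D0.
exists n0 => // n /hn /=; rewrite !sub0r !normrN ger0_norm ?sqint_ge0//.
rewrite ler_pdivlMr// => hs.
have ib : nu.-integrable setT
    (EFin \o (fun p => zlift phi psi (D n) p ^+ 2 * \1_(band N) p.2)).
  apply/integrableP; split.
    apply/measurable_EFinP; apply: measurable_funM; first exact: (bz n).1.
    exact: (measurableT_comp (measurable_indic _) measurable_snd).
  rewrite (eq_integral (fun p =>
    (zlift phi psi (D n) p ^+ 2 * \1_(band N) p.2)%:E)); last first.
    by move=> p _; rewrite /= ger0_norm// mulr_ge0// sqr_ge0.
  by rewrite cE// ltry.
rewrite ger0_norm; last by apply: Rintegral_ge0 => p _; rewrite mulr_ge0 ?sqr_ge0.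
apply: (@le_trans _ _ (Rintegral nu setT (fun p =>
    N%:R * (zlift phi psi (D n) p ^+ 2 * \1_(band N) p.2) + K ^+ 2 * tail N p))).
  apply: le_Rintegral => //.
    rewrite (_ : _ \o _ = (fun p => (N%:R%:E *
      (zlift phi psi (D n) p ^+ 2 * \1_(band N) p.2)%:E) + (K ^+ 2)%:E * (tail N p)%:E)%E).
      apply: integrableD => //; first exact: (integrableZl measurableT N%:R ib).
      exact: (integrableZl measurableT (K ^+ 2) (it N)).
    by apply/funext => p.
  move=> p _; have z2 := sqr_ge0 (zlift phi psi (D n) p).
  have zK : zlift phi psi (D n) p ^+ 2 <= K ^+ 2.
    rewrite -[leLHS]real_normK ?num_real// lerXn2r ?nnegrE//; last exact: DK.
    exact: le_trans (DK n p.1).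
  rewrite /tail; case: ifP => [/andP[pN wN]|_].
    rewrite indicE mem_set// mulr1 mulr0 addr0 mulrC; exact: ler_wpM2r.
  rewrite -[leLHS]add0r; apply: lerD; last exact: ler_wpM2r.
  by rewrite mulr_ge0// mulr_ge0.
rewrite RintegralD//; last 2 first.
- exact: (integrableZl measurableT N%:R ib).
- exact: (integrableZl measurableT (K ^+ 2) (it N)).
rewrite !RintegralZl// {1}/Rintegral cE//= (splitr e) lerD//.
by apply: le_trans hs; rewrite mulrA [leRHS]mulrC ler_wpM2r ?sqint_ge0// lerDl.
Qed.

End WeightedConvergence.

Section StrongConvergence.
Context (R : realType) d (X : measurableType d) (mu : probability X R).
Variables (phi psi : X -> X).
Hypothesis Hphi : invertible_mpt mu phi psi.

(** The shift is isometric, so the squared distance at [u] is the integral of the squared difference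
    of the multipliers with weight |u|^2. *)
Lemma sot_cvg_shift_mulL (f : nat -> X -> R) (h : X -> R) (lo hi : R) :
  (forall n, measurable_fun setT (f n)) -> (forall n x, lo <= f n x <= hi) ->
  measurable_fun setT h -> (forall x, lo <= h x <= hi) ->
  sqint mu (fun x => f n x - h x) @[n --> \oo] --> 0 ->
  sot_cvg (XZdot mu)
    (fun n => cp_shift mu \o mulL (nu := XZmeasure mu) (zlift phi psi (f n)))
    (cp_shift mu \o mulL (nu := XZmeasure mu) (zlift phi psi h)).
Proof.
move=> mf fb mh hb fh u.
have bf n := bfun_zlift Hphi (bfun_itv (mf n) (fb n)).
have bh := bfun_zlift Hphi (bfun_itv mh hb).
pose nu := XZmeasure mu.
have E n : nsq (XZdot mu) (cp_shift mu (mulL (nu := nu) (zlift phi psi (f n)) u) -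
     cp_shift mu (mulL (nu := nu) (zlift phi psi h) u)) =
   Rintegral nu setT (fun p => zlift phi psi (fun x => f n x - h x) p ^+ 2 *
     normc2 (repr u p)).
  rewrite cp_shiftE -linB; last by apply: compL_linear; exact: mpreserving_zshift.
  rewrite (nsq_compL (nu := nu) _ (mpreserving_zshift mu 1)) -mulLB// nsq_mulL//.
  exact: bfunB.
have c0 : Rintegral nu setT (fun p => zlift phi psi (fun x => f n x - h x) p ^+ 2 *
     normc2 (repr u p)) @[n --> \oo] --> 0.
  apply: (@weighted_sqint_cvg _ _ _ _ _ _ Hphi _ _ _ _ (hi - lo)) => //.
  - by move=> p; exact: normc2_ge0.
  - exact: integrable_nsq.
  - by move=> n; exact: measurable_funB.
  - move=> n x; have := fb n x; have := hb x; rewrite ler_norml.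
    by move=> /andP[h1 h2] /andP[f1 f2]; apply/andP; split; lra.
rewrite (_ : (fun n => _) = (fun n => Num.sqrt (Rintegral nu setT (fun p =>
    zlift phi psi (fun x => f n x - h x) p ^+ 2 * normc2 (repr u p))))).
  rewrite -[X in _ --> X]sqrtr0; exact: (continuous_cvg _ (@sqrt_continuous _ _) c0).
by apply/funext => n; rewrite hnormE /= E.
Qed.

End StrongConvergence.

(** * A bounded representative of |T|, bounded away from 0 *)

Section InvertibleModulus.
Context (R : realType) d (X : measurableType d) (mu : probability X R).
Variables (phi psi : X -> X).
Hypothesis Hphi : invertible_mpt mu phi psi.

(** The slice at 0 has counting mass one, so a null set meets it in a null set; on this slice
    [zlift] gives back the function itself. *)
Lemma ae_slice0 (P : X * int -> Prop) :
  {ae XZmeasure mu, forall p, P p} -> {ae mu, forall x, P (x, 0)}.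
Proof.
move=> [A [mA A0 PA]].
have mA0 : measurable [set x | A (x, 0 : int)].
  rewrite (_ : [set x | _] = (fun x => (x, 0 : int)) @^-1` A)//.
  rewrite -[_ @^-1` _]setTI.
  apply: (measurable_fun_pair (@measurable_id _ _ _) (measurable_cst _)) => //.
exists [set x | A (x, 0 : int)]; split => //; last by move=> x Px; exact: PA.
apply/eqP; rewrite eq_le measure_ge0 andbT -[leRHS]A0.
have m0 : measurable [set (0 : int)] by [].
have <- : XZmeasure mu ([set x | A (x, 0 : int)] `*` [set 0]) =
    mu [set x | A (x, 0 : int)].
  rewrite [LHS]product_measure1E//= -[RHS]mule1; congr (_ * _)%E.
  rewrite /zcounting /counting /= asboolT; last exact: finite_set1.
  by rewrite fset_set1 finmap.cardfs1.
apply: le_measure; rewrite ?inE//; first exact: measurableX.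
by move=> [x k] /= [Ax ->].
Qed.

(** A bounded inverse of [T] and the isometry of the shift bound the multiplier from below in norm,
    hence its absolute value almost everywhere; positivity then removes the absolute value. *)
Lemma invertible_absT_bounds (T : XZspace mu -> XZspace mu) (absT : X -> R) :
  invertible_op (XZdot mu) T -> Linfty mu (toC absT) ->
  positive_op (XZdot mu) (cp_pi mu phi psi (toC absT)) ->
  T = cp_shift mu \o cp_pi mu phi psi (toC absT) ->
  exists (a : X -> R) (c C : R), [/\ measurable_fun setT a, 0 < c, forall x, c <= a x <= C &
    {ae mu, forall x, absT x = a x}].
Proof.
move=> [_ [B [Bb TK _]]] LT posT TE.
have mT := Linfty_toC_measurable LT.
have [a1 b1 e1] := Linfty_toC_bfun LT.
have E1 := cp_pi_ae Hphi mT b1 e1.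
have bz := bfun_zlift Hphi b1.
pose nu := XZmeasure mu.
have [k k0 Bk] := bounded_op_nsq Bb.
have low (u : L2space nu) : nsq (@L2dot _ _ R nu) u <=
    k * nsq (@L2dot _ _ R nu) (mulL (zlift phi psi a1) u).
  rewrite -[u in leLHS]TK; apply: le_trans (Bk _) _.
  rewrite TE /= cp_shiftE E1 (nsq_compL (nu := nu) _ (mpreserving_zshift mu 1)).
  exact: lexx.
have k1 : 0 < k + 1 by rewrite ltr_wpDl.
have e0 : 0 < (k + 1)^-1 by rewrite invr_gt0.
have ke : k * (k + 1)^-1 ^+ 2 < 1.
  rewrite exprVn ltr_pdivrMr ?exprn_gt0// mul1r; nra.
have sf : sigma_finite [set: X * int] nu := sigma_finiteT (XZsigma mu).
have l1 := mulL_lower_bound_ae sf bz k0 low e0 ke.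
have l2 : {ae nu, forall p, (k + 1)^-1 <= zlift phi psi a1 p}.
  by apply: (positive_mulL_ae sf bz e0 l1); rewrite -E1.
have {}l2 := ae_slice0 l2.
case: b1 => m1 [C hC]; set c := (k + 1)^-1 in e0 l2 *.
(* Clamping alters [a1] only on a null set, and [Num.max C c] ensures that the interval is not
   empty. *)
exists (fun x => Num.max c (Num.min (Num.max C c) (a1 x))), c, (Num.max C c); split => //.
- apply: measurable_maxr; first exact: measurable_cst.
  by apply: measurable_minr => //; exact: measurable_cst.
- by move=> x; rewrite le_max lexx /= ge_max le_max lexx orbT /= ge_min lexx.
- apply: filterS2 e1 l2 => x -> /=; rewrite /zlift /= => ca.
  have aC : a1 x <= Num.max C c by rewrite le_max (le_trans (ler_norm _) (hC x)).
  by rewrite (min_idPr aC) (max_idPr ca).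
Qed.

End InvertibleModulus.

Lemma powR_invK (R : realType) (r x : R) : r != 0 -> 0 <= x ->
  (x `^ r^-1) `^ r = x.
Proof. by move=> r0 x0; rewrite -powRrM mulVf// powRr1. Qed.

Lemma powRK_inv (R : realType) (r x : R) : r != 0 -> 0 <= x ->
  (x `^ r) `^ r^-1 = x.
Proof. by move=> r0 x0; rewrite -powRrM mulfV// powRr1. Qed.

Section Iterates.
Context (R : realType) d (X : measurableType d) (mu : probability X R).
Variables (phi psi : X -> X).
Hypothesis Hphi : invertible_mpt mu phi psi.

(** Raising to the power [r] conjugates one step to [average], whose iterates stay in the initial
    interval by convexity; this supplies the positive lower bound that the next step requires. *)
Lemma iter_induced_aluthge (a : X -> R) (c C r l : R) n :
  measurable_fun setT a -> 0 < c -> (forall x, c <= a x <= C) ->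
  r != 0 -> 0 < l < 1 ->
  iter n (induced_aluthge (XZdot mu) (power_mean r l))
    (cp_shift mu \o mulL (nu := XZmeasure mu) (zlift phi psi a)) =
  cp_shift mu \o mulL (nu := XZmeasure mu) (zlift phi psi (fun x =>
    iter n (average psi l) (fun x => a x `^ r) x `^ r^-1)).
Proof.
move=> ma c0 acC r0 l01; have pp := mpreserving_psi Hphi.
have [lo [hi [lo0 b]]] := powR_itv_bounds r C c0.
have [lo' [hi' [lo'0 b']]] := powR_itv_bounds r^-1 hi lo0.
have mu0 := measurable_funpowR r ma.
have ub0 x : lo <= a x `^ r <= hi by exact: b.
have ub m := iter_average_itv psi l01 m ub0.
have bu m := @bfun_iter_average _ _ _ _ _ l pp _ m (bfun_itv mu0 ub0).
elim: n => [|n IH].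
  congr (_ \o mulL (zlift _ _ _)); apply/funext => x /=.
  by rewrite powRK_inv//; case/andP: (acC x) => /(lt_le_trans c0)/ltW.
rewrite iterS IH; set u := iter n (average psi l) (fun x => a x `^ r).
have e : (fun x => ((1 - l) * (u (psi x) `^ r^-1) `^ r +
     l * (u x `^ r^-1) `^ r) `^ r^-1) =
    (fun x => iter n.+1 (average psi l) (fun x => a x `^ r) x `^ r^-1).
  apply/funext => x /=; rewrite -/u /average !powR_invK//.
    by case/andP: (ub n x) => /(lt_le_trans lo0)/ltW.
  by case/andP: (ub n (psi x)) => /(lt_le_trans lo0)/ltW.
have bg m : bfun (fun x => iter m (average psi l) (fun x => a x `^ r) x `^ r^-1).
  apply: (@bfun_itv _ _ _ _ lo' hi'); first exact: measurable_funpowR (bu m).1.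
  by move=> x; exact: b' (ub m x).
rewrite -e; apply: (induced_aluthge_step Hphi (bg n) lo'0 _ r0 l01) => //.
  by move=> x; exact: b' (ub n x).
by rewrite e; exact: bg.
Qed.

Lemma sqint_powR_cvg (v : nat -> X -> R) (h : X -> R) (q lo hi : R) : 0 < lo ->
  (forall n, measurable_fun setT (v n)) -> (forall n x, lo <= v n x <= hi) ->
  measurable_fun setT h -> (forall x, lo <= h x <= hi) ->
  sqint mu (fun x => v n x - h x) @[n --> \oo] --> 0 ->
  sqint mu (fun x => v n x `^ q - h x `^ q) @[n --> \oo] --> 0.
Proof.
move=> lo0 mv vb mh hb vh.
have [L L0 lip] := powR_lipschitz q hi lo0.
have [lo' [hi' [_ b']]] := powR_itv_bounds q hi lo0.
apply: (@cvg0_le _ _ (fun n => L ^+ 2 * sqint mu (fun x => v n x - h x))); last first.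
  by rewrite -(mulr0 (L ^+ 2)); exact: cvgMl_tmp.
move=> n; rewrite sqint_ge0 /=.
have bv := bfun_itv (mv n) (vb n); have bh := bfun_itv mh hb.
have bvq := bfun_itv (measurable_funpowR q (mv n)) (fun x => b' _ (vb n x)).
have bhq := bfun_itv (measurable_funpowR q mh) (fun x => b' _ (hb x)).
rewrite -sqintZ; last exact: bfunB.
apply: le_bint.
- exact: bfun_sq (bfunB bvq bhq).
- by apply: bfun_sq; apply: bfunZ; exact: bfunB.
move=> x; rewrite -[leLHS]real_normK ?num_real// -[leRHS]real_normK ?num_real//.
by rewrite lerXn2r ?nnegrE// normrM (ger0_norm L0); exact: lip.
Qed.

End Iterates.

Theorem corollary9p5 (R : realType) (d : measure_display)
  (X : measurableType d) (mu : probability X R) (phi psi : X -> X)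
  (Hphi : invertible_mpt mu phi psi)
  (T : XZspace mu -> XZspace mu) (absT : X -> R)
  (T_in_M : crossed_product mu phi psi T)
  (T_invertible : invertible_op (XZdot mu) T)
  (absT_Linfty : Linfty mu (toC absT))
  (absTE : absolute_value (XZdot mu) T (cp_pi mu phi psi (toC absT)))
  (TE : T = cp_shift mu \o cp_pi mu phi psi (toC absT))
  (r lambda : R) (Hr : -1 <= r <= 1) (r_neq0 : r != 0)
  (Hlambda : 0 < lambda < 1) :
  sot_cvg (XZdot mu)
    (fun n => iter n (induced_aluthge (XZdot mu) (power_mean r lambda)) T)
    (cp_shift mu \o cp_pi mu phi psi (toC (fun x =>
       invariant_expectation mu phi (fun y => absT y `^ r) x `^ r^-1))).
Proof.
have pp := mpreserving_psi Hphi.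
have mT := Linfty_toC_measurable absT_Linfty.
have [_ posT _] := absTE.
have [a [c [C [ma c0 acC Ta]]]] :=
  invertible_absT_bounds Hphi T_invertible absT_Linfty posT TE.
rewrite TE (cp_pi_ae Hphi mT (bfun_itv ma acC) Ta).
have [lo [hi [lo0 b]]] := powR_itv_bounds r C c0.
have [lo' [hi' [_ b']]] := powR_itv_bounds r^-1 hi lo0.
have mu0 := measurable_funpowR r ma.
have ub0 x : lo <= a x `^ r <= hi by exact: b.
have ub n := iter_average_itv psi Hlambda n ub0.
have bu n := @bfun_iter_average _ _ _ _ _ lambda pp _ n (bfun_itv mu0 ub0).
have [h [mh hb uh Eh]] := iter_average_cvg Hphi Hlambda mu0 ub0.
have mTr := measurable_funpowR r mT.
have Eh' : is_invariant_expectation mu phi (fun y => absT y `^ r) h.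
  apply: is_invariant_expectation_ae Eh => //.
  by apply: filterS Ta => x ->.
(* The ergodic limit [h] shows that the set behind [xget] is inhabited, so its value is a true
   expectation and not the default. *)
have EE : is_invariant_expectation mu phi (fun y => absT y `^ r)
    (invariant_expectation mu phi (fun y => absT y `^ r)).
  by rewrite /invariant_expectation; apply: (@xgetPex _ _ [set k |
    is_invariant_expectation mu phi (fun y => absT y `^ r) k]); exists h.
have mE := Linfty_toC_measurable (let: And3 L _ _ := EE in L).
have hE := invariant_expectation_unique Hphi EE Eh'.
have bhq := bfun_itv (measurable_funpowR r^-1 mh) (fun x => b' _ (hb x)).
(* The chosen expectation is determined only up to a null set; the limit operator is rewritten with
   the bounded representative built from [h]. *)
rewrite (cp_pi_ae Hphi (measurable_funpowR r^-1 mE) bhq); last first.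
  by apply: filterS hE => x ->.
rewrite (_ : (fun n => _) = (fun n => cp_shift mu \o
    mulL (nu := XZmeasure mu) (zlift phi psi (fun x =>
    iter n (average psi lambda) (fun x => a x `^ r) x `^ r^-1)))); last first.
  by apply/funext => n; exact: (iter_induced_aluthge Hphi n ma c0 acC).
apply: (sot_cvg_shift_mulL Hphi (lo := lo') (hi := hi')).
- by move=> n; exact: measurable_funpowR (bu n).1.
- by move=> n x; exact: b' (ub n x).
- exact: measurable_funpowR.
- by move=> x; exact: b' (hb x).
- by apply: (sqint_powR_cvg r^-1 lo0 _ ub mh hb uh) => n; exact: (bu n).1.
Qed.
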